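(* Let $\psi\in C^0([0,1])$ satisfy $\psi(x)=\psi(1-x)$ for all $x\in(0,1)$, $\psi(0)=\psi(1)<0$, and $\psi(x_0)>0$ for some $x_0\in(0,1)$. Assume that there exists a minimiser $u\in\mathcal M(\psi)$ of $W$, i.e. $W(u)=\inf_{v\in\mathcal M(\psi)}W(v)$. Then $$\forall x\in[0,1]:\quad \psi(x)\le\max_{y\in[0,\infty]}\frac{1+(1+y^2)^{-1/4}}{c_0-G(y)}=1.1890464540\ldots$$
   Context: For $v\in H^2(0,1)$ the elastica functional is $$W(v)=\int_0^1\frac{v''(x)^2}{(1+v'(x)^2)^{5/2}}\,dx .$$ The admissible set is $$\mathcal M(\psi)=\{v\in H^2_0(0,1)\mid v(x)=v(1-x),\ v(x)\ge\psi(x)\ \text{for all }x\in(0,1)\},$$ where $H^2_0(0,1)$ is the set of $v\in H^2(0,1)$ with $v(0)=v(1)=0$ and $v'(0)=v'(1)=0$. Moreover $$c_0=\int_{\mathbb R}\frac{d\tau}{(1+\tau^2)^{5/4}}=\sqrt\pi\,\frac{\Gamma(3/4)}{\Gamma(5/4)},\qquad G:\mathbb R\to\left(-\frac{c_0}{2},\frac{c_0}{2}\right),\quad G(t)=\int_0^t\frac{d\tau}{(1+\tau^2)^{5/4}} .$$ At $y=\infty$ the quotient is understood as its limit as $y\to\infty$ (with $G(\infty)=c_0/2$).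
   Formalization: The printed value 1.1890464540… is not exact in its last places (the maximum is 1.18904645389…); the formal theorem instead asserts that the maximum differs from 1.1890464540 by less than 2·10^(-10). *)

(* Defs.v *)
From HB Require Import structures.
From mathcomp Require Import all_boot all_order all_algebra.
From mathcomp Require Import all_classical all_reals all_analysis.

Set Implicit Arguments.
Unset Strict Implicit.
Unset Printing Implicit Defensive.
Import Order.TTheory GRing.Theory Num.Theory.
Import numFieldNormedType.Exports.

Local Open Scope classical_set_scope.
Local Open Scope ring_scope.

(* Functions on (0,1) or [0,1] are total functions R -> R; every notion below
   depends only on their restriction to the interval. *)

Definition C1c01 (R : realType) (phi : R -> R) : Prop :=
  [/\ forall x, derivable phi x 1,
      continuous (derive1 phi),
      compact (closure [set x | phi x != 0])
    & closure [set x | phi x != 0] `<=` `]0, 1[ ].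

Definition L2_01 (R : realType) (f : R -> R) : Prop :=
  (f \_ `]0, 1[ : measurableTypeR R -> R) \in Lfun (@lebesgue_measure R) 2%:E.

(* In dimension one, C^1_c and C^infty_c test functions give the same notion. *)
Definition weak_derivative01 (R : realType) (v w : R -> R) : Prop :=
  forall phi : R -> R, C1c01 phi ->
    \int[lebesgue_measure]_(x in `]0, 1[) (v x * derive1 phi x) =
    - \int[lebesgue_measure]_(x in `]0, 1[) (w x * phi x).

Definition H1_01 (R : realType) (v : R -> R) : Prop :=
  L2_01 v /\ exists w, L2_01 w /\ weak_derivative01 v w.

(* Some square-integrable weak derivative of v; it is determined only up to a
   null set, and it is 0 when v has none. *)
Definition wD (R : realType) (v : R -> R) : R -> R :=
  xget (cst 0) [set w | L2_01 w /\ weak_derivative01 v w].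

(* An element of H^2(0,1) is identified with its continuous representative on
   [0,1], which gives a meaning to its pointwise values. *)
Definition H2_01 (R : realType) (v : R -> R) : Prop :=
  [/\ {within `[0, 1], continuous v}, H1_01 v & H1_01 (wD v)].

(* The boundary values of v' are those of its continuous representative p. *)
Definition H20_01 (R : realType) (v : R -> R) : Prop :=
  [/\ H2_01 v, v 0 = 0, v 1 = 0
    & exists p : R -> R, [/\ {within `[0, 1], continuous p},
        weak_derivative01 v p, p 0 = 0 & p 1 = 0]].

Definition elastica (R : realType) (v : R -> R) : \bar R :=
  (\int[lebesgue_measure]_(x in `]0%R, 1%R[)
    ((wD (wD v) x ^+ 2) / ((1 + wD v x ^+ 2) `^ (5 / 2)))%:E)%E.

Definition admissible (R : realType) (psi : R -> R) : set (R -> R) :=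
  [set v | [/\ H20_01 v,
               forall x, 0 < x < 1 -> v x = v (1 - x)
             & forall x, 0 < x < 1 -> psi x <= v x]].

Definition c0 (R : realType) : R :=
  \int[lebesgue_measure]_tau ((1 + tau ^+ 2) `^ (5 / 4))^-1.

Definition G (R : realType) (t : R) : R :=
  if 0 <= t
  then \int[lebesgue_measure]_(tau in `[0, t]) ((1 + tau ^+ 2) `^ (5 / 4))^-1
  else - \int[lebesgue_measure]_(tau in `[t, 0]) ((1 + tau ^+ 2) `^ (5 / 4))^-1.

Definition quot (R : realType) (y : R) : R :=
  (1 + (1 + y ^+ 2) `^ (- (1 / 4))) / (c0 R - G y).

(* The value at -oo is never used. *)
Definition quot_ext (R : realType) (y : \bar R) : R :=
  match y with
  | y'%:E => quot y'
  | +oo%E => lim (quot t @[t --> +oo%R])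
  | -oo%E => 0
  end.

Definition is_maximum (R : realType) (A : set R) (m : R) : Prop :=
  A m /\ ubound A m.

(* Main.v *)
(* With p = u' the elastic energy is the integral of ((G o p)')^2.  Let
   L <= 1/2 be a maximum point of u, so that p(L) = 0, and let the line through
   (L, c0) of slope sigma touch the graph of G o p on [0, L] from above, at
   alpha; let it start at G(y0), so that sigma L = c0 - G(y0).
   - Before alpha the slope p lies below G^-1 of the line, hence
     u(alpha) <= (2/sigma) (q(y0) - q(p(alpha))) with q(t) = (1 + t^2)^(-1/4).
   - Replacing p on [alpha, L] by a function that follows the line up to nearly
     infinite slope and then returns to 0 gives an admissible competitor; by
     minimality the energy of u on [alpha, L] and its mirror image is at most
     2 sigma^2 (L - alpha).
   - A calibration bounds this energy from below.  With m the maximum of p on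
     [alpha, L] and Psi' = sqrt(1 - p^+/m) G', the inequality
     (k G')^2 + sigma^2 (1 - p^+/m) >= 2 sigma |Psi'(p) k|, where k = p', yields
     u(L) - u(alpha) <= (2/sigma) (1 + q(p(alpha))).
   The sum is max u <= 2 L (1 + q(y0)) / (c0 - G(y0)), and 2 L <= 1.
   The quotient is maximal where y is twice its value; the digits come from
   truncated series for G(1) and c0/2 - G. *)
Require Import Defs.
From Stdlib Require Import BinPos.
From HB Require Import structures.
From mathcomp Require Import all_boot all_order all_algebra.
From mathcomp Require Import all_classical all_reals all_analysis.
From mathcomp Require Import measurable_realfun zify ssrZ ring lra.
From Stdlib Require QArith.

Set Implicit Arguments.
Unset Strict Implicit.
Unset Printing Implicit Defensive.
Import Order.TTheory GRing.Theory Num.Theory.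
Import numFieldNormedType.Exports.

Local Open Scope classical_set_scope.
Local Open Scope ring_scope.

(** * Derivatives and integrals *)

(** The height c0 at L is the height 0 reflected in c0 / 2, the limit of G at infinity: rising from
    G(p(alpha)) to c0 / 2 and falling back to 0 covers the length c0 - G(p(alpha)) = sigma (L -
    alpha). The touching line is thus the unfolded profile of constant speed sigma, whose energy on
    [alpha, L] is sigma^2 (L - alpha). Since G is bounded, an almost infinite slope has finite cost;
    kept over a short length it lifts the competitor above u, so the obstacle imposes nothing there,
    and touching from above keeps the competitor above u on the way up.

    Minimality controls an energy, whereas a height is wanted. The weight 1 - p^+/m converts the
    integral of p into u(L) - u(alpha). The slope p need not be monotone and may change sign, so the
    interval is cut where p attains its maximum m, and only m and p(alpha) survive. The resulting
    bound is free of m, and its term q(p(alpha)) cancels against the bound before alpha. *)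

Lemma der_eq (R : realType) (f : R -> R) (x d e : R) :
  is_derive x 1 f d -> d = e -> is_derive x 1 f e.
Proof. by move=> h <-. Qed.

Lemma derD (R : realType) (f g : R -> R) (x df dg : R) :
  is_derive x 1 f df -> is_derive x 1 g dg ->
  is_derive x 1 (fun t => f t + g t) (df + dg).
Proof. exact: is_deriveD. Qed.

Lemma derN (R : realType) (f : R -> R) (x df : R) :
  is_derive x 1 f df -> is_derive x 1 (fun t => - f t) (- df).
Proof. exact: is_deriveN. Qed.

Lemma derM (R : realType) (f g : R -> R) (x df dg : R) :
  is_derive x 1 f df -> is_derive x 1 g dg ->
  is_derive x 1 (fun t => f t * g t) (f x * dg + g x * df).
Proof. exact: is_deriveM. Qed.

Lemma derX (R : realType) (f : R -> R) (n : nat) (x df : R) :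
  is_derive x 1 f df ->
  is_derive x 1 (fun t => f t ^+ n) (n%:R * f x ^+ n.-1 * df).
Proof.
move=> h; have := @is_deriveX _ _ f n x 1 df h.
by rewrite (_ : f ^+ n = fun t => f t ^+ n)//; apply/funext => t; rewrite exprfctE.
Qed.

Lemma der_comp (R : realType) (f g : R -> R) (x df dg : R) :
  is_derive (g x) 1 f df -> is_derive x 1 g dg ->
  is_derive x 1 (fun t => f (g t)) (df * dg).
Proof. by move=> hf hg; apply: (@is_derive1_comp _ f g x df dg). Qed.

Lemma der_cst (R : realType) (c x : R) : is_derive x 1 (fun _ => c) 0.
Proof. exact: is_derive_cst. Qed.

Lemma der_id (R : realType) (x : R) : is_derive x 1 (fun t => t) 1.
Proof. exact: is_derive_id. Qed.

Lemma derV (R : realType) (x : R) : x != 0 ->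
  is_derive x 1 (fun t => t^-1) (- x ^- 2).
Proof.
move=> x0; apply: der_eq (@is_deriveV _ id x 1 1 x0 (is_derive_id x 1)) _.
by rewrite scaler1.
Qed.

Ltac der1 := first [ eassumption | notypeclasses refine (der_cst _ _)
  | notypeclasses refine (der_id _) | notypeclasses refine (derD _ _)
  | notypeclasses refine (derN _) | notypeclasses refine (derX _ _)
  | notypeclasses refine (derM _ _) ].
Ltac der := notypeclasses refine (der_eq _ _); [repeat der1 | cbv beta].

Lemma der_continuous (R : realType) (f : R -> R) (x d : R) :
  is_derive x 1 f d -> {for x, continuous f}.
Proof.
move=> h; apply: differentiable_continuous; apply/derivable1_diffP.
exact: ex_derive.
Qed.

Lemma der_within_itv (R : realType) (f df : R -> R) (a b : R) :
  (forall x : R, a <= x <= b -> is_derive x 1 f (df x)) ->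
  {within `[a, b], continuous f}.
Proof.
move=> h; apply: derivable_within_continuous => x; rewrite in_itv/= => xab.
by have [] := h x xab.
Qed.

Lemma der_MVT (R : realType) (f df : R -> R) (a b : R) : a < b ->
  (forall x : R, a <= x <= b -> is_derive x 1 f (df x)) ->
  exists2 c, a < c < b & f b - f a = df c * (b - a).
Proof.
move=> ab h; have cf := der_within_itv h.
have [x|c] := @MVT _ f df a b ab _ cf; rewrite in_itv/=; last by exists c.
by move=> /andP[ax xb]; apply: h; rewrite !ltW.
Qed.

Lemma der_le0 (R : realType) (f df : R -> R) (a b : R) : a <= b ->
  (forall x : R, a <= x <= b -> is_derive x 1 f (df x)) ->
  (forall x, a < x < b -> df x <= 0) -> f b <= f a.
Proof.
rewrite le_eqVlt => /predU1P[->//|ab] h n.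
have [c cab e] := der_MVT ab h.
by rewrite -subr_le0 e mulr_le0_ge0 ?n// subr_ge0 ltW.
Qed.

Lemma der_ge0 (R : realType) (f df : R -> R) (a b : R) : a <= b ->
  (forall x : R, a <= x <= b -> is_derive x 1 f (df x)) ->
  (forall x, a < x < b -> 0 <= df x) -> f a <= f b.
Proof.
rewrite le_eqVlt => /predU1P[->//|ab] h n.
have [c cab e] := der_MVT ab h.
by rewrite -subr_ge0 e mulr_ge0 ?n// subr_ge0 ltW.
Qed.

Lemma der_gt0 (R : realType) (f df : R -> R) (a b : R) : a < b ->
  (forall x : R, a <= x <= b -> is_derive x 1 f (df x)) ->
  (forall x, a < x < b -> 0 < df x) -> f a < f b.
Proof.
move=> ab h n; have [c cab e] := der_MVT ab h.
by rewrite -subr_gt0 e mulr_gt0 ?n// subr_gt0.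
Qed.

Lemma continuous_integrable (R : realType) (f : R -> R) (a b : R) :
  continuous f -> (@lebesgue_measure R).-integrable `[a, b] (EFin \o f).
Proof.
move=> cf; apply: continuous_compact_integrable; first exact: segment_compact.
exact: continuous_subspaceT.
Qed.

Lemma integral_der_itv (R : realType) (F f : R -> R) (a b : R) : a <= b ->
  {within `[a, b], continuous f} ->
  (forall x : R, a <= x <= b -> is_derive x 1 F (f x)) ->
  \int[lebesgue_measure]_(t in `[a, b]) f t = F b - F a.
Proof.
rewrite le_eqVlt => /predU1P[<- cf dF|ab cf dF].
  by rewrite set_itv1 Rintegral_set1 subrr.
have dF' x : x \in `]a, b[ -> is_derive x 1 F (f x).
  by rewrite in_itv/= => /andP[ax xb]; apply: dF; rewrite !ltW.
rewrite /Rintegral (@continuous_FTC2 _ f F)//.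
- split=> [x /dF'[]//||].
  + by apply: cvg_at_right_filter; apply: der_continuous (dF a _); rewrite lexx ltW.
  + by apply: cvg_at_left_filter; apply: der_continuous (dF b _); rewrite lexx ltW.
- by move=> x /dF'; rewrite derive1E => -[_ ->].
Qed.

Lemma integral_der (R : realType) (F f : R -> R) (a b : R) : a <= b ->
  continuous f -> (forall x : R, is_derive x 1 F (f x)) ->
  \int[lebesgue_measure]_(t in `[a, b]) f t = F b - F a.
Proof. by move=> ab cf dF; apply: integral_der_itv => //; exact: continuous_subspaceT. Qed.

Lemma near_gt (R : realType) (c x : R) : c < x -> \forall y \near x, c < y.
Proof. by move=> cx; apply: open_nbhs_nbhs; split=> //; exact: open_gt. Qed.

Lemma near_lt (R : realType) (c x : R) : x < c -> \forall y \near x, y < c.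
Proof. by move=> cx; apply: open_nbhs_nbhs; split=> //; exact: open_lt. Qed.

(* The base point -(|x|+1) makes both signs of x interior to the interval of
   integration. *)
Lemma antiderivative (R : realType) (f : R -> R) : continuous f ->
  exists F : R -> R, F 0 = 0 /\ forall x : R, is_derive x 1 F (f x).
Proof.
move=> cf.
pose mu := @lebesgue_measure R.
pose P c x := \int[mu]_(t in `[c, x]) f t.
have split (c a b : R) : c <= a -> a <= b -> P c b - P c a = \int[mu]_(t in `[a, b]) f t.
  move=> ca ab; rewrite /P (@Rintegral_itvB _ _ (BLeft c) (BRight b) a) ?bnd_simp//.
    rewrite Rintegral_itv_obnd_cbnd//.
    apply: integrableS (continuous_integrable a b cf) => //.
    exact: subset_itv_oc_cc.
  exact: continuous_integrable.
have dP (c x : R) : c < x -> is_derive x 1 (P c) (f x).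
  move=> cx; have x1 : x < x + 1 by rewrite ltrDl.
  have [d1 d2] := @continuous_FTC1_closed _ f c x (x + 1) x1
    (continuous_integrable c (x + 1) cf) cx (cf x).
  by apply: DeriveDef => //; rewrite -derive1E d2.
pose F x := P (- (`|x| + 1)) x - P (- (`|x| + 1)) 0.
have Fe (c x : R) : c <= 0 -> c <= x -> F x = P c x - P c 0.
  move=> c0 cx.
  have aux (c1 c2 : R) : c1 <= c2 -> c2 <= 0 -> c2 <= x -> P c1 x - P c1 0 = P c2 x - P c2 0.
    move=> c12 c20 c2x; have [x0|x0] := leP 0 x.
      by rewrite !split// (le_trans c12).
    apply: oppr_inj; rewrite !opprB !split// ?(le_trans c12)//; exact: ltW.
  have n0 : - (`|x| + 1) <= 0 by rewrite oppr_le0 addr_ge0.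
  have nx : - (`|x| + 1) <= x.
    by rewrite lerNl (le_trans (ler_norm _))// normrN lerDl.
  rewrite /F; have [h|/ltW h] := leP c (- (`|x| + 1)); last exact: aux.
  by rewrite -(aux c).
exists F; split=> [|x]; first by rewrite /F subrr.
pose c := - (`|x| + 2).
have cx : c < x.
  by rewrite /c; have := ler_norm (- x); rewrite normrN; lra.
have c0 : c <= 0 by rewrite /c; have := normr_ge0 x; lra.
have h : is_derive x 1 (fun y => P c y - P c 0) (f x).
  have := dP c x cx; move=> ?; der; lra.
apply: DeriveDef; last first.
  rewrite -(@derive_val _ _ _ _ _ _ _ h).
  apply: near_eq_derive; rewrite ?oner_eq0//.
  near=> y; apply: Fe => //; apply/ltW; near: y.
  exact: near_gt.
apply: near_eq_derivable (@ex_derive _ _ _ _ _ _ _ h); rewrite ?oner_eq0//.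
near=> y; apply/esym; apply: Fe => //; apply/ltW; near: y.
exact: near_gt.
Unshelve. all: by end_near. Qed.

(** * The functions (1 + t^2)^(-1/4) and G *)

Definition qf (R : realType) (t : R) : R := (1 + t ^+ 2) `^ (- (1 / 4)).

Lemma sqrp1_gt0 (R : realType) (t : R) : 0 < 1 + t ^+ 2.
Proof. by rewrite ltr_wpDr// sqr_ge0. Qed.

Lemma qf_gt0 (R : realType) (t : R) : 0 < qf t.
Proof. exact/powR_gt0/sqrp1_gt0. Qed.

Lemma qf0 (R : realType) : qf (0 : R) = 1.
Proof. by rewrite /qf expr0n/= addr0 powR1. Qed.

Lemma qfN (R : realType) (t : R) : qf (- t) = qf t.
Proof. by rewrite /qf sqrrN. Qed.

Lemma qf4 (R : realType) (t : R) : qf t ^+ 4 * (1 + t ^+ 2) = 1.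
Proof.
have t0 := sqrp1_gt0 t.
rewrite /qf -powR_mulrn ?powR_ge0// -powRrM.
rewrite (_ : - (1 / 4) * 4%:R = - 1); last by field.
by rewrite powR_inv1 ?ltW// mulVf// gt_eqF.
Qed.

Lemma qf_le1 (R : realType) (t : R) : qf t <= 1.
Proof.
rewrite leNgt; apply/negP => q1.
have : 1 < qf t ^+ 4 by rewrite exprn_egt1.
have := sqr_ge0 t; have := qf4 t; nra.
Qed.

Lemma powR54 (R : realType) (t : R) : ((1 + t ^+ 2) `^ (5 / 4))^-1 = qf t ^+ 5.
Proof.
rewrite /qf -[RHS]powR_mulrn ?powR_ge0// -powRrM -powRN; congr powR; by field.
Qed.

Lemma powR52 (R : realType) (t : R) : ((1 + t ^+ 2) `^ (5 / 2))^-1 = qf t ^+ 10.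
Proof.
rewrite /qf -[RHS]powR_mulrn ?powR_ge0// -powRrM -powRN; congr powR; by field.
Qed.

Lemma der_qf (R : realType) (x : R) : is_derive x 1 (@qf R) (- (x / 2) * qf x ^+ 5).
Proof.
have h : is_derive x 1 (fun t : R => 1 + t ^+ 2) (2 * x) by der; rewrite /=; ring.
have h2 := is_derive1_powR (- (1 / 4)) (sqrp1_gt0 x).
apply: der_eq (@der_comp _ (fun z => z `^ (- (1 / 4))) (fun t => 1 + t ^+ 2) _ _ _ h2 h) _.
rewrite (_ : _ - 1 = - (1 / 4) * 5%:R); last by field.
rewrite powRrM powR_mulrn ?powR_ge0// -/(qf x); by field.
Qed.

Lemma continuous_qf (R : realType) : continuous (@qf R).
Proof. by move=> x; exact: der_continuous (der_qf x). Qed.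

Lemma continuous_qfX (R : realType) n : continuous (fun t : R => qf t ^+ n).
Proof.
move=> x; have h := der_qf x.
exact: der_continuous (derX n h).
Qed.

Lemma G_antiderivative (R : realType) : G (0 : R) = 0 /\
  forall x : R, is_derive x 1 (@G R) (qf x ^+ 5).
Proof.
have [H [H0 dH]] := antiderivative (@continuous_qfX R 5).
have E a b : a <= b ->
    \int[lebesgue_measure]_(t in `[a, b]) ((1 + t ^+ 2) `^ (5 / 4))^-1 = H b - H a.
  move=> ab; rewrite -(integral_der ab (@continuous_qfX R 5) dH).
  by apply: eq_Rintegral => t _; rewrite powR54.
suff -> : @G R = H by [].
apply/funext => t; rewrite /G; case: leP => t0; first by rewrite E// H0 subr0.
by rewrite E ?ltW// H0 sub0r opprK.
Qed.

Lemma G0 (R : realType) : G (0 : R) = 0. Proof. by have [] := G_antiderivative R. Qed.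

Lemma der_G (R : realType) (x : R) : is_derive x 1 (@G R) (qf x ^+ 5).
Proof. by have [] := G_antiderivative R. Qed.

Lemma continuous_G (R : realType) : continuous (@G R).
Proof. by move=> x; exact: der_continuous (der_G x). Qed.

Lemma G_lt (R : realType) : {mono @G R : x y / x < y}.
Proof.
apply: leW_mono; apply: le_mono => x y xy.
by apply: der_gt0 xy (fun x _ => der_G x) _ => z _; rewrite exprn_gt0// qf_gt0.
Qed.

Lemma G_le (R : realType) : {mono @G R : x y / x <= y}.
Proof.
apply: le_mono => x y xy.
by apply: der_gt0 xy (fun x _ => der_G x) _ => z _; rewrite exprn_gt0// qf_gt0.
Qed.

Lemma G_ge0 (R : realType) (x : R) : 0 <= x -> 0 <= G x.
Proof. by move=> x0; rewrite -(G0 R) G_le. Qed.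

Lemma qf_nonincr (R : realType) (x y : R) : 0 <= x -> x <= y -> qf y <= qf x.
Proof.
move=> x0 xy; apply: der_le0 xy (fun x _ => der_qf x) _ => z /andP[xz _].
rewrite mulNr oppr_le0 mulr_ge0// ?exprn_ge0// ?ltW ?qf_gt0//.
by rewrite divr_gt0// (le_lt_trans x0).
Qed.

Lemma G_bounded (R : realType) : has_ubound (range (@G R)).
Proof.
exists (G 1 + 2 * qf 1) => _ [t _ <-].
have q1 := qf_gt0 (1 : R); have qt := qf_gt0 t.
have [t1|/ltW t1] := leP t 1.
  have : G t <= G 1 by rewrite G_le.
  lra.
(* Beyond 1, [2 * qf] falls at least as fast as [G] grows: the sum has derivative
   [qf x ^+ 5 * (1 - x)]. *)
have : G t + 2 * qf t <= G 1 + 2 * qf 1.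
  have hd (x : R) : is_derive x 1 (fun t => G t + 2 * qf t) (qf x ^+ 5 * (1 - x)).
    by have hG := der_G x; have hq := der_qf x; der; field.
  apply: der_le0 t1 (fun x _ => hd x) _ => x; move=> /andP[x1 _].
  have := qf_gt0 x => /(exprn_gt0 5); nra.
lra.
Qed.

(** The integrand of [c0] is even, so half of [c0] is the integral over the half line; the improper
    fundamental theorem identifies it with the supremum of the increasing function [G], which is its
    limit. *)
Lemma cvg_G (R : realType) : G t @[t --> +oo] --> c0 R / 2.
Proof.
have ndG : nondecreasing_fun (@G R) by move=> x y xy; rewrite G_le.
have cG := nondecreasing_cvgr ndG (@G_bounded R).
suff -> : c0 R / 2 = sup (range (@G R)) by [].
rewrite /c0 /Rintegral.
have -> : (fun t : R => (((1 + t ^+ 2) `^ (5 / 4))^-1)%:E) = fun t => (qf t ^+ 5)%:E.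
  by apply/funext => t; rewrite powR54.
rewrite ge0_symfun_integralT; last 3 first.
- by move=> x; rewrite exprn_ge0// ltW// qf_gt0.
- exact: continuous_qfX.
- by move=> x; rewrite /= qfN.
rewrite -set_itvcy (@ge0_continuous_FTC2y _ _ (@G R) 0 (sup (range (@G R)))) //=.
- by rewrite G0 subr0 mulrC mulKf.
- by move=> x _; rewrite exprn_ge0// ltW// qf_gt0.
- by apply: continuous_subspaceT; exact: continuous_qfX.
- by move=> x _; have [] := der_G x.
- by apply: cvg_at_right_filter; exact: continuous_G.
- by move=> x _; rewrite derive1E; have [_ ->] := der_G x.
Qed.

Lemma G_lt_c0 (R : realType) (t : R) : G t < c0 R / 2.
Proof.
apply: (@lt_le_trans _ _ (G (t + 1))); first by rewrite G_lt ltrDl.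
apply: cvgr_to_ge (@cvg_G R) _.
near=> x; rewrite G_le; near: x; exact: nbhs_pinfty_ge (num_real _).
Unshelve. all: by end_near. Qed.

Lemma c0_gt0 (R : realType) : 0 < c0 R.
Proof. by have := G_lt_c0 (0 : R); rewrite G0; lra. Qed.

Lemma G_surj (R : realType) (w : R) : 0 <= w -> w < c0 R / 2 ->
  exists2 y, 0 <= y & G y = w.
Proof.
move=> w0 wc; have [z [z0 wz]] : exists z, 0 <= z /\ w < G z.
  near (+oo : set_system R) => z; exists z; split.
    by near: z; exact: nbhs_pinfty_ge (num_real _).
  by near: z; exact: (cvgr_gt _ (@cvg_G R) _ wc).
have [||y yz <-] := @IVT _ (@G R) 0 z w z0.
- by apply: continuous_subspaceT; exact: continuous_G.
- by rewrite G0 ge_min w0 /= le_max (ltW wz) orbT.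
by exists y => //; move: yz; rewrite in_itv/= => /andP[].
Unshelve. all: by end_near. Qed.

(** * The inverse of [G], and limits at infinity *)

Definition Ginv (R : realType) (w : R) : R := xget 0 [set y | G y = w].

Lemma GK (R : realType) : cancel (@G R) (@Ginv R).
Proof.
move=> y; rewrite /Ginv; case: xgetP => [z _ /= h|/(_ y)/(_ erefl)//].
by apply: le_anti; rewrite -(G_le z) -(G_le y) h lexx.
Qed.

Lemma GinvK (R : realType) (w : R) : 0 <= w < c0 R / 2 -> G (Ginv w) = w.
Proof. by case/andP => w0 wc; have [y _ <-] := G_surj w0 wc; rewrite GK. Qed.

Lemma Ginv_ge0 (R : realType) (w : R) : 0 <= w < c0 R / 2 -> 0 <= Ginv w.
Proof. by case/andP => w0 wc; have [y y0 <-] := G_surj w0 wc; rewrite GK. Qed.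

Lemma der_Ginv (R : realType) (w : R) : 0 <= w < c0 R / 2 ->
  is_derive w 1 (@Ginv R) (qf (Ginv w) ^- 5).
Proof.
case/andP => w0 wc; have [y _ <-] := G_surj w0 wc; rewrite GK.
apply: is_derive_inverse (der_G y) _.
- by near=> z; exact: GK.
- by near=> z; exact: continuous_G.
- by rewrite gt_eqF// exprn_gt0// qf_gt0.
Unshelve. all: by end_near. Qed.

Lemma cvg_qf (R : realType) : @qf R t @[t --> +oo] --> (0 : R).
Proof.
apply/cvgrPdist_lt => e e0; near=> t.
rewrite sub0r normrN gtr0_norm ?qf_gt0// ltNge; apply/negP => eq.
(* If [e <= qf t], then [e ^+ 4 * (1 + t ^+ 2) <= 1] by [qf4], which fails beyond this threshold. *)
have t1 : 1 + e ^- 4 < t by near: t; exact: nbhs_pinfty_gt (num_real _).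
have e4 : e ^+ 4 * e ^- 4 = 1 by rewrite divff// gt_eqF// exprn_gt0.
have : e ^+ 4 <= qf t ^+ 4 by rewrite lerXn2r// nnegrE// ltW// qf_gt0.
have := qf4 t; have := exprn_gt0 4 e0.
have : 0 < e ^- 4 by rewrite invr_gt0 exprn_gt0.
move: e4 t1; move: (e ^- 4) (e ^+ 4) (qf t ^+ 4) => a b c ba t1 a0 b0 c4 bc.
have bt : 1 < b * t by nra.
have : b * t <= c * t by rewrite ler_pM2r//; lra.
have : 0 < c by lra.
nra.
Unshelve. all: by end_near. Qed.

(** Multiples of [qf] vanish at infinity, so an estimate of [G] at finite points with such an error
    passes to its limit. *)
Lemma c0_le (R : realType) (B C a : R) :
  (forall t, a <= t -> G t - C * qf t <= B) -> c0 R / 2 <= B.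
Proof.
move=> h; have cf : G t - C * qf t @[t --> +oo] --> c0 R / 2 - C * 0.
  by apply: cvgB; [exact: cvg_G|apply: cvgMr; exact: cvg_qf].
rewrite mulr0 subr0 in cf; apply: cvgr_to_le cf _.
near=> t; apply: h; near: t; exact: nbhs_pinfty_ge (num_real _).
Unshelve. all: by end_near. Qed.

Lemma c0_ge (R : realType) (B C a : R) :
  (forall t, a <= t -> B <= G t + C * qf t) -> B <= c0 R / 2.
Proof.
move=> h; have cf : G t + C * qf t @[t --> +oo] --> c0 R / 2 + C * 0.
  by apply: cvgD; [exact: cvg_G|apply: cvgMr; exact: cvg_qf].
rewrite mulr0 addr0 in cf; apply: cvgr_to_ge cf _.
near=> t; apply: h; near: t; exact: nbhs_pinfty_ge (num_real _).
Unshelve. all: by end_near. Qed.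

(** * The calibration *)

Definition calib (R : realType) (m x : R) : R := Num.sqrt (1 - Num.max x 0 / m).

Lemma continuous_calib (R : realType) (m : R) : continuous (@calib R m).
Proof.
move=> x; apply: (@cvg_comp _ _ _ (fun x => 1 - Num.max x 0 / m) Num.sqrt
    _ (nbhs (1 - Num.max x 0 / m))).
  apply: cvgB; first exact: cvg_cst.
  apply: cvgMl; apply: continuous_max; first exact: cvg_id.
  exact: cvg_cst.
exact: sqrt_continuous.
Qed.

Lemma calib_ge0 (R : realType) (m x : R) : 0 <= calib m x.
Proof. exact: sqrtr_ge0. Qed.

Lemma calib_sqr (R : realType) (m x : R) : 0 < m -> x <= m ->
  calib m x ^+ 2 = 1 - Num.max x 0 / m.
Proof.
move=> m0 xm; rewrite sqr_sqrtr// subr_ge0 ler_pdivrMr// mul1r ge_max xm.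
exact: ltW.
Qed.

Lemma mul_qf2_le1 (R : realType) (t : R) : 0 <= t -> t * qf t ^+ 2 <= 1.
Proof.
move=> t0; have := qf4 t; have := exprn_gt0 2 (qf_gt0 t).
rewrite (_ : qf t ^+ 4 = (qf t ^+ 2) ^+ 2); last by rewrite -exprM.
move: (qf t ^+ 2) => a a0 e; nra.
Qed.

Lemma mul_qf5_le (R : realType) (t : R) : 0 <= t -> t * qf t ^+ 5 <= qf t.
Proof.
move=> t0; have q0 := qf_gt0 t.
rewrite (_ : t * qf t ^+ 5 = t * qf t ^+ 2 * (qf t ^+ 2) * qf t); last by ring.
rewrite ler_piMl ?(ltW q0)//; apply: mulr_ile1 => //.
- by rewrite mulr_ge0 ?exprn_ge0 ?(ltW q0).
- by rewrite exprn_ge0 ?(ltW q0).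
- exact: mul_qf2_le1.
- by rewrite exprn_ile1 ?(ltW q0) ?qf_le1.
Qed.

(** The function [h] decreases, and far out it is at least [G - qf], which tends to c0 / 2. The term
    [m ^+ 2 / 3 * qf m ^+ 5] is the boundary term produced at [m] by the integration by parts in
    [calibration_origin], where the two cancel. *)
Lemma G_tail (R : realType) (m : R) : 0 < m ->
  m * (c0 R / 2 - G m) <= qf m - m ^+ 2 / 3 * qf m ^+ 5.
Proof.
move=> m0.
pose h (t : R) := G t + qf t / t - t / 3 * qf t ^+ 5.
suff : c0 R / 2 <= h m.
  rewrite /h => H.
  have -> : qf m - m ^+ 2 / 3 * qf m ^+ 5 = m * (qf m / m - m / 3 * qf m ^+ 5).
    by field; rewrite gt_eqF.
  by rewrite ler_pM2l//; lra.
apply: (@c0_le _ _ 1 m) => t mt.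
have t0 : 0 < t by exact: lt_le_trans mt.
apply: (@le_trans _ _ (h t)).
  have qt : 0 <= qf t / t by rewrite divr_ge0 ?ltW ?qf_gt0.
  have := mul_qf5_le (ltW t0); have := qf_gt0 t.
  rewrite /h; lra.
have dh (x : R) : m <= x <= t ->
    is_derive x 1 h (- qf x ^+ 9 * (1 + 11 / 6 * x ^+ 2) / x ^+ 2).
  move=> /andP[mx _]; have x0 : x != 0 by rewrite gt_eqF// (lt_le_trans m0).
  have hG := der_G x; have hq := der_qf x; have hi := derV x0.
  rewrite /h; der; rewrite /=.
  apply/eqP; rewrite -subr_eq0 (_ : _ - _ = (qf x ^+ 4 * (1 + x ^+ 2) - 1) *
    ((qf x + qf x ^+ 5 * (1 + 5 / 6 * x ^+ 2)) / x ^+ 2)); last by field.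
  by rewrite qf4 subrr mul0r.
apply: der_le0 mt dh _ => x /andP[mx _].
have x0 : 0 < x by exact: lt_trans mx.
rewrite !mulNr oppr_le0 divr_ge0 ?sqr_ge0// mulr_ge0 ?exprn_ge0 ?(ltW (qf_gt0 _))//.
by have := sqr_ge0 x; lra.
Qed.

(* With [q = x / m], the function
   [(2/3) q^(-3/2) ((1 - q)^(3/2) - 1) + q^(-1/2)] is a primitive of
   [(1 - sqrt (1 - q) - q / 2) q^(-5/2)] that vanishes at [0]; integrating by
   parts against [x^(5/2) (1 + x^2)^(-5/4)], which increases, leaves a remainder
   of constant sign.  The variable [s] is [sqrt (1 - q)]. *)
Lemma calibration_origin (R : realType) (m : R) (Psi : R -> R) : 0 < m ->
  Psi 0 = 0 ->
  (forall x : R, is_derive x 1 Psi (calib m x * qf x ^+ 5)) ->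
  m * (c0 R / 2 - Psi m) <= 1.
Proof.
move=> m0 Psi0 dPsi.
pose p (s : R) := m * (1 - s ^+ 2).
(* [J] is [m * q ^ (3/2)] times the primitive above, with [q = 1 - s ^+ 2]; the last term of [A] is
   the boundary term of the integration by parts. As [s] runs from 0 to 1, the point [p s] runs from
   [m] back to 0. *)
pose J (s : R) := m * (2 / 3 * (s ^+ 3 - 1) + (1 - s ^+ 2)).
pose A s := m * (G (p s) - Psi (p s)) - (1 - qf (p s)) - p s * J s * qf (p s) ^+ 5.
have dA (s : R) : 0 <= s <= 1 ->
    is_derive s 1 A (5 * m * s * J s * qf (p s) ^+ 9).
  move=> /andP[s0 s1].
  have dp : is_derive s 1 p (- 2 * m * s) by rewrite /p; der; rewrite /=; ring.
  have dJ : is_derive s 1 J (m * (2 * s ^+ 2 - 2 * s)).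
    by rewrite /J; der; rewrite /=; field.
  have hG := der_comp (der_G (p s)) dp.
  have hq := der_comp (der_qf (p s)) dp.
  have hP := der_comp (dPsi (p s)) dp.
  have calibE : calib m (p s) = s.
    rewrite /calib max_l; last by rewrite mulr_ge0 ?(ltW m0)// subr_ge0 exprn_ile1.
    rewrite /p mulrAC divff ?gt_eqF// mul1r opprB addrC subrK.
    by rewrite sqrtr_sqr ger0_norm.
  rewrite calibE in hP.
  rewrite /A; der; rewrite /=.
  apply/eqP; rewrite -subr_eq0 (_ : _ - _ = (qf (p s) ^+ 4 * (1 + p s ^+ 2) - 1) *
    (- 5 * m * s * J s * qf (p s) ^+ 5)).
    by rewrite qf4 subrr mul0r.
  by rewrite /J /p; field.
have A1 : A 1 = 0.
  rewrite /A (_ : p 1 = 0); last by rewrite /p expr1n subrr mulr0.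
  by rewrite G0 Psi0 qf0; ring.
have : A 0 <= A 1.
  apply: der_ge0 ler01 dA _ => s /andP[s0 s1].
  have J0 : 0 <= J s.
    rewrite (_ : J s = m / 3 * ((1 - s) ^+ 2 * (1 + 2 * s))); last by rewrite /J; field.
    rewrite mulr_ge0 ?divr_ge0 ?(ltW m0)// mulr_ge0 ?sqr_ge0//; lra.
  have q9 := exprn_gt0 9 (qf_gt0 (p s)).
  by rewrite mulr_ge0 ?(ltW q9)// mulr_ge0// mulr_ge0 ?(ltW s0)// mulr_ge0 ?(ltW m0).
rewrite A1 /A (_ : p 0 = m); last by rewrite /p expr0n subr0 mulr1.
rewrite (_ : J 0 = m / 3); last by rewrite /J !expr0n/=; field.
have := G_tail m0; lra.
Qed.

(** Twice [calibration_origin] settles [y = 0]. For other [y] it remains to see that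
    [m * (Psi y - G y) - qf y] decreases on [0, m], which is the inequality sqrt(1 - z) <= 1 - z / 2
    at z = x / m. *)
Lemma calibration_bound (R : realType) (m y : R) (Psi : R -> R) : 0 < m ->
  Psi 0 = 0 ->
  (forall x : R, is_derive x 1 Psi (calib m x * qf x ^+ 5)) ->
  0 <= y <= m ->
  m * (c0 R - G y - 2 * Psi m + Psi y) <= 1 + qf y.
Proof.
move=> m0 Psi0 dPsi /andP[y0 ym].
have := calibration_origin m0 Psi0 dPsi.
have : m * (Psi y - G y) - qf y <= m * (Psi 0 - G 0) - qf 0.
  pose df x := qf x ^+ 5 * (m * calib m x - m + x / 2).
  have dF (x : R) : is_derive x 1 (fun y => m * (Psi y - G y) - qf y) (df x).
    have hP := dPsi x; have hG := der_G x; have hq := der_qf x.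
    by der; rewrite /df; field.
  apply: der_le0 y0 (fun x _ => dF x) _ => x /andP[x0 xy].
  have q0 := exprn_gt0 5 (qf_gt0 x).
  rewrite /df pmulr_rle0//.
  have := calib_ge0 m x; have := calib_sqr m0 (ltW (lt_le_trans xy ym)).
  rewrite max_l; last exact: ltW.
  have xE : x = m * (x / m) by field; rewrite gt_eqF.
  move: (x / m) (calib m x) xE => z s xE zE s0.
  have : s <= 1 - z / 2 by have := sqr_ge0 (1 - s); nra.
  move=> h; have : m * (s - 1 + z / 2) <= 0 by rewrite pmulr_rle0//; lra.
  by rewrite {1}xE; lra.
rewrite Psi0 G0 qf0; lra.
Qed.

(** * Maximum of the quotient *)

(* Horner evaluation of the truncation of
   [sum_n y^n prod_(k < n) (5 + 4 k) / prod_(k <= n) ((a + 4 k) / 2)],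
   started at index [n]; the last coefficient is replaced by [b]. *)
Fixpoint horn (R : realType) (b : R) (a : nat) (y : R) (N n : nat) : R :=
  if N is N'.+1 then
    (2 + (5 + 4 * n)%:R * y * horn b a y N' n.+1) / (a + 4 * n)%:R
  else b.

(** Integrated from t to infinity, this expresses the integral of q^5 X^n, X = q^4, through that of
    q^5 X^(n+1). Iterated from n = 0, it expands c0 / 2 - G(t) in powers of X = 1 / (1 + t^2). *)
Lemma der_tail_term (R : realType) (n : nat) (t : R) :
  is_derive t 1 (fun t => t * qf t ^+ 5 * (qf t ^+ 4) ^+ n)
    (qf t ^+ 5 * (qf t ^+ 4) ^+ n *
      (- (3 / 2 + 2 * n%:R) + (5 / 2 + 2 * n%:R) * qf t ^+ 4)).
Proof.
have hq := der_qf t; der.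
case: n => [|n] /=; apply/eqP; rewrite -subr_eq0.
  rewrite (_ : _ - _ = (qf t ^+ 4 * (1 + t ^+ 2) - 1) *
    (- 5 / 2 * qf t ^+ 5)); first by rewrite qf4 subrr mul0r.
  by rewrite !expr0; field.
rewrite ![_ ^+ n.+1]exprS -!natr1.
move: ((qf t ^+ 4) ^+ n) (n%:R : R) => X c.
rewrite (_ : _ - _ = (qf t ^+ 4 * (1 + t ^+ 2) - 1) *
  (- (5 / 2 + 2 * (c + 1)) * qf t ^+ 5 * X * qf t ^+ 4)).
  by rewrite qf4 subrr mul0r.
by field.
Qed.

(** The same recurrence integrated from 0 to t: it expands G(t) in powers of t^2 q^4 = t^2 / (1 +
    t^2). Both variables equal 1 / 2 at t = 1. *)
Lemma der_head_term (R : realType) (n : nat) (t : R) :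
  is_derive t 1 (fun t => t * qf t ^+ 5 * (t ^+ 2 * qf t ^+ 4) ^+ n)
    (qf t ^+ 5 * (t ^+ 2 * qf t ^+ 4) ^+ n *
      (1 + 2 * n%:R - (5 / 2 + 2 * n%:R) * (t ^+ 2 * qf t ^+ 4))).
Proof.
have hq := der_qf t; der.
case: n => [|n] /=; apply/eqP; rewrite -subr_eq0.
  by rewrite !expr0; apply/eqP; field.
rewrite ![_ ^+ n.+1]exprS -!natr1.
move: ((t ^+ 2 * qf t ^+ 4) ^+ n) (n%:R : R) => X c.
by apply/eqP; field.
Qed.

(** Covers both expansions: [e = -1] and [a = 3] for the tail, [e = 1] and [a = 2] for the head.
    Adding up the recurrences telescopes to one remainder, [D] being the product of the ratios of
    coefficients. Its sign is that of the factor containing [b]: with [b = 0] this factor is 1, with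
    [b = 1] it is negative for small [y], so the two choices give bounds from opposite sides. *)
Lemma der_horn (R : realType) (b : R) (a : nat) (y f df : R -> R) (e : R) :
  (0 < a)%N ->
  (forall (n : nat) (t : R), is_derive t 1 (fun t => f t * y t ^+ n)
    (df t * y t ^+ n * (e * ((a%:R / 2 + 2 * n%:R) -
      (5 / 2 + 2 * n%:R) * y t)))) ->
  forall N n, exists2 D, 0 <= D & forall t : R, is_derive t 1
    (fun t => f t * y t ^+ n * horn b a (y t) N n)
    (df t * (e * (y t ^+ n - D * y t ^+ (n + N) *
      (1 - b * (a%:R / 2 + 2 * (n + N)%:R - (5 / 2 + 2 * (n + N)%:R) * y t))))).
Proof.
move=> a0 hf; elim=> [|N IH] n.
  exists 1 => // t; have h := hf n t.
  by rewrite addn0 /=; der; field.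
have [D D0 dD] := IH n.+1.
have an0 : 0 < (a + 4 * n)%:R :> R by rewrite ltr0n addn_gt0 a0.
have an : a%:R + 4 * n%:R != 0 :> R by rewrite -natrM -natrD gt_eqF.
exists (D * ((5 + 4 * n)%:R / (a + 4 * n)%:R)).
  by rewrite mulr_ge0// divr_ge0// ltW.
move=> t; have h1 := hf n t; have := dD t.
rewrite addSnnS => h2.
have -> : (fun t => f t * y t ^+ n * horn b a (y t) N.+1 n) =
    (fun t => 2 / (a + 4 * n)%:R * (f t * y t ^+ n) + (5 + 4 * n)%:R / (a + 4 * n)%:R *
      (f t * y t ^+ n.+1 * horn b a (y t) N n.+1)).
  by apply/funext => s; rewrite /= exprS; field.
by der; rewrite exprS; field.
Qed.

Lemma horn_le (R : realType) (b : R) (a : nat) (x y : R) (N n : nat) :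
  (0 < a)%N -> 0 <= b -> 0 <= x -> x <= y ->
  0 <= horn b a x N n <= horn b a y N n.
Proof.
move=> a0 b0 x0 xy; elim: N n => [|N IH] n; first by rewrite b0 lexx.
have /andP[h0 h] := IH n.+1.
have an0 : 0 < (a + 4 * n)%:R :> R by rewrite ltr0n addn_gt0 a0.
rewrite /= ler_pM2r ?invr_gt0// lerD2l.
rewrite divr_ge0 ?(ltW an0)//=; last by rewrite addr_ge0 ?mulr_ge0.
by apply: ler_pM; rewrite ?mulr_ge0// ler_wpM2l.
Qed.

Lemma der_horn_tail (R : realType) (b : R) (N : nat) :
  exists2 D, 0 <= D & forall t : R, is_derive t 1
    (fun t => G t + t * qf t ^+ 5 * horn b 3 (qf t ^+ 4) N 0)
    (qf t ^+ 5 * (D * (qf t ^+ 4) ^+ N *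
      (1 - b * (3 / 2 + 2 * N%:R - (5 / 2 + 2 * N%:R) * qf t ^+ 4)))).
Proof.
have [||D D0 dD] := @der_horn R b 3 (fun t => qf t ^+ 4) (fun t => t * qf t ^+ 5)
  (fun t => qf t ^+ 5) (- 1) _ _ N 0%N => //.
  by move=> n t; apply: der_eq (der_tail_term n t) _; ring.
exists D => // t; have hG := der_G t; have := dD t; rewrite add0n => hD.
have -> : (fun t => G t + t * qf t ^+ 5 * horn b 3 (qf t ^+ 4) N 0) =
    (fun t => G t + t * qf t ^+ 5 * (qf t ^+ 4) ^+ 0 * horn b 3 (qf t ^+ 4) N 0).
  by apply/funext => s; rewrite expr0 mulr1.
by der; rewrite expr0; ring.
Qed.

Lemma der_horn_head (R : realType) (b : R) (N : nat) :
  exists2 D, 0 <= D & forall t : R, is_derive t 1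
    (fun t => t * qf t ^+ 5 * horn b 2 (t ^+ 2 * qf t ^+ 4) N 0 - G t)
    (- (qf t ^+ 5 * (D * (t ^+ 2 * qf t ^+ 4) ^+ N *
      (1 - b * (1 + 2 * N%:R - (5 / 2 + 2 * N%:R) * (t ^+ 2 * qf t ^+ 4)))))).
Proof.
have [||D D0 dD] := @der_horn R b 2 (fun t => t ^+ 2 * qf t ^+ 4) (fun t => t * qf t ^+ 5)
  (fun t => qf t ^+ 5) 1 _ _ N 0%N => //.
  by move=> n t; apply: der_eq (der_head_term n t) _; field.
exists D => // t; have hG := der_G t; have := dD t; rewrite add0n => hD.
have -> : (fun t => t * qf t ^+ 5 * horn b 2 (t ^+ 2 * qf t ^+ 4) N 0 - G t) =
    (fun t => t * qf t ^+ 5 * (t ^+ 2 * qf t ^+ 4) ^+ 0 *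
       horn b 2 (t ^+ 2 * qf t ^+ 4) N 0 - G t).
  by apply/funext => s; rewrite expr0 mulr1.
by der; rewrite expr0; field.
Qed.

(** With last coefficient 0, [G] plus the truncated series increases, and its limit is c0 / 2: the
    series part is at most [qf] times the value of [horn] at 1, hence vanishes at infinity. *)
Lemma c0_subG_ge_horn (R : realType) (t : R) (N : nat) : 0 <= t ->
  t * qf t ^+ 5 * horn 0 3 (qf t ^+ 4) N 0 <= c0 R / 2 - G t.
Proof.
move=> t0; rewrite lerBrDl; have [D D0 dD] := @der_horn_tail R 0 N.
apply: (@c0_ge _ _ (horn 0 3 1 N 0) t) => s ts.
have s0 : 0 <= s := le_trans t0 ts.
apply: (@le_trans _ _ (G s + s * qf s ^+ 5 * horn 0 3 (qf s ^+ 4) N 0)).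
  apply: der_ge0 ts (fun x _ => dD x) _ => x _.
  by rewrite mul0r subr0 mulr1 mulr_ge0 ?mulr_ge0 ?exprn_ge0 ?(ltW (qf_gt0 _)).
have q4 : 0 <= qf s ^+ 4 <= 1.
  by rewrite exprn_ge0 ?exprn_ile1 ?(ltW (qf_gt0 _))// qf_le1.
case/andP: q4 => q40 q41.
have /andP[h0 h1] := @horn_le R 0 3 _ _ N 0%N isT (lexx 0) q40 q41.
rewrite lerD2l mulrC; apply: ler_pM => //; last exact: mul_qf5_le.
by rewrite mulr_ge0 ?exprn_ge0 ?(ltW (qf_gt0 _)).
Qed.

(** With last coefficient 1 and [qf ^+ 4 <= 1 / 2], the factor that decides the sign is at most 3 /
    4 - N, so [G] plus the series decreases from one term on. *)
Lemma c0_subG_le_horn (R : realType) (t : R) (N : nat) : 0 <= t -> (0 < N)%N ->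
  qf t ^+ 4 <= 1 / 2 ->
  c0 R / 2 - G t <= t * qf t ^+ 5 * horn 1 3 (qf t ^+ 4) N 0.
Proof.
move=> t0 N0 xt; rewrite lerBlDl; have [D D0 dD] := @der_horn_tail R 1 N.
apply: (@c0_le _ _ 0 t) => s ts; rewrite mul0r subr0.
have s0 : 0 <= s := le_trans t0 ts.
have q40 := exprn_ge0 4 (ltW (qf_gt0 s)).
have /andP[h0 _] := @horn_le R 1 3 _ _ N 0%N isT ler01 q40 (lexx _).
apply: (@le_trans _ _ (G s + s * qf s ^+ 5 * horn 1 3 (qf s ^+ 4) N 0)).
  by rewrite lerDl !mulr_ge0 ?exprn_ge0 ?(ltW (qf_gt0 _)).
apply: der_le0 ts (fun x _ => dD x) _ => x /andP[tx xs].
have q5 := exprn_ge0 5 (ltW (qf_gt0 x)).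
rewrite mulr_ge0_le0// mulr_ge0_le0 ?mulr_ge0 ?exprn_ge0 ?(ltW (qf_gt0 _))//.
have : qf x ^+ 4 <= 1 / 2.
  by apply: le_trans xt; rewrite lerXn2r ?nnegrE ?(ltW (qf_gt0 _))// qf_nonincr// ltW.
have : 1 <= N%:R :> R by rewrite ler1n.
move: (qf x ^+ 4) (N%:R : R) => X c; nra.
Qed.

Lemma head_arg_le (R : realType) (x : R) : 0 <= x -> x <= 1 ->
  0 <= x ^+ 2 * qf x ^+ 4 <= 1 / 2.
Proof.
move=> x0 x1; have := qf4 x; have := exprn_gt0 4 (qf_gt0 x).
have := sqr_ge0 x; have : x ^+ 2 <= 1 by rewrite exprn_ile1.
move: (qf x ^+ 4) (x ^+ 2) => a b b1 b0 a0 e; nra.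
Qed.

Lemma G1_ge_horn (R : realType) (N : nat) :
  qf 1 ^+ 5 * horn 0 2 (1 / 2) N 0 <= G (1 : R).
Proof.
have q1 : qf (1 : R) ^+ 4 = 1 / 2 by have := qf4 (1 : R); rewrite expr1n; lra.
have [D D0 dD] := @der_horn_head R 0 N.
have := der_le0 ler01 (fun x _ => dD x).
rewrite expr1n !mul1r !mul0r G0 subrr subr_le0 q1 mul1r; apply=> x _.
rewrite mul0r subr0 mulr1 oppr_le0.
have q5 := exprn_ge0 5 (ltW (qf_gt0 x)).
by apply: mulr_ge0 => //; apply: mulr_ge0 => //; apply/exprn_ge0/mulr_ge0;
  rewrite ?sqr_ge0// exprn_ge0// ltW// qf_gt0.
Qed.

(** On [0, 1] the deciding factor is at most 5 / 4 - N, whence at least two terms. *)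
Lemma G1_le_horn (R : realType) (N : nat) : (1 < N)%N ->
  G (1 : R) <= qf 1 ^+ 5 * horn 1 2 (1 / 2) N 0.
Proof.
move=> N1.
have q1 : qf (1 : R) ^+ 4 = 1 / 2 by have := qf4 (1 : R); rewrite expr1n; lra.
have [D D0 dD] := @der_horn_head R 1 N.
have := der_ge0 ler01 (fun x _ => dD x).
rewrite expr1n !mul1r !mul0r G0 subrr subr_ge0 q1 mul1r; apply=> x /andP[x0 x1].
have q5 := exprn_ge0 5 (ltW (qf_gt0 x)).
have /andP[z0 z1] := head_arg_le (ltW x0) (ltW x1).
rewrite oppr_ge0 mulr_ge0_le0// mulr_ge0_le0 ?mulr_ge0 ?exprn_ge0//.
have : 2 <= N%:R :> R by rewrite ler_nat.
move: (_ * qf x ^+ 4) (N%:R : R) z0 z1 => X c; nra.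
Qed.

(** * Numerical bounds by rational arithmetic *)

(** Binary fractions can be evaluated by computation, real numbers cannot; this embedding carries
    the evaluated truncations back to [R]. *)
Definition ratQ (R : realType) (x : QArith_base.Q) : R :=
  (int_of_Z (QArith_base.Qnum x))%:~R / (int_of_Z (BinInt.Z.pos (QArith_base.Qden x)))%:~R.

Lemma int_of_ZM (a b : BinInt.Z) : int_of_Z (BinInt.Z.mul a b) = int_of_Z a * int_of_Z b.
Proof. by lia. Qed.

Lemma int_of_ZD (a b : BinInt.Z) : int_of_Z (BinInt.Z.add a b) = int_of_Z a + int_of_Z b.
Proof. by lia. Qed.

Lemma int_of_pos_gt0 (R : realType) (p : BinPos.positive) :
  0 < (int_of_Z (BinInt.Z.pos p))%:~R :> R.
Proof. by rewrite ltr0z; lia. Qed.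

Lemma ratQE (R : realType) a p : ratQ R (QArith_base.Qmake a p) =
  (int_of_Z a)%:~R / (int_of_Z (BinInt.Z.pos p))%:~R.
Proof. by []. Qed.

Lemma int_of_posM (p q : BinPos.positive) :
  int_of_Z (BinInt.Z.pos (BinPos.Pos.mul p q)) =
  int_of_Z (BinInt.Z.pos p) * int_of_Z (BinInt.Z.pos q).
Proof. by rewrite -int_of_ZM. Qed.

Lemma ratQD (R : realType) x y :
  ratQ R (QArith_base.Qplus x y) = ratQ R x + ratQ R y.
Proof.
case: x y => [a p] [b q]; rewrite !ratQE int_of_posM int_of_ZD !int_of_ZM.
by rewrite !intrM intrD !intrM; field; rewrite !gt_eqF// int_of_pos_gt0.
Qed.

Lemma ratQM (R : realType) x y :
  ratQ R (QArith_base.Qmult x y) = ratQ R x * ratQ R y.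
Proof.
case: x y => [a p] [b q]; rewrite !ratQE int_of_posM int_of_ZM !intrM.
by field; rewrite !gt_eqF// int_of_pos_gt0.
Qed.

Lemma ratQ_le (R : realType) x y : QArith_base.Qle_bool x y -> ratQ R x <= ratQ R y.
Proof.
case: x y => [a p] [b q]; rewrite !ratQE => h.
rewrite ler_pdivrMr ?int_of_pos_gt0// mulrAC ler_pdivlMr ?int_of_pos_gt0//.
by rewrite -!intrM -!int_of_ZM ler_int; move: h;
  rewrite /QArith_base.Qle_bool; cbn [QArith_base.Qnum QArith_base.Qden]; lia.
Qed.

Lemma ratQ_lt (R : realType) x y : ~~ QArith_base.Qle_bool y x -> ratQ R x < ratQ R y.
Proof.
case: x y => [a p] [b q]; rewrite !ratQE => h.
rewrite ltr_pdivrMr ?int_of_pos_gt0// mulrAC ltr_pdivlMr ?int_of_pos_gt0//.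
by rewrite -!intrM -!int_of_ZM ltr_int; move: h;
  rewrite /QArith_base.Qle_bool; cbn [QArith_base.Qnum QArith_base.Qden]; lia.
Qed.

Definition natQ (n : nat) := QArith_base.inject_Z (BinInt.Z.of_nat n).

Lemma ratQ_nat (R : realType) n : ratQ R (natQ n) = n%:R.
Proof.
rewrite /ratQ /= divr1 (_ : int_of_Z _ = n%:Z) ?pmulrn//; lia.
Qed.

Definition invQ (n : nat) :=
  QArith_base.Qmake (BinInt.Z.pos BinPos.xH) (BinPos.Pos.of_nat n).

Lemma ratQ_inv (R : realType) n : (0 < n)%N -> ratQ R (invQ n) = n%:R^-1.
Proof.
move=> n0; rewrite /invQ ratQE.
rewrite (_ : int_of_Z (BinInt.Z.pos (BinPos.Pos.of_nat n)) = n%:Z); last by lia.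
by rewrite -pmulrn mul1r.
Qed.

Fixpoint hornQ (b : QArith_base.Q) (a : nat) (y : QArith_base.Q) (N n : nat) :=
  if N is N'.+1 then
    QArith_base.Qmult (QArith_base.Qplus (natQ 2)
      (QArith_base.Qmult (QArith_base.Qmult (natQ (5 + 4 * n)) y)
        (hornQ b a y N' n.+1))) (invQ (a + 4 * n))
  else b.

Lemma ratQ_horn (R : realType) b a y N n : (0 < a)%N ->
  ratQ R (hornQ b a y N n) = horn (ratQ R b) a (ratQ R y) N n.
Proof.
move=> a0; elim: N n => [//|N IH] n.
cbn [hornQ horn]; rewrite !(ratQM, ratQD) !ratQ_nat IH ratQ_inv//.
by rewrite addn_gt0 a0.
Qed.

Lemma qf_le (R : realType) (t a : R) :
  0 <= a -> 1 <= a ^+ 4 * (1 + t ^+ 2) -> qf t <= a.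
Proof.
move=> a0 h; rewrite leNgt; apply/negP => qa.
have : a ^+ 4 < qf t ^+ 4 by rewrite ltrXn2r// nnegrE ltW// qf_gt0.
by rewrite -(ltr_pM2r (sqrp1_gt0 t)) qf4 ltNge h.
Qed.

Lemma qf_ge (R : realType) (t a : R) :
  a ^+ 4 * (1 + t ^+ 2) <= 1 -> a <= qf t.
Proof.
move=> h; rewrite leNgt; apply/negP => qa.
have a0 : 0 < a := lt_trans (qf_gt0 t) qa.
have : qf t ^+ 4 < a ^+ 4 by rewrite ltrXn2r ?nnegrE ?ltW ?qf_gt0.
by rewrite -(ltr_pM2r (sqrp1_gt0 t)) qf4 ltNge h.
Qed.

Definition crit (R : realType) (y : R) : R := 1 + qf y - y / 2 * (c0 R - G y).

Lemma qf1_4 (R : realType) : qf (1 : R) ^+ 4 = 1 / 2.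
Proof. by have := qf4 (1 : R); rewrite expr1n; lra. Qed.

(** The quantity c0 - G(y) is split into G(1), c0 / 2 - G(1) and c0 / 2 - G(y), whose series have
    arguments 1 / 2, 1 / 2 and [x = qf y ^+ 4]. Here [h] bounds q(1) from above, and [k], [r] bound
    q(y) from above and below; [h / 2] stands for q(1)^5, as q(1)^4 = 1 / 2. *)
Lemma crit_gt0 (R : realType) (y x h k r : R) (N M : nat) :
  0 <= y -> x * (1 + y ^+ 2) = 1 -> x <= 1 / 2 -> (1 < N)%N -> (1 < M)%N ->
  0 <= h -> 1 <= 2 * h ^+ 4 -> 0 <= k -> 1 <= k ^+ 4 * (1 + y ^+ 2) ->
  r ^+ 4 * (1 + y ^+ 2) <= 1 ->
  y * (h / 2 * (horn 1 2 (1 / 2) N 0 + horn 1 3 (1 / 2) N 0) +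
       y * (k * x) * horn 1 3 x M 0) < 2 * (1 + r) ->
  0 < crit y.
Proof.
move=> y0 xy x2 N1 M1 h0 h4 k0 k4 r4 H.
have qx : qf y ^+ 4 = x.
  by apply: (mulIf (lt0r_neq0 (sqrp1_gt0 y))); rewrite qf4 xy.
have rq := qf_ge r4; have qk := qf_le k0 k4.
have q1h : qf 1 <= h by apply: qf_le => //; rewrite expr1n; lra.
have hG := @G1_le_horn R N N1.
have hT := @c0_subG_le_horn R 1 N ler01 (ltnW N1); rewrite qf1_4 in hT.
have {}hT := hT (lexx _); rewrite mul1r in hT.
have hy := @c0_subG_le_horn R y M y0 (ltnW M1); rewrite qx in hy; have {}hy := hy x2.
have E5 t : qf t ^+ 5 = qf t * qf t ^+ 4 :> R by rewrite exprS.
rewrite !E5 qf1_4 in hG hT hy; rewrite qx in hy.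
have x0 : 0 <= x by rewrite -qx exprn_ge0// ltW// qf_gt0.
have half0 : 0 <= 1 / 2 :> R by lra.
have /andP[hP _] := @horn_le R 1 3 _ _ N 0%N isT ler01 half0 (lexx _).
have /andP[hQ _] := @horn_le R 1 2 _ _ N 0%N isT ler01 half0 (lexx _).
have /andP[hX _] := @horn_le R 1 3 _ _ M 0%N isT ler01 x0 (lexx _).
have s1 : qf 1 * (1 / 2) * (horn 1 2 (1 / 2) N 0 + horn 1 3 (1 / 2) N 0) <=
    h / 2 * (horn 1 2 (1 / 2) N 0 + horn 1 3 (1 / 2) N 0).
  by rewrite ler_wpM2r ?addr_ge0//; lra.
have s2 : y * (qf y * x) * horn 1 3 x M 0 <= y * (k * x) * horn 1 3 x M 0.
  by rewrite ler_wpM2r// ler_wpM2l// ler_wpM2r.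
have s3 : y * (c0 R - G y) <= y * (h / 2 * (horn 1 2 (1 / 2) N 0 + horn 1 3 (1 / 2) N 0) +
       y * (k * x) * horn 1 3 x M 0).
  by rewrite ler_wpM2l//; lra.
rewrite /crit; lra.
Qed.

(** The same splitting with every rounding reversed and last coefficients 0. *)
Lemma crit_lt0 (R : realType) (y x h k r : R) (N M : nat) :
  0 <= y -> x * (1 + y ^+ 2) = 1 ->
  2 * h ^+ 4 <= 1 -> k ^+ 4 * (1 + y ^+ 2) <= 1 ->
  0 <= r -> 1 <= r ^+ 4 * (1 + y ^+ 2) ->
  2 * (1 + r) < y * (h / 2 * (horn 0 2 (1 / 2) N 0 + horn 0 3 (1 / 2) N 0) +
       y * (k * x) * horn 0 3 x M 0) ->
  crit y < 0.
Proof.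
move=> y0 xy h4 k4 r0 r4 H.
have qx : qf y ^+ 4 = x.
  by apply: (mulIf (lt0r_neq0 (sqrp1_gt0 y))); rewrite qf4 xy.
have rq := qf_le r0 r4; have qk := qf_ge k4.
have q1h : h <= qf 1 by apply: qf_ge; rewrite expr1n; lra.
have hG := @G1_ge_horn R N.
have hT := @c0_subG_ge_horn R 1 N ler01; rewrite qf1_4 mul1r in hT.
have hy := @c0_subG_ge_horn R y M y0; rewrite qx in hy.
have E5 t : qf t ^+ 5 = qf t * qf t ^+ 4 :> R by rewrite exprS.
rewrite !E5 qf1_4 in hG hT hy; rewrite qx in hy.
have x0 : 0 <= x by rewrite -qx exprn_ge0// ltW// qf_gt0.
have half0 : 0 <= 1 / 2 :> R by lra.
have /andP[hP _] := @horn_le R 0 3 _ _ N 0%N isT (lexx 0) half0 (lexx _).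
have /andP[hQ _] := @horn_le R 0 2 _ _ N 0%N isT (lexx 0) half0 (lexx _).
have /andP[hX _] := @horn_le R 0 3 _ _ M 0%N isT (lexx 0) x0 (lexx _).
have s1 : h / 2 * (horn 0 2 (1 / 2) N 0 + horn 0 3 (1 / 2) N 0) <=
    qf 1 * (1 / 2) * (horn 0 2 (1 / 2) N 0 + horn 0 3 (1 / 2) N 0).
  by rewrite ler_wpM2r ?addr_ge0//; lra.
have s2 : y * (k * x) * horn 0 3 x M 0 <= y * (qf y * x) * horn 0 3 x M 0.
  by rewrite ler_wpM2r// ler_wpM2l// ler_wpM2r.
have s3 : y * (h / 2 * (horn 0 2 (1 / 2) N 0 + horn 0 3 (1 / 2) N 0) +
       y * (k * x) * horn 0 3 x M 0) <= y * (c0 R - G y).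
  by rewrite ler_wpM2l//; lra.
rewrite /crit; lra.
Qed.

Lemma ratQ1 (R : realType) : ratQ R (natQ 1) = 1.
Proof. exact: ratQ_nat. Qed.

Definition decQ (p q : BinPos.positive) := QArith_base.Qmake (BinInt.Z.pos p) q.

Definition seriesQ (b y x h k : QArith_base.Q) (N M : nat) : QArith_base.Q :=
  let mul := QArith_base.Qmult in let add := QArith_base.Qplus in
  mul y (add (mul (mul h (invQ 2)) (add (hornQ b 2 (invQ 2) N 0) (hornQ b 3 (invQ 2) N 0)))
    (mul (mul y (mul k x)) (hornQ b 3 x M 0))).

Lemma ratQ_series (R : realType) (b y x h k : QArith_base.Q) (N M : nat) :
  ratQ R (seriesQ b y x h k N M) = ratQ R y * (ratQ R h / 2 *
    (horn (ratQ R b) 2 (1 / 2) N 0 + horn (ratQ R b) 3 (1 / 2) N 0) +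
    ratQ R y * (ratQ R k * ratQ R x) * horn (ratQ R b) 3 (ratQ R x) M 0).
Proof. by rewrite /seriesQ !(ratQM, ratQD) !ratQ_horn// !ratQ_inv// div1r. Qed.

Lemma ratQ_ge0 (R : realType) p q : 0 <= ratQ R (decQ p q).
Proof. by rewrite divr_ge0// ltW// int_of_pos_gt0. Qed.

Lemma ratQ_natX (R : realType) x n :
  ratQ R (iter n (QArith_base.Qmult x) (natQ 1)) = ratQ R x ^+ n.
Proof. by elim: n => [|n IH]; rewrite ?ratQ_nat//= ratQM IH exprS. Qed.

Definition fourthQ (h y : QArith_base.Q) := QArith_base.Qmult
  (iter 4 (QArith_base.Qmult h) (natQ 1))
  (QArith_base.Qplus (natQ 1) (QArith_base.Qmult y y)).

Lemma ratQ_fourth (R : realType) (h y : QArith_base.Q) :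
  ratQ R (fourthQ h y) = ratQ R h ^+ 4 * (1 + ratQ R y ^+ 2).
Proof. by rewrite /fourthQ !(ratQM, ratQD, ratQ_natX) !ratQ_nat expr2. Qed.

Definition doubleQ (r : QArith_base.Q) :=
  QArith_base.Qmult (natQ 2) (QArith_base.Qplus (natQ 1) r).

Lemma ratQ_double (R : realType) r : ratQ R (doubleQ r) = 2 * (1 + ratQ R r).
Proof. by rewrite ratQM ratQD ratQ1 ratQ_nat. Qed.

Lemma ratQ_sqr_inv (R : realType) (y x : QArith_base.Q) :
  QArith_base.Qeq_bool (QArith_base.Qmult x
    (QArith_base.Qplus (natQ 1) (QArith_base.Qmult y y))) (natQ 1) ->
  ratQ R x * (1 + ratQ R y ^+ 2) = 1.
Proof.
move=> h; rewrite expr2 -(ratQ1 R) -!(ratQM, ratQD).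
have [h1 h2] : QArith_base.Qle_bool (QArith_base.Qmult x
    (QArith_base.Qplus (natQ 1) (QArith_base.Qmult y y))) (natQ 1) /\
    QArith_base.Qle_bool (natQ 1) (QArith_base.Qmult x
    (QArith_base.Qplus (natQ 1) (QArith_base.Qmult y y))).
  move: h; rewrite /QArith_base.Qeq_bool /QArith_base.Qle_bool.
  move: (BinInt.Z.mul _ _) (BinInt.Z.mul _ _) => u v; lia.
by apply/eqP; rewrite eq_le !ratQ_le.
Qed.

(* [h] and [k] are decimal approximations of [2 ^ (- 1 / 4)] and [qf y]. *)
Lemma crit_lower (R : realType) :
  0 < crit (ratQ R (decQ 23780929076%positive 10000000000%positive)).
Proof.
pose y := decQ 23780929076%positive 10000000000%positive.
pose x := decQ (BinPos.Pos.mul 10000000000%positive 10000000000%positive)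
  (BinPos.Pos.add (BinPos.Pos.mul 10000000000%positive 10000000000%positive)
    (BinPos.Pos.mul 23780929076%positive 23780929076%positive)).
pose h := decQ 84089641525372%positive 100000000000000%positive.
pose k := decQ 62259792456340%positive 100000000000000%positive.
pose r := decQ 62259792456339%positive 100000000000000%positive.
(* The series at 1 / 2 are cut after 40 terms; the one at [x], about 0.15, converges faster and is
   cut after 16. *)
apply: (@crit_gt0 R (ratQ R y) (ratQ R x) (ratQ R h) (ratQ R k) (ratQ R r)
  40 16) => //.
- exact: ratQ_ge0.
- by apply: ratQ_sqr_inv; vm_compute.
- by rewrite div1r -(ratQ_inv R (n := 2))//; apply: ratQ_le; vm_compute.
- exact: ratQ_ge0.
- by rewrite -(ratQ_nat R 2) -(ratQ1 R) -ratQ_natX -ratQM; apply: ratQ_le; vm_compute.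
- exact: ratQ_ge0.
- by rewrite -ratQ_fourth -(ratQ1 R); apply: ratQ_le; vm_compute.
- by rewrite -ratQ_fourth -(ratQ1 R); apply: ratQ_le; vm_compute.
- have /(ratQ_lt R) : ~~ QArith_base.Qle_bool (doubleQ r)
    (seriesQ (natQ 1) y x h k 40 16) by vm_compute.
  by rewrite ratQ_series ratQ_double ratQ1.
Qed.

Lemma crit_upper (R : realType) :
  crit (ratQ R (decQ 23780929084%positive 10000000000%positive)) < 0.
Proof.
pose y := decQ 23780929084%positive 10000000000%positive.
pose x := decQ (BinPos.Pos.mul 10000000000%positive 10000000000%positive)
  (BinPos.Pos.add (BinPos.Pos.mul 10000000000%positive 10000000000%positive)
    (BinPos.Pos.mul 23780929084%positive 23780929084%positive)).
pose h := decQ 84089641525371%positive 100000000000000%positive.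
pose k := decQ 62259792447440%positive 100000000000000%positive.
pose r := decQ 62259792447441%positive 100000000000000%positive.
apply: (@crit_lt0 R (ratQ R y) (ratQ R x) (ratQ R h) (ratQ R k) (ratQ R r) 40 16) => //.
- exact: ratQ_ge0.
- by apply: ratQ_sqr_inv; vm_compute.
- by rewrite -(ratQ_nat R 2) -(ratQ1 R) -ratQ_natX -ratQM; apply: ratQ_le; vm_compute.
- by rewrite -ratQ_fourth -(ratQ1 R); apply: ratQ_le; vm_compute.
- exact: ratQ_ge0.
- by rewrite -ratQ_fourth -(ratQ1 R); apply: ratQ_le; vm_compute.
- have /(ratQ_lt R) : ~~ QArith_base.Qle_bool
    (seriesQ (natQ 0) y x h k 40 16) (doubleQ r) by vm_compute.
  by rewrite ratQ_series ratQ_double (ratQ_nat R 0).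
Qed.

(** Twice the decimal 1.18904645 followed by the two digits [c], in blocks of digits so that the
    unary numerals stay small. *)
Definition decimalsQ (c : nat) : QArith_base.Q :=
  let pow n := iter n (QArith_base.Qmult (invQ 10)) (natQ 1) in
  let mul := QArith_base.Qmult in let add := QArith_base.Qplus in
  mul (natQ 2) (add (add (add (natQ 1) (mul (natQ 1890) (pow 4%N)))
    (mul (natQ 4645) (pow 8%N))) (mul (natQ c) (pow 10%N))).

Lemma ratQ_decimals (R : realType) (c : nat) : ratQ R (decimalsQ c) =
  2 * (1 + 1890 / 10 ^+ 4 + 4645 / 10 ^+ 8 + c%:R / 10 ^+ 10).
Proof.
rewrite /decimalsQ !(ratQM, ratQD, ratQ_natX) !ratQ_nat ratQ_inv//.
by rewrite !exprVn.
Qed.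

Lemma c0_subG_gt0 (R : realType) (y : R) : 0 < c0 R - G y.
Proof. by have := G_lt_c0 y; have := c0_gt0 R; lra. Qed.

Lemma quotE (R : realType) (y : R) : quot y = (1 + qf y) / (c0 R - G y).
Proof. by []. Qed.

(** The bracket is twice the interval of radius 2 / 10^10 about 1.1890464540, because the maximal
    value is half of its maximiser. *)
Lemma crit_bracket (R : realType) : exists y1 y2 : R,
  [/\ [/\ y1 = 2 * (1 + 1890 / 10 ^+ 4 + 4645 / 10 ^+ 8 + 38 / 10 ^+ 10),
      y2 = 2 * (1 + 1890 / 10 ^+ 4 + 4645 / 10 ^+ 8 + 42 / 10 ^+ 10),
      0 <= y1 & y1 < y2], 0 < crit y1 & crit y2 < 0].
Proof.
exists (ratQ R (decimalsQ 38)), (ratQ R (decimalsQ 42)); split.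
- split; [exact: ratQ_decimals|exact: ratQ_decimals| |].
  + by rewrite -[0](ratQ_nat R 0); apply: ratQ_le; vm_compute.
  + by apply: ratQ_lt; vm_compute.
- have <- : ratQ R (decQ 23780929076%positive 10000000000%positive) =
      ratQ R (decimalsQ 38); last exact: crit_lower.
  by apply/le_anti/andP; split; apply: ratQ_le; vm_compute.
- have <- : ratQ R (decQ 23780929084%positive 10000000000%positive) =
      ratQ R (decimalsQ 42); last exact: crit_upper.
  by apply/le_anti/andP; split; apply: ratQ_le; vm_compute.
Qed.

(* The derivative of [quot] has the sign of [crit], so at the maximum point
   [y] the value is [y / 2]. *)
Lemma quot_maximum (R : realType) : exists M : R,
  [/\ is_maximum [set quot_ext y | y in [set y : \bar R | (0 <= y)%E]] M,
    forall y : R, quot y <= M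
    & `|M - (1 + 1890 / 10 ^+ 4 + 4645 / 10 ^+ 8 + 40 / 10 ^+ 10)|
          < 2 / 10 ^+ 10].
Proof.
have [y1 [y2 [[E1 E2 y10 y12] c1 c2]]] := crit_bracket R.
have [||z z12 cz] := @IVT R (@crit R) y1 y2 0 (ltW y12).
- apply: (der_within_itv (df := fun y => - (c0 R - G y) / 2)) => y _.
  have hq := der_qf y; have hG := der_G y.
  by rewrite /crit; der; field.
- by rewrite ge_min (ltW c2) orbT le_max (ltW c1).
have /andP[z1 z2] : y1 < z < y2.
  move: z12; rewrite in_itv/= !lt_neqAle => /andP[-> ->]; rewrite !andbT.
  apply/andP; split; apply/eqP => e; first by move: c1; rewrite e cz ltxx.
  by move: c2; rewrite -e cz ltxx.
have bound y : quot y <= z / 2.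
  rewrite quotE ler_pdivrMr ?c0_subG_gt0//.
  (* With the factor [z / 2] frozen, [quot y <= z / 2] means [F y <= 0], and the derivative of [F]
     visibly changes sign exactly at [z]. *)
  pose F t := 1 + qf t - z / 2 * (c0 R - G t).
  have dF (t : R) : is_derive t 1 F (qf t ^+ 5 * (z - t) / 2).
    by have hq := der_qf t; have hG := der_G t; rewrite /F; der; field.
  have Fz : F z = 0 by exact: cz.
  suff : F y <= F z by rewrite Fz /F; lra.
  have [yz|/ltW zy] := leP y z.
    apply: der_ge0 yz (fun t _ => dF t) _ => t /andP[_ tz].
    by have := exprn_gt0 5 (qf_gt0 t); nra.
  apply: der_le0 zy (fun t _ => dF t) _ => t /andP[zt _].
  by have := exprn_gt0 5 (qf_gt0 t); nra.
exists (z / 2); split => //; last first.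
  rewrite E1 in z1; rewrite E2 in z2.
  by rewrite ltr_distlC; lra.
split.
  exists z%:E => /=; first by rewrite lee_fin (le_trans y10)// ltW.
  apply: (mulIf (lt0r_neq0 (c0_subG_gt0 z))).
  rewrite quotE divfK ?gt_eqF ?c0_subG_gt0//.
  by move: cz; rewrite /crit; lra.
move=> _ [[y| |] /= y0 <-] //.
apply: limr_le; last by near=> t; exact: bound.
(* The value at infinity is a [lim], so the bound passes to it only once convergence is known. *)
apply/cvg_ex; exists ((1 + 0) / (c0 R - c0 R / 2)).
have -> : @quot R = fun t => (1 + qf t) / (c0 R - G t) by [].
apply: cvgM; first by apply: cvgD; [exact: cvg_cst|exact: cvg_qf].
apply: cvgV; first by apply: lt0r_neq0; have := c0_gt0 R; lra.
by apply: cvgB; [exact: cvg_cst|exact: cvg_G].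
Unshelve. all: by end_near. Qed.

(** * Absolutely continuous functions *)

Lemma uniform_continuity_itv (R : realType) (f : R -> R) (a b e : R) :
  continuous f -> 0 < e ->
  exists2 d, 0 < d & forall x y, a <= x <= b -> a <= y <= b -> `|x - y| < d ->
    `|f x - f y| < e.
Proof.
move=> cf e0.
pose P (d x : R) := forall y, `|x - y| < d -> `|f x - f y| < e.
have /compact_near_coveringP H := @segment_compact R a b.
have [|d /= d0 hd] := H R (0^'+) P _.
  move=> x _.
  have /cvgrPdist_lt/(_ _ (divr_gt0 e0 (ltr0n _ 2)))[r /= r0 hr] := cf x.
  exists ([set x' | `|x - x'| < r / 2], [set d | d < r / 2]) => /=.
    split; first by exists (r / 2) => //=; rewrite divr_gt0.
    by apply: nbhs_right_lt; rewrite divr_gt0.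
  move=> [x' d] /= [xx' dr] y x'y.
  have h1 : `|f x - f x'| < e / 2 by apply: hr => /=; lra.
  have h2 : `|f x - f y| < e / 2.
    apply: hr => /=; rewrite (_ : x - y = (x - x') + (x' - y)); last by ring.
    by apply: (le_lt_trans (ler_normD _ _)); lra.
  rewrite (_ : f x' - f y = (f x - f y) - (f x - f x')); last by ring.
  by apply: (le_lt_trans (ler_normB _ _)); lra.
exists (d / 2); first by rewrite divr_gt0.
move=> x y xab _ xy; apply: (hd (d / 2) _ _ x) => //=.
- by rewrite sub0r normrN gtr0_norm ?divr_gt0//; lra.
- by rewrite divr_gt0.
Qed.

(* Replaces almost everywhere differentiability: with [H] the integral of a
   nonnegative function, no derivative of [D] is needed. *)
Lemma small_increments (R : realType) (D H : R -> R) (a b : R) : a <= b ->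
  (forall e, 0 < e -> exists2 d, 0 < d & forall x y, a <= x -> x <= y -> y <= b ->
     y - x < d -> `|D y - D x| <= e * (H y - H x)) ->
  D b = D a.
Proof.
rewrite le_eqVlt => /predU1P[->//|ab] h.
have step e : 0 < e -> `|D b - D a| <= e * (H b - H a).
  move=> e0; have [d d0 hd] := h e e0.
  pose n := (Num.trunc ((b - a) / d)).+1.
  have nd : (b - a) / n%:R < d.
    rewrite ltr_pdivrMr ?ltr0n// -ltr_pdivrMl// mulrC.
    exact: Num.Theory.truncnS_gt.
  pose x i := a + (b - a) / n%:R * i%:R.
  have st0 : 0 < (b - a) / n%:R by rewrite divr_gt0 ?subr_gt0// ltr0n.
  have x0 : x 0%N = a by rewrite /x mulr0 addr0.
  have xn : x n = b by rewrite /x divfK ?pnatr_eq0// subrKC.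
  have xS i : x i.+1 = x i + (b - a) / n%:R by rewrite /x -natr1; ring.
  have xle i j : (i <= j)%N -> x i <= x j.
    by move=> ij; rewrite lerD2l ler_pM2l// ler_nat.
  have ind i : (i <= n)%N -> `|D (x i) - D a| <= e * (H (x i) - H a).
    elim: i => [|i IH] i_n; first by rewrite x0 !subrr normr0 mulr0.
    have := IH (ltnW i_n).
    have := hd (x i) (x i.+1); rewrite -{1}x0 -{1}xn !xle// => /(_ isT isT isT).
    rewrite {1}xS addrAC subrr add0r => /(_ nd).
    rewrite (_ : D (x i.+1) - D a = (D (x i.+1) - D (x i)) + (D (x i) - D a)); last by ring.
    move=> h1 h2; apply: (le_trans (ler_normD _ _)).
    by apply: (le_trans (lerD h1 h2)); rewrite -mulrDr addrA subrK.
  by have := ind n (leqnn n); rewrite xn.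
have e1 := step 1 ltr01; rewrite mul1r in e1.
have K0 : 0 <= H b - H a := le_trans (normr_ge0 _) e1.
apply/eqP; rewrite -subr_eq0 -normr_le0; apply/ler_addgt0Pl => e e0.
have := step (e / (H b - H a + 1)); rewrite divr_gt0// ?ltr_pwDr// => /(_ isT) h1.
rewrite addr0; apply: (le_trans h1).
rewrite mulrAC ler_pdivrMr ?ltr_pwDr// ler_pM2l//.
by rewrite lerDl.
Qed.

(* Absolute continuity, expressed by the fundamental theorem of calculus. *)
Definition ac_itv (R : realType) (a b : R) (F f : R -> R) : Prop :=
  (@lebesgue_measure R).-integrable `[a, b] (EFin \o f) /\
  forall x y, a <= x -> x <= y -> y <= b ->
    F y - F x = \int[lebesgue_measure]_(t in `[x, y]) f t.

Lemma subset_itvcc (R : realType) (a b x y : R) : a <= x -> y <= b ->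
  `[x, y]%classic `<=` `[a, b]%classic.
Proof. by move=> ax yb; apply: subset_itv; rewrite bnd_simp. Qed.

Lemma integrable_sub (R : realType) (f : R -> R) (a b x y : R) :
  a <= x -> y <= b ->
  (@lebesgue_measure R).-integrable `[a, b] (EFin \o f) ->
  (@lebesgue_measure R).-integrable `[x, y] (EFin \o f).
Proof. by move=> ax yb; apply: integrableS => //; exact: subset_itvcc. Qed.

Lemma Rintegral_split (R : realType) (f : R -> R) (a x b : R) :
  a <= x -> x <= b ->
  (@lebesgue_measure R).-integrable `[a, b] (EFin \o f) ->
  \int[lebesgue_measure]_(t in `[a, b]) f t =
  \int[lebesgue_measure]_(t in `[a, x]) f t + \int[lebesgue_measure]_(t in `[x, b]) f t.
Proof.
move=> ax xb fi.
have := @Rintegral_itvB R f (BLeft a) (BRight b) x fi; rewrite !bnd_simp => /(_ ax xb).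
rewrite Rintegral_itv_obnd_cbnd.
  by move=> <-; rewrite addrC subrK.
by apply: integrableS fi => //; apply: subset_itv; rewrite bnd_simp.
Qed.

Lemma ac_itv_sub (R : realType) (a b x y : R) (F f : R -> R) :
  a <= x -> y <= b -> ac_itv a b F f -> ac_itv x y F f.
Proof.
move=> ax yb [fi h]; split; first exact: integrable_sub fi.
by move=> s t xs st ty; rewrite h// ?(le_trans ax)// (le_trans ty).
Qed.

Lemma integrable_cat (R : realType) (f : R -> R) (a c b : R) :
  a <= c -> c <= b ->
  (@lebesgue_measure R).-integrable `[a, c] (EFin \o f) ->
  (@lebesgue_measure R).-integrable `[c, b] (EFin \o f) ->
  (@lebesgue_measure R).-integrable `[a, b] (EFin \o f).
Proof.
move=> ac cb fi1 fi2.
have E : `[a, b]%classic = `[a, c]%classic `|` `]c, b]%classic :> set R.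
  apply/seteqP; split => x /=; rewrite !in_itv/=.
    by case/andP => -> ->; case: (leP x c) => _; [left|right].
  by move=> [] /andP[h3 h4]; rewrite ?h3 ?h4 ?(le_trans ac (ltW h3))// (le_trans h4).
have {}fi2 : (@lebesgue_measure R).-integrable `]c, b] (EFin \o f).
  by apply: integrableS fi2 => //; apply: subset_itv; rewrite bnd_simp.
move/integrableP: fi1 => [m1 i1]; move/integrableP: fi2 => [m2 i2].
apply/integrableP; rewrite E; split; first exact/measurable_funU.
rewrite ge0_integral_setU//=.
- exact: lte_add_pinfty.
- apply/measurable_EFinP; apply/measurable_funU => //.
  by split; apply: measurableT_comp => //; exact/measurable_EFinP.
- apply/disj_setPS => x [] /=; rewrite !in_itv/= => /andP[_ xc] /andP[cx _].
  by move: xc; rewrite leNgt cx.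
Qed.

Lemma ac_itv_cat (R : realType) (a c b : R) (F f : R -> R) :
  a <= c -> c <= b -> ac_itv a c F f -> ac_itv c b F f -> ac_itv a b F f.
Proof.
move=> ac cb [fi1 h1] [fi2 h2].
have fi := integrable_cat ac cb fi1 fi2.
split => // x y ax xy yb.
have [yc|/ltW cy] := leP y c; first exact: h1.
have [xc|/ltW cx] := leP x c; last exact: h2.
rewrite (@Rintegral_split _ f x c y)//; last exact: integrable_sub fi.
by rewrite -h1// -h2//; ring.
Qed.

Lemma ac_itv_continuous (R : realType) (a b : R) (F f : R -> R) :
  a <= b -> ac_itv a b F f -> {within `[a, b], continuous F}.
Proof.
move=> ab [fi h].
have := parameterized_integral_continuous ab fi.
move=> c.
have : {within `[a, b], continuous (fun x => F a + parameterized_integral lebesgue_measure a x f)}.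
  move=> x; apply: cvgD; [exact: cvg_cst|exact: c].
apply: subspace_eq_continuous => x; rewrite inE/= in_itv/= => /andP[ax xb].
by rewrite -[RHS](subrKC (F a)) h.
Qed.

Lemma continuous_bounded_itv (R : realType) (h : R -> R) (a b : R) :
  continuous h -> [bounded h x | x in `[a, b]%classic].
Proof.
move=> ch.
have /compact_bounded[M [Mr hM]] : compact (h @` `[a, b]%classic).
  by apply: continuous_compact; [exact: continuous_subspaceT|exact: segment_compact].
exists M; split => // x Mx y yab; apply: hM => //; by exists y.
Qed.

Lemma integrable_continuousM (R : realType) (h f : R -> R) (a b : R) :
  continuous h -> (@lebesgue_measure R).-integrable `[a, b] (EFin \o f) ->
  (@lebesgue_measure R).-integrable `[a, b] (EFin \o (fun t => h t * f t)).
Proof.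
move=> ch fi.
have -> : EFin \o (fun t => h t * f t) = ((EFin \o h) \* (EFin \o f))%E by [].
apply: integrableMr => //; last exact: continuous_bounded_itv.
by apply: measurable_funTS; exact: continuous_measurable_fun.
Qed.

(** [F] is only continuous, so the mean value theorem is applied to [Psi] between the values of [F];
    the intermediate value theorem then turns the mean value into some [F z]. *)
Lemma MVT_between (R : realType) (F Psi psi : R -> R) (x y : R) :
  continuous F -> x <= y -> (forall t : R, is_derive t 1 Psi (psi t)) ->
  exists2 z, x <= z <= y & Psi (F y) - Psi (F x) = psi (F z) * (F y - F x).
Proof.
move=> cF xy dPsi.
suff [c cF' e] : exists2 c, Num.min (F x) (F y) <= c <= Num.max (F x) (F y) &
    Psi (F y) - Psi (F x) = psi c * (F y - F x).
  have [|z + zc] := IVT xy _ cF'; first exact: continuous_subspaceT.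
  by rewrite in_itv/= => zxy; exists z; rewrite // zc.
have [Fxy|Fyx|E] := ltgtP (F x) (F y).
- have [c /andP[c1 c2] e] := der_MVT Fxy (fun t _ => dPsi t).
  by exists c; rewrite ?(ltW c1) ?(ltW c2).
- have [c /andP[c1 c2] e] := der_MVT Fyx (fun t _ => dPsi t).
  exists c; first by rewrite (ltW c1) (ltW c2).
  by rewrite -opprB e -mulrN opprB.
- by exists (F x); rewrite ?E ?lexx ?subrr ?mulr0.
Qed.

(** On a short interval [MVT_between] gives the increment of [Psi (F t)] with one value [psi (F z)].
    By uniform continuity it differs from the integral of [psi (F t) * f t] by at most [e] times the
    integral of [|f|], so [small_increments] applies to the difference of the two. *)
Lemma ac_chain (R : realType) (a b : R) (F f Psi psi : R -> R) :
  continuous F -> continuous psi -> (forall t : R, is_derive t 1 Psi (psi t)) ->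
  ac_itv a b F f -> ac_itv a b (fun t => Psi (F t)) (fun t => psi (F t) * f t).
Proof.
move=> cF cpsi dPsi [fi hF].
have cg : continuous (fun t => psi (F t)).
  by move=> t; apply: continuous_comp; [exact: cF|exact: cpsi].
have gi := integrable_continuousM cg fi.
split=> // x y ax xy yb.
have gxy := integrable_sub ax yb gi; have fxy := integrable_sub ax yb fi.
pose D t := Psi (F t) - \int[lebesgue_measure]_(s in `[x, t]) (psi (F s) * f s).
pose H t := \int[lebesgue_measure]_(s in `[x, t]) `|f s|.
suff : D y = D x.
  by rewrite /D set_itv1 Rintegral_set1 subr0 => <-; ring.
apply: (small_increments (H := H)) => // e e0.
have [d d0 hd] := uniform_continuity_itv x y cg e0.
exists d => // s t xs st ty st_d.
have intn a' b' : x <= a' -> b' <= y ->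
    (@lebesgue_measure R).-integrable `[a', b'] (EFin \o (fun s => `|f s|)).
  move=> xa' b'y.
  have := integrable_norm (integrable_sub xa' b'y fxy); exact.
have HE : H t - H s = \int[lebesgue_measure]_(r in `[s, t]) `|f r|.
  rewrite /H (@Rintegral_split _ _ x s t)//; first by ring.
  exact: intn.
have [z /andP[sz zt] zE] := MVT_between cF st dPsi.
have DE : D t - D s = \int[lebesgue_measure]_(r in `[s, t]) ((psi (F z) - psi (F r)) * f r).
  have -> : D t - D s = psi (F z) * (F t - F s) -
      \int[lebesgue_measure]_(r in `[s, t]) (psi (F r) * f r).
    rewrite -zE /D (@Rintegral_split _ _ x s t)//; first by ring.
    exact: integrable_sub gxy.
  rewrite hF ?(le_trans ax)// ?(le_trans ty)//.
  rewrite -RintegralZl//; last exact: integrable_sub fxy.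
  rewrite -RintegralB//; last 2 first.
  - by apply: (integrable_continuousM (h := fun=> psi (F z))) ;
      [move=> ?; exact: cvg_cst|exact: integrable_sub fxy].
  - exact: integrable_sub gxy.
  by apply: eq_Rintegral => r _; ring.
have mi : (@lebesgue_measure R).-integrable `[s, t]
    (EFin \o (fun r => (psi (F z) - psi (F r)) * f r)).
  apply: (integrable_continuousM (h := fun r => psi (F z) - psi (F r))).
    by move=> r; apply: cvgB; [exact: cvg_cst|exact: cg].
  exact: integrable_sub fxy.
rewrite DE HE -RintegralZl//; last exact: intn.
apply: (le_trans (le_normr_Rintegral _ mi)) => //.
apply: le_Rintegral => //.
- exact: (integrable_norm mi).
- apply: (integrable_continuousM (h := fun=> e)); first by move=> ?; exact: cvg_cst.
  exact: intn.
move=> r /=; rewrite in_itv/= => /andP[sr rt].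
rewrite normrM ler_wpM2r//; apply/ltW/hd.
- by rewrite (le_trans xs)// (le_trans zt).
- by rewrite (le_trans xs)// (le_trans rt).
- by rewrite ltr_norml; lra.
Qed.

Lemma ac_itvD (R : realType) (a b : R) (F f H h : R -> R) :
  ac_itv a b F f -> ac_itv a b H h ->
  ac_itv a b (fun t => F t + H t) (fun t => f t + h t).
Proof.
move=> [fi hF] [hi hH]; split.
  have -> : EFin \o (fun t => f t + h t) = ((EFin \o f) \+ (EFin \o h))%E by [].
  exact: integrableD.
move=> x y ax xy yb; rewrite RintegralD//; [|exact: integrable_sub fi|exact: integrable_sub hi].
by rewrite -hF// -hH//; ring.
Qed.

Lemma ac_itvZ (R : realType) (a b c : R) (F f : R -> R) :
  ac_itv a b F f -> ac_itv a b (fun t => c * F t) (fun t => c * f t).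
Proof.
move=> [fi hF]; split.
  have -> : EFin \o (fun t => c * f t) = (fun t => c%:E * (EFin \o f) t)%E by [].
  exact: integrableZl.
move=> x y ax xy yb; rewrite RintegralZl//; last exact: integrable_sub fi.
by rewrite -hF//; ring.
Qed.

Lemma ac_itv_der_itv (R : realType) (a b : R) (F f : R -> R) :
  {within `[a, b], continuous f} ->
  (forall x : R, a <= x <= b -> is_derive x 1 F (f x)) -> ac_itv a b F f.
Proof.
move=> cf dF; split.
  by apply: continuous_compact_integrable => //; exact: segment_compact.
move=> x y ax xy yb; apply/esym; apply: integral_der_itv => //.
  by apply: continuous_subspaceW cf; exact: subset_itvcc.
by move=> z /andP[xz zy]; apply: dF; rewrite (le_trans ax) ?(le_trans zy).
Qed.

Lemma ac_itv_der (R : realType) (a b : R) (F f : R -> R) :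
  continuous f -> (forall x : R, is_derive x 1 F (f x)) -> ac_itv a b F f.
Proof. by move=> cf dF; apply: ac_itv_der_itv => //; exact: continuous_subspaceT. Qed.

Lemma integrable_itv_oo_cc (R : realType) (a b : R) (f : R -> R) :
  (@lebesgue_measure R).-integrable `]a, b[ (EFin \o f) ->
  (@lebesgue_measure R).-integrable `[a, b] (EFin \o f).
Proof.
move=> /integrableP[mf fi]; apply/integrableP; split.
  apply/measurable_EFinP.
  by move/measurable_EFinP: mf; exact: measurable_fun_itv_cc.
rewrite integral_itv_bndoo//; apply: measurableT_comp => //.
Qed.

Lemma eq_ac_itv (R : realType) (a b : R) (F G f g : R -> R) :
  (forall x, a <= x <= b -> F x = G x) ->
  (forall x, a < x < b -> f x = g x) ->
  ac_itv a b F f -> ac_itv a b G g.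
Proof.
move=> FG fg [fi hF].
have fi' : (@lebesgue_measure R).-integrable `]a, b[ (EFin \o f).
  by apply: integrableS fi => //; exact: subset_itv_oo_cc.
have gi : (@lebesgue_measure R).-integrable `]a, b[ (EFin \o g).
  apply: eq_integrable fi' => // x; rewrite inE/= in_itv/= => xab.
  by rewrite /= fg.
split; first exact: integrable_itv_oo_cc.
move=> x y ax xy yb; rewrite -!FG; last 2 first.
- by rewrite ax (le_trans xy).
- by rewrite (le_trans ax).
have sub : (`]x, y[%classic : set R) `<=` `]a, b[%classic.
  by apply: subset_itv; rewrite bnd_simp.
rewrite hF// /Rintegral; congr fine; apply: eq_integral_itv_bounded.
- by apply: measurable_funS sub _ => //; apply/measurable_EFinP; exact: measurable_int fi'.
- by apply: measurable_funS sub _ => //; apply/measurable_EFinP; exact: measurable_int gi.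
move=> z; rewrite in_itv/= => /andP[xz zy].
by rewrite fg// (le_lt_trans ax) ?(lt_le_trans zy).
Qed.

(** By polarisation, F H = ((F + H)^2 - (F - H)^2) / 4, the product rule follows from the chain rule
    for the square. *)
Lemma ac_itvM (R : realType) (a b : R) (F f H h : R -> R) :
  continuous F -> continuous H -> ac_itv a b F f -> ac_itv a b H h ->
  ac_itv a b (fun t => F t * H t) (fun t => F t * h t + H t * f t).
Proof.
move=> cF cH aF aH.
have dsq (t : R) : is_derive t 1 (fun t => t ^+ 2) (2 * t) by der; rewrite /=; ring.
have csq : continuous (fun t : R => 2 * t).
  by move=> t; apply: cvgMr; exact: cvg_id.
have cD : continuous (fun t => F t + H t) by move=> t; apply: cvgD; [exact: cF|exact: cH].
have cB : continuous (fun t => F t + - 1 * H t).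
  by move=> t; apply: cvgD; [exact: cF|apply: cvgMr; exact: cH].
have h1 := ac_chain cD csq dsq (ac_itvD aF aH).
have h2 := ac_chain cB csq dsq (ac_itvD aF (ac_itvZ (- 1) aH)).
have := ac_itvD (ac_itvZ (1 / 4) h1) (ac_itvZ (- (1 / 4)) h2).
by apply: eq_ac_itv => x _; field.
Qed.

(** * Weak derivatives *)

Lemma ac_continuous (R : realType) (P k : R -> R) : ac_itv 0 1 P k ->
  (forall x, x <= 0 -> P x = P 0) -> (forall x, 1 <= x -> P x = P 1) ->
  continuous P.
Proof.
move=> aP P0 P1 x.
pose N := `|x| + 2.
have N2 : 2 <= N by rewrite lerDr.
pose kc := k \_ (`]0, 1[%classic : set R).
have c0 a b (c : R) : ac_itv a b (fun=> c) (fun=> 0).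
  by apply: ac_itv_der => ?; exact: cvg_cst.
have kc0 s : (s <= 0) || (1 <= s) -> kc s = 0.
  move=> h; rewrite /kc patchE; case: ifPn => //; rewrite inE/= in_itv/=.
  by case/andP; case/orP: h; lra.
have a1 : ac_itv (- N) 0 P kc.
  apply: eq_ac_itv (c0 (- N) 0 (P 0)) => t /andP[_ t0]; first by rewrite P0.
  by rewrite kc0// (ltW t0).
have a2 : ac_itv 0 1 P kc.
  by apply: eq_ac_itv aP => // t t01; rewrite /kc patchE ifT// inE/= in_itv.
have a3 : ac_itv 1 N P kc.
  apply: eq_ac_itv (c0 1 N (P 1)) => t /andP[t1 _]; first by rewrite P1.
  by rewrite kc0// (ltW t1) orbT.
have a12 : ac_itv (- N) 1 P kc by apply: ac_itv_cat a1 a2; lra.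
have a123 : ac_itv (- N) N P kc by apply: ac_itv_cat a12 a3; lra.
apply: (@within_continuous_continuous _ _ _ (- N) N); first lra.
  by apply: ac_itv_continuous a123; lra.
by rewrite in_itv/= -ltr_norml /N; lra.
Qed.

Lemma primitive01 (R : realType) (k : R -> R) :
  (@lebesgue_measure R).-integrable `]0, 1[ (EFin \o k) ->
  exists P : R -> R, [/\ continuous P, ac_itv 0 1 P k,
    forall x, x <= 0 -> P x = 0 & forall x, 1 <= x -> P x = P 1].
Proof.
move=> ki; have ki' := integrable_itv_oo_cc ki.
pose c (x : R) := Num.max 0 (Num.min x 1).
pose P x := \int[lebesgue_measure]_(t in `[0, c x]) k t.
have aP : ac_itv 0 1 P k.
  split=> // x y x0 xy y1.
  have E t : 0 <= t -> t <= 1 -> c t = t by move=> t0 t1; rewrite /c min_l// max_r.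
  rewrite /P !E// ?(le_trans x0)// ?(le_trans xy)//.
  rewrite (@Rintegral_split _ _ 0 x y)//; first by ring.
  exact: integrable_sub ki'.
have P0 x : x <= 0 -> P x = 0.
  move=> x0; rewrite /P (_ : c x = 0) ?set_itv1 ?Rintegral_set1//.
  by rewrite /c max_l// ge_min x0.
have P1 x : 1 <= x -> P x = P 1.
  by move=> x1; rewrite /P /c min_r// minxx.
exists P; split => //.
by apply: ac_continuous aP _ _ => // x x0; rewrite !P0.
Qed.

Lemma C1c01_ends (R : realType) (phi : R -> R) : C1c01 phi ->
  phi 0 = 0 /\ phi 1 = 0.
Proof.
move=> [_ _ _ sub].
have out x : ~ `]0, 1[%classic x -> phi x = 0.
  move=> nx; apply/eqP/negP => /negP px; apply: nx; apply: sub.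
  exact: subset_closure.
by split; apply: out; rewrite /= in_itv/= ltxx ?andbF.
Qed.

Lemma C1c01_der (R : realType) (phi : R -> R) : C1c01 phi ->
  forall x : R, is_derive x 1 phi (derive1 phi x).
Proof. by move=> [d _ _ _] x; apply: DeriveDef; rewrite ?derive1E. Qed.

Lemma C1c01_continuous (R : realType) (phi : R -> R) : C1c01 phi -> continuous phi.
Proof. by move=> h x; apply: der_continuous (C1c01_der h x). Qed.

Lemma Rintegral_oo_cc (R : realType) (a b : R) (f : R -> R) :
  (@lebesgue_measure R).-integrable `]a, b[ (EFin \o f) ->
  \int[lebesgue_measure]_(x in `]a, b[) f x = \int[lebesgue_measure]_(x in `[a, b]) f x.
Proof.
by move=> fi; rewrite /Rintegral [in RHS]integral_itv_bndoo//; exact: measurable_int fi.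
Qed.

Lemma integrable_cc_oo (R : realType) (a b : R) (f : R -> R) :
  (@lebesgue_measure R).-integrable `[a, b] (EFin \o f) ->
  (@lebesgue_measure R).-integrable `]a, b[ (EFin \o f).
Proof. by apply: integrableS => //; exact: subset_itv_oo_cc. Qed.

Lemma ac_weak_derivative (R : realType) (F f : R -> R) :
  continuous F -> ac_itv 0 1 F f -> weak_derivative01 F f.
Proof.
move=> cF aF phi hphi; have [_ cphi' _ _] := hphi.
have cphi := C1c01_continuous hphi; have [phi0 phi1] := C1c01_ends hphi.
have aphi := ac_itv_der 0 1 cphi' (C1c01_der hphi).
have [_ /(_ 0 1 (lexx _) ler01 (lexx _))] := ac_itvM cF cphi aF aphi.
have i1 : (@lebesgue_measure R).-integrable `[0, 1]
    (EFin \o (fun x => F x * derive1 phi x)).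
  by apply: (integrable_continuousM cF); case: aphi.
have i2 : (@lebesgue_measure R).-integrable `[0, 1]
    (EFin \o (fun x => phi x * f x)).
  by apply: (integrable_continuousM cphi); case: aF.
rewrite phi0 phi1 !mulr0 subrr RintegralD// => /esym/eqP.
rewrite addr_eq0 => /eqP e; rewrite Rintegral_oo_cc; last exact: integrable_cc_oo.
rewrite e; congr (- _); rewrite -Rintegral_oo_cc; last exact: integrable_cc_oo.
by apply: eq_Rintegral => x _; rewrite mulrC.
Qed.

(** The test function is chosen with derivative a narrow tent at [a] minus its translate at [b].
    Tested against [D], the two tents give nearly [J * D a] and [J * D b], with [J] the common mass,
    so [D a = D b]; the ends follow by continuity. *)
Lemma du_bois_reymond (R : realType) (D : R -> R) :
  {within `[0, 1], continuous D} ->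
  (forall phi, C1c01 phi ->
    \int[lebesgue_measure]_(x in `]0, 1[) (D x * derive1 phi x) = 0) ->
  forall x, 0 <= x <= 1 -> D x = D 0.
Proof.
move=> cD hD.
have inner a b : 0 < a -> a < b -> b < 1 -> D a = D b.
  move=> a0 ab b1.
  have cDx x : 0 < x < 1 -> {for x, continuous D}.
    by move=> x01; apply: within_continuous_continuous cD _ => //; rewrite in_itv.
  apply/eqP; rewrite -subr_eq0 -normr_le0; apply/ler_addgt0Pl => e e0; rewrite addr0.
  have /cDx/cvgrPdist_lt/(_ _ (divr_gt0 e0 (ltr0n _ 2)))[r1 /= r10 hr1] : 0 < a < 1 by lra.
  have /cDx/cvgrPdist_lt/(_ _ (divr_gt0 e0 (ltr0n _ 2)))[r2 /= r20 hr2] : 0 < b < 1 by lra.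
  have [h [h0 ha hb h1 h2]] : exists h : R, [/\ 0 < h, h < a, h < 1 - b, h < r1 & h < r2].
    exists (Num.min (Num.min (a / 2) ((1 - b) / 2)) (Num.min (r1 / 2) (r2 / 2))).
    by split; rewrite ?lt_min ?gt_min; lra.
  pose eta (x : R) := Num.max 0 (h - `|x|).
  have ceta : continuous eta.
    move=> x; apply: (@continuous_max _ _ (fun=> 0) (fun x => h - `|x|)).
      exact: cvg_cst.
    by apply: cvgB; [exact: cvg_cst|exact: norm_continuous].
  have eta0 x : h <= `|x| -> eta x = 0 by move=> hx; rewrite /eta max_l// subr_le0.
  have eta_ge0 x : 0 <= eta x by rewrite /eta le_max lexx.
  have [S [_ dS]] := antiderivative ceta.
  have Scst x y : x <= y -> (forall t, x < t < y -> eta t = 0) -> S x = S y.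
    move=> xy z; apply/le_anti/andP; split.
      by apply: der_ge0 xy (fun t _ => dS t) _ => t /z ->.
    by apply: der_le0 xy (fun t _ => dS t) _ => t /z ->.
  have Sl x : x <= - h -> S x = S (- h).
    move=> xh; apply: Scst => // t /andP[_ th]; apply: eta0.
    by have := ler_norm (- t); rewrite normrN; lra.
  have Sr x : h <= x -> S x = S h.
    move=> xh; apply/esym/Scst => // t /andP[ht _]; apply: eta0.
    by rewrite (le_trans (ltW ht)) ?ler_norm.
  have Slt : S (- h) < S h.
    apply: der_gt0 (fun t _ => dS t) _; first lra.
    by move=> t ht; rewrite /eta lt_max subr_gt0 ltr_norml ht orbT.
  (* The primitive [S] of the tent is constant on either side of it and has the same total rise for
     both translates, so [phi] has compact support in ]0, 1[. *)
  pose phi x := S (x - a) - S (x - b).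
  have dSa (c x : R) : is_derive x 1 (fun x => S (x - c)) (eta (x - c)).
    have := @der_comp _ S (fun x => x - c) x _ 1 (dS _) _; rewrite mulr1; apply.
    by der; rewrite addr0.
  have dphi (x : R) : is_derive x 1 phi (eta (x - a) - eta (x - b)).
    by have h3 := dSa a x; have h4 := dSa b x; rewrite /phi; der.
  have phi'E : derive1 phi = fun x => eta (x - a) - eta (x - b).
    by apply/funext => x; rewrite derive1E; have [] := dphi x.
  have ceta' (c : R) : continuous (fun x => eta (x - c)).
    move=> x; apply: (@continuous_comp _ _ _ (fun x => x - c) eta); last exact: ceta.
    by apply: cvgB; [exact: cvg_id|exact: cvg_cst].
  have supp : closure [set x | phi x != 0] `<=` `[a - h, b + h].
    have /closure_id -> : closed (`[a - h, b + h]%classic : set R) by exact: interval_closed.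
    apply: closure_subset => x /=; rewrite in_itv/= => px.
    rewrite !leNgt -negb_or; apply: contra px => /orP[xa|xb]; apply/eqP.
      by rewrite /phi !Sl ?subrr//; lra.
    by rewrite /phi !Sr ?subrr//; lra.
  have C1phi : C1c01 phi.
    split.
    - by move=> x; have [] := dphi x.
    - rewrite phi'E => x; apply: cvgB; exact: ceta'.
    - apply: subclosed_compact supp; first exact: closed_closure.
      exact: segment_compact.
    - apply: (subset_trans supp) => x /=; rewrite !in_itv/=; lra.
  have iD : (@lebesgue_measure R).-integrable `[0, 1] (EFin \o D).
    by apply: continuous_compact_integrable => //; exact: segment_compact.
  have iDe c : (@lebesgue_measure R).-integrable `[0, 1] (EFin \o (fun x => eta (x - c) * D x)).
    exact: integrable_continuousM iD.
  pose J := S h - S (- h).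
  have JE c : h < c -> h < 1 - c -> \int[lebesgue_measure]_(x in `[0, 1]) eta (x - c) = J.
    move=> hc hc1; rewrite (integral_der ler01 (ceta' c) (dSa c)).
    by rewrite /J (@Sr (1 - c)) 1?(@Sl (0 - c))//; lra.
  have est c r : h < c -> h < 1 - c -> h < r ->
      (forall y, `|c - y| < r -> `|D c - D y| < e / 2) ->
      `|\int[lebesgue_measure]_(x in `[0, 1]) (eta (x - c) * D x) - J * D c| <= J * (e / 2).
    move=> hc hc1 hr hD'.
    have ie (z : R) : (@lebesgue_measure R).-integrable `[0, 1]
        (EFin \o (fun x => eta (x - c) * z)).
      by apply: integrable_continuousM => //; apply: continuous_integrable => ?; exact: cvg_cst.
    have ie' : (@lebesgue_measure R).-integrable `[0, 1] (EFin \o (fun x => eta (x - c))).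
      exact: continuous_integrable.
    have id : (@lebesgue_measure R).-integrable `[0, 1]
        (EFin \o (fun x => eta (x - c) * D x - eta (x - c) * D c)).
      exact: (integrableB _ (iDe c) (ie (D c))).
    rewrite -(JE c)// -!RintegralZr// -RintegralB//.
    apply: (le_trans (le_normr_Rintegral _ id)) => //.
    apply: le_Rintegral => //; first exact: (integrable_norm id).
    move=> x _; rewrite -mulrBr normrM ger0_norm// distrC.
    have [xc|xc] := ltP `|x - c| h; last by rewrite eta0// !mul0r.
    by rewrite ler_wpM2l//; apply/ltW/hD'; rewrite distrC (lt_trans xc).
  have ha1 : h < 1 - a by lra.
  have hb0 : h < b by lra.
  have e1 := est a r1 ha ha1 h1 hr1; have e2 := est b r2 hb0 hb h2 hr2.
  have J0 : 0 < J by rewrite subr_gt0.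
  have := hD phi C1phi; rewrite phi'E Rintegral_oo_cc; last first.
    apply: integrable_cc_oo.
    have H : (@lebesgue_measure R).-integrable `[0, 1]
        (EFin \o (fun x => eta (x - a) * D x - eta (x - b) * D x)).
      exact: (integrableB _ (iDe a) (iDe b)).
    apply: eq_integrable H => // x _; rewrite /=; congr EFin; ring.
  have -> : \int[lebesgue_measure]_(x in `[0, 1]) (D x * (eta (x - a) - eta (x - b))) =
      \int[lebesgue_measure]_(x in `[0, 1]) (eta (x - a) * D x) -
      \int[lebesgue_measure]_(x in `[0, 1]) (eta (x - b) * D x).
    by rewrite -RintegralB//; apply: eq_Rintegral => x _; ring.
  move=> I0.
  have : J * `|D a - D b| <= J * e; last by rewrite ler_pM2l.
  rewrite -{1}(gtr0_norm J0) -normrM.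
  set u := (\int[_]_(_ in _) _) in I0 e1; set v := (\int[_]_(_ in _) _) in I0 e2.
  have -> : J * (D a - D b) = (v - J * D b) - (u - J * D a).
    by rewrite mulrBr; lra.
  apply: (le_trans (ler_normB _ _)).
  apply: (le_trans (lerD e2 e1)); lra.
have cc : forall x, 0 < x < 1 -> D x = D (1 / 2).
  move=> x /andP[x0 x1]; have [h|h|->//] := ltgtP x (1 / 2).
    by apply: inner => //; lra.
  by apply/esym; apply: inner => //; lra.
have /(continuous_within_itvP _ ltr01)[_ c0 c1] := cD.
have D0 : D 0 = D (1 / 2).
  apply/esym; apply: (@cvg_unique _ (@Rhausdorff R) (D x @[x --> 0^'+])); last exact: c0.
  apply: cvg_near_cst; near=> x; apply: cc.
  apply/andP; split; first by near: x; exact: nbhs_right_gt.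
  by near: x; exact: nbhs_right_lt.
have D1 : D 1 = D (1 / 2).
  apply/esym; apply: (@cvg_unique _ (@Rhausdorff R) (D x @[x --> 1^'-])); last exact: c1.
  apply: cvg_near_cst; near=> x; apply: cc.
  apply/andP; split; first by near: x; exact: nbhs_left_gt.
  by near: x; exact: nbhs_left_lt.
move=> x /andP[]; rewrite le_eqVlt => /predU1P[<-//|x0].
rewrite le_eqVlt => /predU1P[->|x1]; first by rewrite D1 D0.
by rewrite cc ?x0// D0.
Unshelve. all: by end_near. Qed.

(** The primitive of [f] integrates to 0 against every [derive1 phi], hence is constant, and
    Lebesgue differentiation recovers [f] from it almost everywhere. *)
Lemma weak_null (R : realType) (f : R -> R) :
  (@lebesgue_measure R).-integrable `]0, 1[ (EFin \o f) ->
  (forall phi, C1c01 phi ->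
    \int[lebesgue_measure]_(x in `]0, 1[) (f x * phi x) = 0) ->
  {ae (@lebesgue_measure R), forall x, `]0, 1[%classic x -> f x = 0}.
Proof.
move=> fi h; have [P [cP aP P0 P1]] := primitive01 fi.
have Pc : forall x, 0 <= x <= 1 -> P x = 0.
  move=> x x01; rewrite (@du_bois_reymond _ P) ?P0//; first exact: continuous_subspaceT.
  by move=> phi hphi; rewrite (ac_weak_derivative cP aP hphi) h// oppr0.
pose g := f \_ (`]0, 1[%classic : set R).
have gi : (@lebesgue_measure R).-integrable setT (EFin \o g).
  rewrite /g -restrict_EFin; apply: (iffLR (integrable_mkcond _ _)); last exact: fi.
  exact: measurable_itv.
have := @FTC1 R g (BLeft 0) _ (open_integrable_locally openT gi).
have /[swap]/[apply] : forall y,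
    (@lebesgue_measure R).-integrable [set` Interval (BLeft 0) (BRight y)] (EFin \o g).
  move=> y; apply: integrableS gi => //.
apply: filterS; first exact: (ae_filter_ringOfSetsType (@lebesgue_measure R)).
move=> x hx; rewrite /= in_itv/= => /andP[x0 x1].
have [|d] := hx; first by rewrite lte_fin.
rewrite /g patchE ifT; last by rewrite inE/= in_itv/= x0 x1.
move=> <-; rewrite derive1E (@near_eq_derive _ _ _ _ (fun=> 0)) ?derive_cst//.
near=> y.
have y0 : 0 < y by near: y; exact: near_gt.
have y1 : y < 1 by near: y; exact: near_lt.
have [_ /(_ 0 y (lexx _) (ltW y0) (ltW y1))] := aP.
rewrite !Pc ?lexx ?ler01 ?(ltW y0) ?(ltW y1)// subrr => e.
have [gf _] := aP; have fi0 := integrable_cc_oo (integrable_sub (lexx 0) (ltW y1) gf).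
rewrite /= [RHS]e -Rintegral_oo_cc; last exact: integrableS gi.
rewrite -Rintegral_oo_cc//; apply: eq_Rintegral => z; rewrite inE/= in_itv/= => /andP[z0 zy].
by rewrite /g patchE ifT// inE/= in_itv/= z0 (lt_trans zy).
Unshelve. all: by end_near. Qed.

(** * Square integrability and uniqueness of weak derivatives *)

Notation meas01 := (measurable_fun (`]0, 1[%classic : set (measurableTypeR _))).

Lemma ae_impl (R : realType) (P Q : R -> Prop) : (forall x, P x -> Q x) ->
  {ae (@lebesgue_measure R), forall x, P x} -> {ae (@lebesgue_measure R), forall x, Q x}.
Proof.
by move=> PQ [N [mN N0 sub]]; exists N; split => // x nQ; apply: sub => /PQ.
Qed.

Lemma ae_and (R : realType) (P Q : R -> Prop) :
  {ae (@lebesgue_measure R), forall x, P x} -> {ae (@lebesgue_measure R), forall x, Q x} ->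
  {ae (@lebesgue_measure R), forall x, P x /\ Q x}.
Proof.
by apply: filterI; exact: (ae_filter_ringOfSetsType (@lebesgue_measure R)).
Qed.

Definition sq_integrable01 (R : realType) (f : R -> R) : Prop :=
  meas01 f /\
  (@lebesgue_measure R).-integrable `]0, 1[ (EFin \o (fun x => f x ^+ 2)).

Lemma L2_01P (R : realType) (f : R -> R) : L2_01 f <-> sq_integrable01 f.
Proof.
pose D := (`]0, 1[%classic : set R).
have mD : measurable (D : set (measurableTypeR R)) by exact: measurable_itv.
have sqE : (fun x => (f \_ D) x ^+ 2) = (fun x => f x ^+ 2) \_ D.
  by apply/funext => x; rewrite !patchE; case: ifP => // _; rewrite expr0n.
split=> [h|[mf fi]].
  split.
    move: h; rewrite /L2_01 inE => /andP[mf _]; move: mf; rewrite inE/= => mf.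
    exact/(measurable_restrictT f mD).
  have := Lfun2_integrable_sqr h; rewrite sqE -restrict_EFin => h2.
  exact: (iffRL (integrable_mkcond _ mD) h2).
have h2 : (@lebesgue_measure R).-integrable setT (EFin \o (fun x => (f \_ D) x ^+ 2)).
  by rewrite sqE -restrict_EFin; exact: (iffLR (integrable_mkcond _ mD) fi).
rewrite /L2_01 inE; apply/andP; split; rewrite inE/=.
  exact/(measurable_restrictT f mD).
rewrite /finite_norm; apply: (@lty_poweRy _ _ 2) => //.
rewrite powR_Lnorm//.
move/integrableP: h2 => [_]; apply: le_lt_trans.
rewrite le_eqVlt; apply/orP; left; apply/eqP; apply: eq_integral => x _ /=.
by rewrite normrX powR_mulrn.
Qed.

Lemma sq_integrable01_integrable (R : realType) (f : R -> R) :
  sq_integrable01 f -> (@lebesgue_measure R).-integrable `]0, 1[ (EFin \o f).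
Proof.
move=> [mf fi].
have oi : (@lebesgue_measure R).-integrable `]0, 1[ (EFin \o (fun=> 1 : R)).
  by apply: integrable_cc_oo; apply: continuous_integrable => ?; exact: cvg_cst.
have hi : (@lebesgue_measure R).-integrable `]0, 1[ (EFin \o (fun x => 1 + f x ^+ 2)).
  exact: (integrableD _ oi fi).
apply: le_integrable hi => //; first exact/measurable_EFinP.
move=> x _ /=; rewrite lee_fin [leRHS]ger0_norm ?addr_ge0 ?sqr_ge0//.
have := sqr_ge0 (`|f x| - 1); rewrite -(real_normK (num_real (f x))); nra.
Qed.

Lemma continuous_sq_integrable01 (R : realType) (f : R -> R) :
  {within `[0, 1], continuous f} -> sq_integrable01 f.
Proof.
move=> cf; have H (g : R -> R) : {within `[0, 1], continuous g} ->
    (@lebesgue_measure R).-integrable `]0, 1[ (EFin \o g).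
  move=> cg; apply: integrable_cc_oo; apply: continuous_compact_integrable => //.
  exact: segment_compact.
split; first by apply/measurable_EFinP; exact: measurable_int (H f cf).
apply: H => x; have cfx := cf x.
rewrite (_ : (fun x => f x ^+ 2) = (fun x => f x * f x)); last exact/funext.
exact: (cvgM cfx cfx).
Qed.

Lemma eq_ae_Rintegral (R : realType) (f g : R -> R) :
  meas01 f -> meas01 g ->
  {ae (@lebesgue_measure R), forall x, `]0, 1[%classic x -> f x = g x} ->
  \int[lebesgue_measure]_(x in `]0, 1[) f x = \int[lebesgue_measure]_(x in `]0, 1[) g x.
Proof.
move=> mf mg fg; rewrite /Rintegral; congr fine.
apply: ae_eq_integral => //; [exact/measurable_EFinP|exact/measurable_EFinP|].
by apply: ae_impl fg => x h Dx; rewrite /= h.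
Qed.

Lemma integrable01_continuousM (R : realType) (h f : R -> R) :
  continuous h -> (@lebesgue_measure R).-integrable `]0, 1[ (EFin \o f) ->
  (@lebesgue_measure R).-integrable `]0, 1[ (EFin \o (fun t => h t * f t)).
Proof.
move=> ch fi; apply: integrable_cc_oo.
by apply: integrable_continuousM => //; exact: integrable_itv_oo_cc.
Qed.

Lemma weak_derivative_unique (R : realType) (v f g : R -> R) :
  sq_integrable01 f -> sq_integrable01 g ->
  weak_derivative01 v f -> weak_derivative01 v g ->
  {ae (@lebesgue_measure R), forall x, `]0, 1[%classic x -> f x = g x}.
Proof.
move=> /sq_integrable01_integrable fi /sq_integrable01_integrable gi hf hg.
have di : (@lebesgue_measure R).-integrable `]0, 1[ (EFin \o (fun x => f x - g x)).
  exact: (integrableB _ fi gi).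
have zero phi : C1c01 phi ->
    \int[lebesgue_measure]_(x in `]0, 1[) ((f x - g x) * phi x) = 0.
  move=> hphi; have cphi := C1c01_continuous hphi.
  have E (w : R -> R) : \int[lebesgue_measure]_(x in `]0, 1[) (w x * phi x) =
      \int[lebesgue_measure]_(x in `]0, 1[) (phi x * w x).
    by apply: eq_Rintegral => x _; rewrite mulrC.
  have := hf phi hphi; rewrite (hg phi hphi) !E => /oppr_inj e.
  have -> : \int[lebesgue_measure]_(x in `]0, 1[) (phi x * (f x - g x)) =
      \int[lebesgue_measure]_(x in `]0, 1[) (phi x * f x - phi x * g x).
    by apply: eq_Rintegral => x _; ring.
  by rewrite RintegralB// ?e ?subrr//; exact: integrable01_continuousM.
by apply: ae_impl (weak_null di zero) => x h Dx; apply/eqP; rewrite -subr_eq0 h.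
Qed.

Lemma ac_uniq (R : realType) (D f g : R -> R) : D 0 = g 0 ->
  {within `[0, 1], continuous D} -> weak_derivative01 D f ->
  continuous g -> ac_itv 0 1 g f -> forall x, 0 <= x <= 1 -> D x = g x.
Proof.
move=> D0 cD hD cg ag x x01; have hg := ac_weak_derivative cg ag.
have cgi : {within `[0, 1], continuous g} by exact: continuous_subspaceT.
apply/eqP; rewrite -subr_eq0.
rewrite (@du_bois_reymond _ (fun x => D x - g x))//; first by rewrite D0 subrr.
  by move=> y; apply: cvgB; [exact: cD|exact: cgi].
move=> phi hphi; have [_ cphi' _ _] := hphi.
have Di := sq_integrable01_integrable (continuous_sq_integrable01 cD).
have gi := sq_integrable01_integrable (continuous_sq_integrable01 cgi).
have -> : \int[lebesgue_measure]_(x in `]0, 1[) ((D x - g x) * derive1 phi x) =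
    \int[lebesgue_measure]_(x in `]0, 1[) (derive1 phi x * D x - derive1 phi x * g x).
  by apply: eq_Rintegral => y _; ring.
rewrite RintegralB//; [|exact: integrable01_continuousM|exact: integrable01_continuousM].
have E (w : R -> R) : \int[lebesgue_measure]_(x in `]0, 1[) (derive1 phi x * w x) =
    \int[lebesgue_measure]_(x in `]0, 1[) (w x * derive1 phi x).
  by apply: eq_Rintegral => y _; rewrite mulrC.
by rewrite !E hD// hg// subrr.
Qed.

(** * The functional through continuous slopes *)

Definition energy (R : realType) (k p : R -> R) (x : R) : R := (k x * qf (p x) ^+ 5) ^+ 2.

Lemma wD_spec (R : realType) (v : R -> R) : H1_01 v ->
  sq_integrable01 (wD v) /\ weak_derivative01 v (wD v).
Proof.
move=> [_ [w hw]]; rewrite /wD; case: xgetP => [y _ [/L2_01P]//|/(_ w)]; exact.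
Qed.

Lemma eq_weak_derivative (R : realType) (v w f : R -> R) :
  sq_integrable01 v -> sq_integrable01 w ->
  {ae (@lebesgue_measure R), forall x, `]0, 1[%classic x -> v x = w x} ->
  weak_derivative01 v f -> weak_derivative01 w f.
Proof.
move=> vi wi vw h phi hphi; rewrite -(h _ hphi).
have [_ cphi' _ _] := hphi.
have mM (g : R -> R) : sq_integrable01 g ->
    meas01 (fun x => g x * derive1 phi x).
  move=> /sq_integrable01_integrable gi.
  apply/measurable_EFinP; have := measurable_int _ (integrable01_continuousM cphi' gi).
  by rewrite (_ : (fun x => g x * _) = (fun x => derive1 phi x * g x))//;
    apply/funext => x; rewrite mulrC.
apply: eq_ae_Rintegral; [exact: mM|exact: mM|].
by apply: ae_impl vw => x e Dx; rewrite e.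
Qed.

(** [wD] picks a weak derivative that is determined only up to null sets; the integral does not see
    this choice. *)
Lemma elastica_energy (R : realType) (v p k : R -> R) : continuous p ->
  sq_integrable01 (wD v) -> sq_integrable01 (wD (wD v)) -> sq_integrable01 k ->
  {ae (@lebesgue_measure R), forall x, `]0, 1[%classic x -> wD v x = p x} ->
  {ae (@lebesgue_measure R), forall x, `]0, 1[%classic x -> wD (wD v) x = k x} ->
  elastica v = (\int[lebesgue_measure]_(x in `]0%R, 1%R[) (energy k p x)%:E)%E.
Proof.
move=> cp [mg _] [mk' _] [mk _] hg hk.
have mq (f : R -> R) : meas01 f ->
    meas01 (fun x => qf (f x)).
  move=> mf; apply: (measurableT_comp _ mf).
  by apply: continuous_measurable_fun; exact: continuous_qf.
have me (f h : R -> R) : meas01 f ->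
    meas01 h ->
    meas01 (energy f h).
  move=> mf mh; apply: measurable_funX; apply: measurable_funM => //.
  by apply: measurable_funX; exact: mq.
have mp : meas01 p.
  by apply: measurable_funTS; exact: continuous_measurable_fun.
rewrite /elastica; transitivity
  (\int[lebesgue_measure]_(x in `]0%R, 1%R[) (energy (wD (wD v)) (wD v) x)%:E)%E.
  apply: eq_integral => x _; congr EFin.
  by rewrite powR52 /energy exprMn -exprM.
apply: ae_eq_integral => //; [apply/measurable_EFinP; exact: me|apply/measurable_EFinP; exact: me|].
by apply: ae_impl (ae_and hg hk) => x [h1 h2] Dx; rewrite /= /energy h1// h2.
Qed.

(* [k] and [p] are the second and the first derivative of [v]. *)
Definition H20_data (R : realType) (v p k : R -> R) : Prop :=
  [/\ sq_integrable01 k, forall x, x <= 0 \/ 1 <= x -> p x = 0, ac_itv 0 1 p k,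
    forall x : R, is_derive x 1 v (p x) & v 0 = 0 /\ v 1 = 0].

Lemma H20_data_continuous (R : realType) (v p k : R -> R) :
  H20_data v p k -> continuous p.
Proof.
move=> [_ p_out ap _ _]; apply: ac_continuous ap _ _ => x hx.
  by rewrite !p_out//; left.
by rewrite !p_out//; right.
Qed.

(** Three versions of the slope have to be identified: the chosen [wD u], the continuous [p0] that
    carries the boundary values, and the primitive [p] of the second derivative. Almost everywhere
    [p0] is [wD u], so it has the weak derivative [k]; vanishing at 0, it equals [p] on [0, 1]. The
    same argument one order lower identifies [u] with the primitive of [p]. *)
Lemma H20_representation (R : realType) (u : R -> R) : H20_01 u ->
  exists v p k : R -> R, [/\ H20_data v p k, forall x, 0 <= x <= 1 -> u x = v x &
    elastica u = (\int[lebesgue_measure]_(x in `]0%R, 1%R[) (energy k p x)%:E)%E].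
Proof.
move=> [[cu H1u H1g] u0 u1 [p0 [cp0 up0 p00 p01]]].
have [sg ug] := wD_spec H1u; have [sk gk] := wD_spec H1g.
set g := wD u in sg ug sk gk *; set k := wD g in sk gk *.
have sp0 := continuous_sq_integrable01 cp0.
have gp0 := weak_derivative_unique sg sp0 ug up0.
have p0k := eq_weak_derivative sg sp0 gp0 gk.
have [p [cp ap pl pr]] := primitive01 (sq_integrable01_integrable sk).
have p0p : forall x, 0 <= x <= 1 -> p0 x = p x.
  by apply: (ac_uniq _ cp0 p0k cp ap); rewrite p00 pl.
have gp : {ae (@lebesgue_measure R), forall x, `]0, 1[%classic x -> g x = p x}.
  apply: ae_impl gp0 => x + Dx => ->//; apply: p0p.
  by move: Dx; rewrite /= in_itv/= => /andP[x0 x1]; rewrite !ltW.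
have [v [v0 dv]] := antiderivative cp.
have cv : continuous v by move=> x; exact: der_continuous (dv x).
have sp : sq_integrable01 p by apply/continuous_sq_integrable01/continuous_subspaceT.
have upw : weak_derivative01 u p.
  move=> phi hphi; rewrite (up0 _ hphi); congr (- _).
  apply: eq_Rintegral => x; rewrite inE/= in_itv/= => /andP[x0 x1].
  by rewrite p0p// !ltW.
have uv : forall x, 0 <= x <= 1 -> u x = v x.
  by apply: (ac_uniq _ cu upw cv (ac_itv_der 0 1 cp dv)); rewrite u0 v0.
exists v, p, k; split => //.
- have p1 : p 1 = 0 by rewrite -p0p ?lexx ?ler01.
  split => //; last by split => //; rewrite -uv ?lexx ?ler01.
  by move=> x [/pl|/pr ->].
- by apply: elastica_energy => //; apply: aeW.
Qed.

(** The converse passage, by which functions built from an explicit slope become competitors. *)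
Lemma H20_data_spec (R : realType) (v p k : R -> R) : H20_data v p k ->
  H20_01 v /\
  elastica v = (\int[lebesgue_measure]_(x in `]0%R, 1%R[) (energy k p x)%:E)%E.
Proof.
move=> h; have cp := H20_data_continuous h; have [sk p_out ap dv [v0 v1]] := h.
have p0 : p 0 = 0 by apply: p_out; left.
have p1 : p 1 = 0 by apply: p_out; right.
have cv : continuous v by move=> x; exact: der_continuous (dv x).
have cvi : {within `[0, 1], continuous v} by exact: continuous_subspaceT.
have cpi : {within `[0, 1], continuous p} by exact: continuous_subspaceT.
have sv := continuous_sq_integrable01 cvi; have sp := continuous_sq_integrable01 cpi.
have vp : weak_derivative01 v p by apply: ac_weak_derivative => //; exact: ac_itv_der.
have pk : weak_derivative01 p k by exact: ac_weak_derivative.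
have H1v : H1_01 v by split; [exact/L2_01P|exists p; split => //; exact/L2_01P].
have [sg vg] := wD_spec H1v.
have gp := weak_derivative_unique sg sp vg vp.
have pg : {ae (@lebesgue_measure R), forall x, `]0, 1[%classic x -> p x = wD v x}.
  by apply: ae_impl gp => x + Dx => ->.
have gk := eq_weak_derivative sp sg pg pk.
have H1g : H1_01 (wD v) by split; [exact/L2_01P|exists k; split => //; exact/L2_01P].
split; first by split => //; exists p; split.
have [sk' gk'] := wD_spec H1g.
apply: elastica_energy => //.
exact: weak_derivative_unique sk' sk gk' gk.
Qed.

Lemma energy_integrable (R : realType) (k p : R -> R) : continuous p ->
  sq_integrable01 k ->
  (@lebesgue_measure R).-integrable `]0, 1[ (EFin \o energy k p).
Proof.
move=> cp [mk ki]; have := integrable01_continuousM (h := fun x => qf (p x) ^+ 10) _ ki.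
have cq : continuous (fun x => qf (p x) ^+ 10).
  by move=> x; apply: (@continuous_comp _ _ _ p (fun y => qf y ^+ 10));
    [exact: cp|exact: continuous_qfX].
move=> /(_ cq); apply: eq_integrable => // x _; rewrite /= /energy; congr EFin.
by rewrite exprMn -exprM mulrC.
Qed.

(** * Elastic energy and comparison *)

Lemma eq_integrable_oo (R : realType) (a b : R) (f g : R -> R) :
  (forall x, a < x < b -> f x = g x) ->
  (@lebesgue_measure R).-integrable `[a, b] (EFin \o f) ->
  (@lebesgue_measure R).-integrable `[a, b] (EFin \o g).
Proof.
move=> fg fi; apply: integrable_itv_oo_cc.
apply: eq_integrable (integrable_cc_oo fi) => // x; rewrite inE/= in_itv/= => xab.
by rewrite /= fg.
Qed.

Lemma eq_Rintegral_oo (R : realType) (a b : R) (f g : R -> R) :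
  (forall x, a < x < b -> f x = g x) ->
  (@lebesgue_measure R).-integrable `[a, b] (EFin \o f) ->
  \int[lebesgue_measure]_(x in `[a, b]) f x = \int[lebesgue_measure]_(x in `[a, b]) g x.
Proof.
move=> fg fi; have gi := eq_integrable_oo fg fi.
rewrite -!Rintegral_oo_cc; try exact: integrable_cc_oo.
by apply: eq_Rintegral => x; rewrite inE/= in_itv/= => /fg.
Qed.

(** Square integrability of [f] is carried along because glued slopes must again satisfy
    [H20_data]. *)
Definition ac_energy (R : realType) (a b : R) (F f : R -> R) (e : R) : Prop :=
  [/\ ac_itv a b F f,
    (@lebesgue_measure R).-integrable `[a, b] (EFin \o (fun x => f x ^+ 2)),
    (@lebesgue_measure R).-integrable `[a, b] (EFin \o energy f F)
    & \int[lebesgue_measure]_(x in `[a, b]) energy f F x = e].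

Lemma ac_energy_sub (R : realType) (a b x y : R) (F f : R -> R) (e : R) :
  a <= x -> y <= b -> ac_energy a b F f e ->
  ac_energy x y F f (\int[lebesgue_measure]_(t in `[x, y]) energy f F t).
Proof.
move=> ax yb [h1 h2 h3 _]; split => //; first exact: ac_itv_sub h1.
  exact: integrable_sub h2.
exact: integrable_sub h3.
Qed.

Lemma ac_energy_cat (R : realType) (a c b : R) (F f : R -> R) (e1 e2 : R) :
  a <= c -> c <= b -> ac_energy a c F f e1 -> ac_energy c b F f e2 ->
  ac_energy a b F f (e1 + e2).
Proof.
move=> ac cb [h1 h2 h3 <-] [k1 k2 k3 <-].
have h := integrable_cat ac cb h3 k3.
split => //; first exact: ac_itv_cat h1 k1.
  exact: integrable_cat h2 k2.
exact: Rintegral_split.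
Qed.

Lemma eq_ac_energy (R : realType) (a b : R) (F G f g : R -> R) (e : R) :
  (forall x, a <= x <= b -> F x = G x) -> (forall x, a < x < b -> f x = g x) ->
  ac_energy a b F f e -> ac_energy a b G g e.
Proof.
move=> FG fg [h1 h2 h3 <-].
have eE x : a < x < b -> energy f F x = energy g G x.
  move=> /[dup] xab /andP[ax xb].
  by rewrite /energy fg// FG// !ltW.
split; first exact: eq_ac_itv h1.
- by apply: eq_integrable_oo h2 => x /fg ->.
- exact: eq_integrable_oo h3.
- by apply/esym/eq_Rintegral_oo.
Qed.

(** Equal end values are enough: absolute continuity asks nothing of the densities at the
    junctions. *)
Lemma ac_energy_replace (R : realType) (a b : R) (p k F f : R -> R) (e e' : R) :
  0 <= a -> a <= b -> b <= 1 -> ac_energy 0 1 p k e -> ac_energy a b F f e' ->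
  F a = p a -> F b = p b ->
  ac_energy 0 1 (fun x => if a <= x <= b then F x else p x)
    (fun x => if a <= x <= b then f x else k x)
    (e - \int[lebesgue_measure]_(t in `[a, b]) energy k p t + e').
Proof.
move=> a0 ab b1 hp hF Fa Fb; have [_ _ pi pe] := hp.
have h1 := ac_energy_sub (lexx 0) (le_trans ab b1) hp.
have h2 := ac_energy_sub (le_trans a0 ab) (lexx 1) hp.
have -> : e - \int[lebesgue_measure]_(t in `[a, b]) energy k p t + e' =
  \int[lebesgue_measure]_(t in `[0, a]) energy k p t + e' +
  \int[lebesgue_measure]_(t in `[b, 1]) energy k p t.
  rewrite -pe (Rintegral_split (le_trans a0 ab) b1 pi).
  rewrite (Rintegral_split a0 ab); last exact: integrable_sub pi.
  by ring.
apply: (ac_energy_cat (le_trans a0 ab) b1); last first.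
  apply: eq_ac_energy h2 => x /andP[bx x1]; last by rewrite [x <= b]leNgt bx andbF.
  by case: ifP => // /andP[_ xb]; rewrite (@le_anti _ _ x b) ?xb// Fb.
apply: (ac_energy_cat a0 ab).
  apply: eq_ac_energy h1 => x /andP[x0 xa]; last by rewrite leNgt xa.
  by case: ifP => // /andP[ax _]; rewrite (@le_anti _ _ x a) ?xa// Fa.
by apply: eq_ac_energy hF => x /andP[ax xb]; rewrite ?(ltW ax) ?(ltW xb) ?ax ?xb.
Qed.

(* The reciprocal of [qf ^+ 5], so that the derivative of [Ginv] is
   [ginv5 \o Ginv]. *)
Definition ginv5 (R : realType) (t : R) : R := (1 + t ^+ 2) ^+ 2 * qf t ^+ 3.

Lemma ginv5E (R : realType) (t : R) : ginv5 t * qf t ^+ 5 = 1.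
Proof.
rewrite (_ : _ * _ = (qf t ^+ 4 * (1 + t ^+ 2)) ^+ 2); last by rewrite /ginv5; ring.
by rewrite qf4 expr1n.
Qed.

Lemma der_Ginv_lin (R : realType) (c s x : R) : 0 <= c + s * x < c0 R / 2 ->
  is_derive x 1 (fun x => Ginv (c + s * x)) (s * ginv5 (Ginv (c + s * x))).
Proof.
move=> h; have dl : is_derive x 1 (fun x => c + s * x) s by der; ring.
apply: der_eq (@der_comp _ (@Ginv R) (fun x => c + s * x) x _ _ (der_Ginv h) dl) _.
rewrite mulrC; congr (_ * _); set y := Ginv _.
apply: (mulIf (lt0r_neq0 (exprn_gt0 5 (qf_gt0 y)))).
by rewrite ginv5E mulVf// gt_eqF// exprn_gt0// qf_gt0.
Qed.

Lemma der_ginv5 (R : realType) (t : R) :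
  is_derive t 1 (@ginv5 R) (4 * t * (1 + t ^+ 2) * qf t ^+ 3 -
    3 / 2 * t * (1 + t ^+ 2) ^+ 2 * qf t ^+ 7).
Proof. by have hq := der_qf t; rewrite /ginv5; der; rewrite /=; field. Qed.

(** In the variable G the slope follows a line, so the energy density is the constant [s ^+ 2]. *)
Lemma ac_energy_line (R : realType) (a b c s : R) : a <= b ->
  (forall x, a <= x <= b -> 0 <= c + s * x < c0 R / 2) ->
  ac_energy a b (fun x => Ginv (c + s * x)) (fun x => s * ginv5 (Ginv (c + s * x)))
    (s ^+ 2 * (b - a)).
Proof.
move=> ab h.
have dF x : a <= x <= b -> is_derive x 1 (fun x => Ginv (c + s * x))
    (s * ginv5 (Ginv (c + s * x))).
  by move=> /h; exact: der_Ginv_lin.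
have cf : {within `[a, b], continuous (fun x => s * ginv5 (Ginv (c + s * x)))}.
  apply: derivable_within_continuous => x; rewrite in_itv/= => /dF dFx.
  have h2 := @der_comp _ (@ginv5 R) (fun x => Ginv (c + s * x)) x _ _ (der_ginv5 _) dFx.
  by have [] := derM (der_cst s x) h2.
have eE x : energy (fun x => s * ginv5 (Ginv (c + s * x))) (fun x => Ginv (c + s * x)) x = s ^+ 2.
  by rewrite /energy -mulrA ginv5E mulr1.
have ei : (@lebesgue_measure R).-integrable `[a, b] (EFin \o (fun=> s ^+ 2)).
  by apply: continuous_integrable => ?; exact: cvg_cst.
split.
- exact: ac_itv_der_itv.
- apply: continuous_compact_integrable; first exact: segment_compact.
  move=> x; have cfx := cf x.
  rewrite (_ : (fun x => (s * ginv5 (Ginv (c + s * x))) ^+ 2) =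
    (fun x => (s * ginv5 (Ginv (c + s * x))) * (s * ginv5 (Ginv (c + s * x))))).
    exact: (cvgM cfx cfx).
  by apply/funext => y; rewrite expr2.
- by apply: eq_integrable_oo ei => x _; rewrite eE.
- rewrite (_ : energy _ _ = fun=> s ^+ 2); last by apply/funext => x; rewrite eE.
  have cs : continuous (fun _ : R => s ^+ 2) by move=> ?; exact: cvg_cst.
  have ds (x : R) : is_derive x 1 (fun x => s ^+ 2 * x) (s ^+ 2) by der; ring.
  by rewrite (integral_der ab cs ds) mulrBr.
Qed.

(** * Construction of competitors *)

(** Profile of the new slope in the variable G; the plateau on [a1, a2] is the steep stretch. *)
Definition trapezoid (R : realType) (a a1 a2 b ga gm gb x : R) : R :=
  if x <= a1 then ga + (gm - ga) / (a1 - a) * (x - a)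
  else if x <= a2 then gm else gb + (gm - gb) / (b - a2) * (b - x).

(** Reflection exchanges the branches, and the break points then fall into different ones; [e1] and
    [e2] say that neighbouring branches agree there. *)
Lemma trapezoid_mirror (R : realType) (a a1 a2 b ga gm gb x : R) :
  a < a1 -> a1 <= a2 -> a2 < b ->
  trapezoid (1 - b) (1 - a2) (1 - a1) (1 - a) gb gm ga x =
  trapezoid a a1 a2 b ga gm gb (1 - x).
Proof.
move=> h1 h2 h3; rewrite /trapezoid.
have -> : 1 - a2 - (1 - b) = b - a2 by ring.
have -> : 1 - a - (1 - a1) = a1 - a by ring.
have e1 : (gm - ga) / (a1 - a) * (a1 - a) = gm - ga by rewrite divfK// subr_eq0 gt_eqF.
have e2 : (gm - gb) / (b - a2) * (b - a2) = gm - gb by rewrite divfK// subr_eq0 gt_eqF.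
have [x2|x2] := leP x (1 - a2).
  have [xa|xa] := leP (1 - x) a1.
    have -> : 1 - x = a1 by lra.
    have -> : x - (1 - b) = b - a2 by lra.
    by rewrite e1 e2; ring.
  have [xb|xb] := leP (1 - x) a2; last by congr (_ + _ * _); ring.
  by rewrite (_ : x - (1 - b) = b - a2) ?e2; [ring|lra].
have [x1|x1] := leP x (1 - a1).
  have [xa|xa] := leP (1 - x) a1; last by rewrite ifT//; lra.
  by rewrite (_ : 1 - x - a = a1 - a) ?e1; [ring|lra].
by rewrite ifT; [congr (_ + _ * _); ring|lra].
Qed.

Lemma trapezoid_range (R : realType) (a a1 a2 b ga gm gb x : R) :
  a < a1 -> a1 <= a2 -> a2 < b -> 0 <= ga <= gm -> 0 <= gb <= gm ->
  a <= x <= b -> 0 <= trapezoid a a1 a2 b ga gm gb x <= gm.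
Proof.
move=> h1 h2 h3 /andP[ga0 gam] /andP[gb0 gbm] /andP[ax xb].
have line (u v t : R) : 0 <= u -> u <= v -> 0 <= t -> t <= 1 -> 0 <= u + (v - u) * t <= v.
  move=> u0 uv t0 t1; have vu : 0 <= v - u by lra.
  have := mulr_ge0 vu t0; have : (v - u) * t <= v - u by rewrite ler_piMr.
  by lra.
rewrite /trapezoid; have [xa1|xa1] := leP x a1.
  rewrite mulrAC -mulrA; apply: line => //; first by rewrite divr_ge0; lra.
  by rewrite ler_pdivrMr; lra.
have [xa2|xa2] := leP x a2; first by rewrite lexx (le_trans ga0).
rewrite mulrAC -mulrA; apply: line => //; first by rewrite divr_ge0; lra.
by rewrite ler_pdivrMr; lra.
Qed.

Lemma trapezoid_left (R : realType) (a a1 a2 b ga gm gb : R) : a < a1 ->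
  trapezoid a a1 a2 b ga gm gb a = ga.
Proof. by move=> aa1; rewrite /trapezoid (ltW aa1) subrr mulr0 addr0. Qed.

Lemma trapezoid_right (R : realType) (a a1 a2 b ga gm gb : R) :
  a1 <= a2 -> a2 < b -> trapezoid a a1 a2 b ga gm gb b = gb.
Proof.
move=> a12 a2b; rewrite /trapezoid !leNgt a2b (le_lt_trans a12 a2b)/=.
by rewrite subrr mulr0 addr0.
Qed.

Lemma ac_energy_trapezoid (R : realType) (a a1 a2 b ga gm gb : R) :
  a < a1 -> a1 <= a2 -> a2 < b -> 0 <= ga <= gm -> 0 <= gb <= gm ->
  gm < c0 R / 2 ->
  exists f, ac_energy a b (fun x => Ginv (trapezoid a a1 a2 b ga gm gb x)) f
    ((gm - ga) ^+ 2 / (a1 - a) + (gm - gb) ^+ 2 / (b - a2)).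
Proof.
move=> h1 h2 h3 hga hgb gmc.
have range x : a <= x <= b -> 0 <= trapezoid a a1 a2 b ga gm gb x < c0 R / 2.
  move=> xab; have /andP[-> h] := trapezoid_range h1 h2 h3 hga hgb xab.
  exact: le_lt_trans gmc.
pose s1 := (gm - ga) / (a1 - a); pose s2 := (gm - gb) / (b - a2).
pose k s c x := s * ginv5 (Ginv (c + s * x : R)).
exists (fun x => if x <= a1 then k s1 (ga - s1 * a) x
  else if x <= a2 then k 0 gm x else k (- s2) (gb + s2 * b) x).
have T1 x : x <= a1 -> trapezoid a a1 a2 b ga gm gb x = ga - s1 * a + s1 * x.
  by move=> xa1; rewrite /trapezoid xa1 -/s1; ring.
have T2 x : a1 <= x <= a2 -> trapezoid a a1 a2 b ga gm gb x = gm + 0 * x.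
  move=> /andP[xa1 xa2]; rewrite mul0r addr0 /trapezoid xa2; case: leP => // xa1'.
  rewrite (@le_anti _ _ x a1) ?xa1 ?xa1'// divfK; first by ring.
  by rewrite subr_eq0 gt_eqF.
have T3 x : a2 <= x -> trapezoid a a1 a2 b ga gm gb x = gb + s2 * b + - s2 * x.
  rewrite le_eqVlt => /predU1P[<-|xa2].
    rewrite T2 ?h2 ?lexx// mul0r addr0.
    have : s2 * (b - a2) = gm - gb by rewrite divfK// subr_eq0 gt_eqF.
    by lra.
  by rewrite /trapezoid !leNgt xa2 (le_lt_trans h2 xa2)/= -/s2; ring.
have -> : (gm - ga) ^+ 2 / (a1 - a) + (gm - gb) ^+ 2 / (b - a2) =
    s1 ^+ 2 * (a1 - a) + (0 ^+ 2 * (a2 - a1) + (- s2) ^+ 2 * (b - a2)).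
  by rewrite /s1 /s2; field; rewrite !subr_eq0 !gt_eqF.
have aa2 := lt_le_trans h1 h2; have a1b := le_lt_trans h2 h3.
apply: (ac_energy_cat (ltW h1) (ltW a1b)).
  apply: eq_ac_energy (ac_energy_line (ltW h1) (c := ga - s1 * a) (s := s1) _).
  - by move=> x /andP[_ xa]; rewrite T1.
  - by move=> x /andP[_ xa]; rewrite (ltW xa).
  - by move=> x /andP[ax xa]; rewrite -T1// range// ax (le_trans xa)// ltW.
apply: (ac_energy_cat h2 (ltW h3)).
  apply: eq_ac_energy (ac_energy_line h2 (c := gm) (s := 0) _).
  - by move=> x xa; rewrite T2.
  - by move=> x /andP[xa xa2]; rewrite leNgt xa (ltW xa2).
  - move=> x /andP[xa xa2]; rewrite -T2 ?xa// range//.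
    by rewrite (le_trans (ltW h1))// (le_trans xa2)// ltW.
apply: eq_ac_energy (ac_energy_line (ltW h3) (c := gb + s2 * b) (s := - s2) _).
- by move=> x /andP[xa _]; rewrite T3.
- by move=> x /andP[xa _]; rewrite !leNgt xa (le_lt_trans h2 xa).
- by move=> x /andP[xa xb]; rewrite -T3// range// xb andbT (le_trans (ltW aa2)).
Qed.

Lemma continuous_max_itv (R : realType) (f : R -> R) (a b : R) :
  a <= b -> continuous f ->
  exists2 c, a <= c <= b & forall x, a <= x <= b -> f x <= f c.
Proof.
move=> ab cf; have cw : {within `[a, b], continuous f} by exact: continuous_subspaceT.
have [c] := EVT_max ab cw; rewrite in_itv/= => cab hc.
by exists c => // x xab; apply: hc; rewrite in_itv.
Qed.

Lemma ac_energyN (R : realType) (a b : R) (F f : R -> R) (e : R) :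
  ac_energy a b F f e -> ac_energy a b (fun x => - F x) (fun x => - f x) e.
Proof.
move=> [h1 h2 h3 <-].
have eE x : energy f F x = energy (fun x => - f x) (fun x => - F x) x.
  by rewrite /energy qfN mulNr sqrrN.
split.
- have := ac_itvZ (- 1) h1.
  by apply: eq_ac_itv => x _; rewrite mulN1r.
- by apply: eq_integrable_oo h2 => x _; rewrite sqrrN.
- by apply: eq_integrable_oo h3 => x _; exact: eE.
- by apply: eq_Rintegral => x _; rewrite eE.
Qed.

Lemma H20_data_energy (R : realType) (v p k : R -> R) : H20_data v p k ->
  ac_energy 0 1 p k (\int[lebesgue_measure]_(x in `[0, 1]) energy k p x).
Proof.
move=> h; have cp := H20_data_continuous h; have [[mk ki] _ ap _ _] := h.
split => //; first exact: integrable_itv_oo_cc.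
by apply: integrable_itv_oo_cc; exact: energy_integrable.
Qed.

(** A slope that is odd about 1 / 2 has an even primitive, so the end condition [v 1 = 0] comes for
    free from [v 0 = 0]. *)
Lemma ac_energy_H20_data (R : realType) (p k : R -> R) (e : R) :
  ac_energy 0 1 p k e -> (forall x, x <= 0 \/ 1 <= x -> p x = 0) ->
  (forall x, 0 < x < 1 / 2 -> p (1 - x) = - p x) ->
  exists v, H20_data v p k /\ forall x, 0 <= x <= 1 -> v (1 - x) = v x.
Proof.
move=> [ap ki ei ee] p_out p_odd.
have cp : continuous p.
  apply: ac_continuous ap _ _ => x hx; first by rewrite !p_out//; left.
  by rewrite !p_out//; right.
have [v [v0 dv]] := antiderivative cp; exists v.
have half x : 0 <= x <= 1 / 2 -> v (1 - x) = v x.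
  move=> /andP[x0 x1].
  have dw (t : R) : is_derive t 1 (fun t => v t - v (1 - t)) (p t + p (1 - t)).
    have dl : is_derive t 1 (fun t => 1 - t) (- 1) by der; ring.
    have h1 := dv t; have h2 := @der_comp _ v (fun t => 1 - t) t _ _ (dv _) dl.
    by der; ring.
  have z t : x < t < 1 / 2 -> p t + p (1 - t) = 0.
    by move=> /andP[xt t1]; rewrite p_odd ?subrr// (le_lt_trans x0 xt).
  have : v (1 / 2) - v (1 - 1 / 2) = v x - v (1 - x).
    apply/le_anti/andP; split.
      by apply: (der_le0 x1 (fun t _ => dw t)) => t /z ->.
    by apply: (der_ge0 x1 (fun t _ => dw t)) => t /z ->.
  rewrite (_ : 1 - 1 / 2 = 1 / 2); last by field.
  by rewrite subrr; lra.
have sym x : 0 <= x <= 1 -> v (1 - x) = v x.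
  move=> /andP[x0 x1]; have [xh|xh] := leP x (1 / 2); first by rewrite half// x0.
  by rewrite -half; [congr v; ring|apply/andP; split; lra].
split => //; split => //.
- split; last exact: integrable_cc_oo.
  case: ap => /integrable_cc_oo ik _; apply/measurable_EFinP; exact: measurable_int ik.
- by split => //; rewrite -v0 -[RHS]sym ?lexx ?ler01// subr0.
Qed.

(* The slope of [v] is [p] up to [alpha], then follows the line in the variable
   G up to a value so steep that [v] exceeds the maximum of [u] after keeping
   this slope for a length [delta], and finally descends to 0 at [L], linearly
   in the variable G; after [L] it is [p] again. *)
Lemma competitor (R : realType) (u p k : R -> R) (alpha L sigma delta : R) :
  H20_data u p k ->
  (forall x, 0 <= x <= 1 -> u (1 - x) = u x) ->
  (forall x, 0 < x < 1 -> p (1 - x) = - p x) ->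
  0 <= alpha -> alpha < L -> L <= 1 / 2 -> p L = 0 -> 0 <= p alpha -> 0 < sigma ->
  G (p alpha) = c0 R - sigma * (L - alpha) ->
  (forall x, alpha <= x <= L -> G (p x) <= c0 R - sigma * (L - x)) ->
  0 < delta -> delta < c0 R / 2 / sigma ->
  exists v q j e, [/\ H20_data v q j, forall x, 0 <= x <= 1 -> v (1 - x) = v x,
    forall x, 0 <= x <= 1 -> u x <= v x, ac_energy 0 1 q j e &
    e <= \int[lebesgue_measure]_(x in `[0, 1]) energy k p x -
      \int[lebesgue_measure]_(x in `[alpha, L]) energy k p x -
      \int[lebesgue_measure]_(x in `[1 - L, 1 - alpha]) energy k p x +
      2 * (sigma * (c0 R / 2 - G (p alpha)) +
           (c0 R / 2) ^+ 2 / (c0 R / 2 / sigma - delta))].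
Proof.
move=> hu u_sym p_odd al0 alL L2 pL pal sg0 Gal Gl d0 d1.
have L1 : L <= 1 by lra.
have L_lt1 : L < 1 by lra.
have L10 : 0 <= 1 - L by lra.
have LA : 1 - L <= 1 - alpha by lra.
have A1 : 1 - alpha <= 1 by lra.
have half1 : 1 / 2 < 1 :> R by lra.
have halfC (x : R) : 1 / 2 < x -> 1 - x < 1 / 2 by move=> ?; lra.
have halfB (x : R) : x < 1 / 2 -> 1 / 2 < 1 - x by move=> ?; lra.
have half_le : 1 / 2 <= 1 - 1 / 2 :> R by lra.
have L1L : L <= 1 - L by lra.
have fin (A B C e X : R) : e <= X -> A - B + e - C + e <= A - B - C + 2 * X by move=> ?; lra.
have cp := H20_data_continuous hu; have [_ p_out _ du [u0 u1]] := hu.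
have [K hK] : exists K, forall x, 0 <= x <= 1 -> `|u x| <= K /\ p x <= K.
  have cn : continuous (fun x => `|u x|).
    by move=> x; apply: cvg_norm; exact: der_continuous (du x).
  have [c1 _ hc1] := continuous_max_itv ler01 cp.
  have [c2 _ hc2] := continuous_max_itv ler01 cn.
  by exists (Num.max `|u c2| (p c1)) => x x01; rewrite !le_max hc1// hc2// orbT.
have K0 : 0 <= K by have [|h _] := hK 0; [rewrite lexx ler01|exact: le_trans h].
(* [m > K] keeps the plateau slope above [p], and [m * delta >= 2 * K] lifts [v] by at least the
   possible oscillation of [u]. *)
pose m := K + 1 + 2 * K / delta.
have Kd0 : 0 <= 2 * K / delta by rewrite divr_ge0 ?mulr_ge0// ltW.
have Km : K < m by rewrite /m; lra.
have mdelta : 2 * K <= m * delta.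
  have -> : m * delta = (K + 1) * delta + 2 * K by rewrite /m; field; rewrite gt_eqF.
  by rewrite lerDr mulr_ge0 ?(ltW d0)//; lra.
pose ga := G (p alpha); pose gm := G m.
have al1 : 0 <= alpha <= 1 by lra.
have gam : ga < gm by rewrite G_lt (le_lt_trans _ Km)//; have [] := hK alpha al1.
have gmc : gm < c0 R / 2 := G_lt_c0 m.
have ga0 : 0 <= ga by exact: G_ge0.
have gm0 : 0 < gm := le_lt_trans ga0 gam.
pose a1 := alpha + (gm - ga) / sigma; pose a2 := a1 + delta.
have sL : sigma * (L - alpha) = c0 R - ga by rewrite /ga Gal; ring.
have s1 : sigma * (a1 - alpha) = gm - ga.
  by rewrite /a1; field; rewrite gt_eqF.
have h1 : alpha < a1 by rewrite ltrDl divr_gt0// subr_gt0.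
have h2 : a1 <= a2 by rewrite lerDl ltW.
have s2 : sigma * (c0 R / 2 / sigma) = c0 R / 2 by field; rewrite gt_eqF.
(* Rising at speed [sigma] from [ga] to c0 / 2 would leave exactly c0 / 2 / sigma before [L]; the
   plateau takes at most [delta] of it. *)
have La2 : c0 R / 2 / sigma - delta <= L - a2.
  rewrite -(ler_pM2l sg0) /a2 !mulrBr mulrDr s2.
  by move: sL s1; rewrite !mulrBr; lra.
have h3 : a2 < L by lra.
have a1al : a1 - alpha != 0 by rewrite subr_eq0 gt_eqF.
have slope : (gm - ga) / (a1 - alpha) = sigma by rewrite -s1 mulfK.
have hga : 0 <= ga <= gm by rewrite ga0 ltW.
have hgb : 0 <= (0 : R) <= gm by rewrite lexx ltW.
pose T := trapezoid alpha a1 a2 L ga gm 0.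
pose F x := Ginv (T x).
have [f hf] : exists f, ac_energy alpha L F f
    ((gm - ga) ^+ 2 / (a1 - alpha) + (gm - 0) ^+ 2 / (L - a2)).
  exact: ac_energy_trapezoid.
have [f' hf'] : exists f', ac_energy (1 - L) (1 - alpha) (fun x => - F (1 - x)) f'
    ((gm - ga) ^+ 2 / (a1 - alpha) + (gm - 0) ^+ 2 / (L - a2)).
  have k1 : 1 - L < 1 - a2 by lra.
  have k2 : 1 - a2 <= 1 - a1 by lra.
  have k3 : 1 - a1 < 1 - alpha by lra.
  have [f' /ac_energyN hf'] := ac_energy_trapezoid k1 k2 k3 hgb hga gmc.
  exists (fun x => - f' x).
  have -> : (gm - ga) ^+ 2 / (a1 - alpha) + (gm - 0) ^+ 2 / (L - a2) =
    (gm - 0) ^+ 2 / (1 - a2 - (1 - L)) + (gm - ga) ^+ 2 / (1 - alpha - (1 - a1)).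
    rewrite addrC; congr (_ + _); congr (_ / _); ring.
  by apply: eq_ac_energy hf' => // x _; rewrite trapezoid_mirror.
set e' := _ + _ in hf hf'.
have Fal : F alpha = p alpha by rewrite /F /T trapezoid_left// GK.
have FL : F L = 0 by rewrite /F /T trapezoid_right// -{1}(G0 R) GK.
have hp := H20_data_energy hu.
have hq1 := ac_energy_replace al0 (ltW alL) L1 hp hf Fal (etrans FL (esym pL)).
set q1 := (fun x => if alpha <= x <= L then F x else p x) in hq1.
set j1 := (fun x => if alpha <= x <= L then f x else k x) in hq1.
have q1l : - F (1 - (1 - L)) = q1 (1 - L).
  rewrite (_ : 1 - (1 - L) = L); last by ring.
  rewrite FL oppr0 /q1; case: ifP => [/andP[_ hL]|_].
    (* This case arises only for [L = 1 / 2], where the two replaced intervals share an end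
       point. *)
    by rewrite (_ : 1 - L = L) ?FL//; lra.
  by rewrite p_odd ?pL ?oppr0//; lra.
have q1r : - F (1 - (1 - alpha)) = q1 (1 - alpha).
  rewrite (_ : 1 - (1 - alpha) = alpha); last by ring.
  rewrite Fal /q1 ifF; last by apply/negbTE/negP => /andP[]; lra.
  move: al0; rewrite le_eqVlt => /predU1P[<-|al0'].
    by rewrite subr0 !p_out ?oppr0//; [right|left].
  by rewrite p_odd//; lra.
have hq2 := ac_energy_replace L10 LA A1 hq1 hf' q1l q1r.
set q := (fun x => if 1 - L <= x <= _ then _ else q1 x) in hq2.
set j := (fun x => if 1 - L <= x <= _ then f' x else j1 x) in hq2.
have q_left x : x < 1 / 2 -> q x = q1 x.
  move=> xh; rewrite /q ifF//; apply/negbTE; rewrite negb_and -ltNge.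
  by rewrite (lt_le_trans xh)// (le_trans _ (lerB (lexx 1) L2))// half_le.
have q1_out x : L < x -> q1 x = p x.
  by move=> Lx; rewrite /q1 [x <= L]leNgt Lx andbF.
have q_out x : x <= 0 \/ 1 <= x -> q x = 0.
  case=> [x0|x1].
    rewrite q_left ?(le_lt_trans x0)// /q1; case: ifP => [/andP[ax _]|_];
      last by rewrite p_out//; left.
    have -> : x = alpha by apply: le_anti; rewrite ax (le_trans x0).
    by rewrite Fal p_out//; left; rewrite (le_trans ax).
  rewrite /q; case: ifP => [/andP[_ xa]|_]; last first.
    by rewrite q1_out ?(lt_le_trans L_lt1)// p_out//; right.
  have -> : 1 - x = alpha.
    apply/le_anti/andP; split; first by rewrite (le_trans _ al0)// subr_le0.
    by rewrite lerBrDr addrC -lerBrDr.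
  by rewrite Fal p_out ?oppr0//; left; move: (le_trans x1 xa); rewrite lerBrDl gerDr.
have q_odd x : 0 < x < 1 / 2 -> q (1 - x) = - q x.
  move=> /andP[x0 xh]; rewrite (q_left x xh) /q /q1 !lerD2l !lerN2 andbC.
  rewrite (_ : 1 - (1 - x) = x); last by ring.
  case: ifP => // _; rewrite ifF; first by rewrite p_odd// x0 (lt_trans xh half1).
  apply/negbTE; rewrite negb_and -!ltNge; apply/orP; right.
  exact: le_lt_trans L2 (halfB x xh).
have [v [hv v_sym]] := ac_energy_H20_data hq2 q_out q_odd.
have cq := H20_data_continuous hv; have [_ _ _ dv [v0 v1]] := hv.
have dvu (t : R) : is_derive t 1 (fun t => v t - u t) (q t - p t).
  by have k1 := dv t; have k2 := du t; der.
have T_range x : alpha <= x <= L -> 0 <= T x < c0 R / 2.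
  move=> xaL; have /andP[-> h] := trapezoid_range h1 h2 h3 hga hgb xaL.
  exact: le_lt_trans gmc.
have q_F x : alpha <= x -> x < L -> q x = F x.
  by move=> ax xL; rewrite q_left ?(lt_le_trans xL)// /q1 ax (ltW xL).
have q_m x : a1 < x -> x <= a2 -> q x = m.
  move=> x1 x2; rewrite q_F ?(le_trans (ltW h1) (ltW x1))// ?(le_lt_trans x2)//.
  by rewrite /F /T /trapezoid leNgt x1 x2 GK.
have q_ge x : 0 < x < a2 -> p x <= q x.
  move=> /andP[x0 x2]; have xL := lt_trans x2 h3.
  have x01 : 0 <= x <= 1 by rewrite (ltW x0) (le_trans (ltW xL)).
  have [ax|xa] := leP alpha x; last first.
    by rewrite q_left ?(lt_le_trans xL)// /q1 [alpha <= x]leNgt xa.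
  have [x1|x1] := leP x a1; last first.
    by rewrite q_m ?(ltW x2)// (le_trans _ (ltW Km))//; have [] := hK x x01.
  have xaL : alpha <= x <= L by rewrite ax ltW.
  rewrite q_F// -G_le GinvK ?T_range//; apply: le_trans (Gl x xaL) _.
  rewrite /T /trapezoid x1 slope -(subrK (sigma * (L - alpha)) (c0 R)) sL.
  by rewrite le_eqVlt; apply/orP; left; apply/eqP; rewrite /ga Gal; ring.
have left_ge x : 0 <= x -> x <= a2 -> u x <= v x.
  move=> x0 xa2; rewrite -subr_ge0.
  have -> : 0 = v 0 - u 0 by rewrite u0 v0 subrr.
  apply: (der_ge0 x0 (fun t _ => dvu t)) => t /andP[t0 tx].
  by rewrite subr_ge0 q_ge// t0 (lt_le_trans tx).
have mid_ge x : a2 <= x -> x <= L -> u x <= v x.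
  move=> a2x xL.
  have x01 : 0 <= x <= 1.
    by rewrite (le_trans al0 (le_trans (ltW h1) (le_trans h2 a2x))) (le_trans xL).
  have a01 : 0 <= a1 <= 1.
    by rewrite (le_trans al0 (ltW h1)) (le_trans h2 (le_trans (ltW h3) L1)).
  have /andP[a10 _] := a01.
  have v2x : v a2 <= v x.
    apply: (der_ge0 a2x (fun t _ => dv t)) => t /andP[at_ tx].
    have tL := lt_le_trans tx xL.
    have alt : alpha <= t by rewrite (le_trans (ltW h1))// (le_trans h2)// ltW.
    by rewrite q_F// Ginv_ge0// T_range// alt ltW.
  have v12 : v a1 - m * a1 <= v a2 - m * a2.
    have dvm (t : R) : is_derive t 1 (fun t => v t - m * t) (q t - m).
      by have k1 := dv t; der; ring.
    apply: (der_ge0 h2 (fun t _ => dvm t)) => t /andP[t1 t2].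
    by rewrite q_m ?subrr// ltW.
  have ua := left_ge a1 a10 h2.
  have [ux _] := hK x x01; have [ua1 _] := hK a1 a01.
  have a2E : m * a2 = m * a1 + m * delta by rewrite /a2 mulrDr.
  have := ler_norm (u x); have := ler_norm (- u a1); rewrite normrN.
  move: ux ua1 ua v12 v2x mdelta a2E.
  move: (u x) (v x) (u a1) (v a1) (v a2) `|u x| `|u a1| (m * a1) (m * a2) (m * delta).
  by clear; move=> *; lra.
have half_ge x : 0 <= x -> x <= 1 / 2 -> u x <= v x.
  move=> x0 xh; have [xa2|/ltW a2x] := leP x a2; first exact: left_ge.
  have [xL|/ltW Lx] := leP x L; first exact: mid_ge.
  (* Between [L] and 1 / 2 the two slopes coincide, so the advantage gained at [L] persists. *)
  have : v L - u L <= v x - u x.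
    apply: (der_ge0 Lx (fun t _ => dvu t)) => t /andP[Lt tx].
    rewrite q_left; last exact: lt_le_trans xh.
    by rewrite /q1 [t <= L]leNgt Lt andbF subrr.
  rewrite -[u x <= v x]subr_ge0; apply: le_trans; rewrite subr_ge0.
  exact: mid_ge (ltW h3) (lexx _).
exists v, q, j; eexists; split; [exact: hv|exact: v_sym| |exact: hq2|].
  move=> x /andP[x0 x1]; have [xh|xh] := leP x (1 / 2); first exact: half_ge.
  have x01 : 0 <= x <= 1 by rewrite x0.
  by rewrite -(u_sym x x01) -(v_sym x x01); apply: half_ge; [rewrite subr_ge0|exact/ltW/halfC].
have -> : \int[lebesgue_measure]_(t in `[1 - L, 1 - alpha]) energy j1 q1 t =
    \int[lebesgue_measure]_(t in `[1 - L, 1 - alpha]) energy k p t.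
  have [_ _ ei _] := ac_energy_sub L10 A1 hp.
  apply/esym/eq_Rintegral_oo => // x /andP[xL _].
  have Lx : L < x := le_lt_trans L1L xL.
  by rewrite /energy q1_out// /j1 [x <= L]leNgt Lx andbF.
have e'_le : e' <= sigma * (c0 R / 2 - G (p alpha)) +
    (c0 R / 2) ^+ 2 / (c0 R / 2 / sigma - delta).
  apply: lerD.
    by rewrite expr2 mulrAC slope ler_pM2l// lerD2r ltW.
  rewrite subr0; apply: ler_pM; rewrite ?sqr_ge0 ?invr_ge0 ?subr_ge0 ?(ltW h3)//.
    by rewrite lerXn2r ?nnegrE ?(ltW gm0)// ltW// (lt_trans gm0).
  by rewrite lef_pV2 ?posrE ?subr_gt0.
exact: fin.
Qed.

(** * Lower bounds for the energy *)

(** Pointwise this is (k q^5 - c s z)^2 >= 0 with [z = calib m (p t)] and z^2 = 1 - p^+/m <= 1 -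
    p/m. The sign [c], which is 1 or -1, selects whether a rise or a fall of [Psi] is estimated. *)
Lemma calibration_half (R : realType) (v p k Psi : R -> R) (a b m s c e : R) :
  a <= b -> continuous p -> (forall x : R, is_derive x 1 v (p x)) ->
  ac_energy a b p k e -> 0 < m -> c ^+ 2 = 1 ->
  (forall x : R, is_derive x 1 Psi (calib m x * qf x ^+ 5)) ->
  (forall x, a <= x <= b -> p x <= m) ->
  c * (2 * s * (Psi (p b) - Psi (p a))) <= e + s ^+ 2 * (b - a - (v b - v a) / m).
Proof.
move=> ab cp dv [ap ki ei ee] m0 c1 dPsi pm.
have cpsi : continuous (fun x => calib m x * qf x ^+ 5).
  by move=> x; apply: cvgM; [exact: continuous_calib|exact: continuous_qfX].
have [gi hg] := ac_chain cp cpsi dPsi ap.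
rewrite hg//.
have cl : continuous (fun t => s ^+ 2 * (1 - p t / m)).
  move=> t; apply: cvgMr; apply: cvgB; first exact: cvg_cst.
  by apply: cvgMl; exact: cp.
have dl (t : R) : is_derive t 1 (fun t => s ^+ 2 * (t - v t / m)) (s ^+ 2 * (1 - p t / m)).
  by have h := dv t; der; ring.
have li := continuous_integrable a b cl.
have -> : s ^+ 2 * (b - a - (v b - v a) / m) =
    \int[lebesgue_measure]_(t in `[a, b]) (s ^+ 2 * (1 - p t / m)).
  by rewrite (integral_der ab cl dl); ring.
rewrite -ee mulrA -RintegralD//.
rewrite -RintegralZl//.
apply: le_Rintegral => //.
- by apply: (integrable_continuousM (h := fun=> c * (2 * s))) gi => ?; exact: cvg_cst.
- exact: (integrableD _ ei li).
move=> t; rewrite /= in_itv/= => tab; rewrite /energy.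
have := calib_sqr m0 (pm t tab).
have : p t / m <= Num.max (p t) 0 / m by rewrite ler_pM2r ?invr_gt0// le_max lexx.
move: (Num.max _ _ / m) (p t / m) (calib m (p t)) (qf (p t) ^+ 5) => y x z w xy zy.
have := sqr_ge0 (k t * w - c * s * z).
have : s ^+ 2 * z ^+ 2 <= s ^+ 2 * (1 - x) by rewrite ler_wpM2l ?sqr_ge0// zy; lra.
have -> : (k t * w - c * s * z) ^+ 2 =
    (k t * w) ^+ 2 + c ^+ 2 * (s ^+ 2 * z ^+ 2) - c * (2 * s) * (z * w * k t) by ring.
rewrite c1 mul1r; lra.
Qed.

(** The sign is 1 up to the point where [p = m] and -1 after it, so the climb to [Psi m] and the
    descent from it are both counted, however [p] oscillates in between. *)
Lemma calibration_integral (R : realType) (v p k Psi : R -> R) (a b m s x e : R) :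
  continuous p -> (forall x : R, is_derive x 1 v (p x)) ->
  ac_energy a b p k e -> 0 < m ->
  (forall x : R, is_derive x 1 Psi (calib m x * qf x ^+ 5)) ->
  (forall x, a <= x <= b -> p x <= m) -> a <= x <= b -> p x = m ->
  2 * s * (2 * Psi m - Psi (p a) - Psi (p b)) <=
    e + s ^+ 2 * (b - a - (v b - v a) / m).
Proof.
move=> cp dv he m0 dPsi pm /andP[ax xb] pxm.
have [_ _ ei <-] := he; rewrite (Rintegral_split ax xb ei).
have h1 := ac_energy_sub (lexx a) xb he; have h2 := ac_energy_sub ax (lexx b) he.
have n1 : (-1 : R) ^+ 2 = 1 by rewrite sqrrN expr1n.
have k1 := @calibration_half R v p k Psi a x m s 1 _ ax cp dv h1 m0 (expr1n _ 2) dPsi.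
have k2 := @calibration_half R v p k Psi x b m s (-1) _ xb cp dv h2 m0 n1 dPsi.
have -> : 2 * s * (2 * Psi m - Psi (p a) - Psi (p b)) =
  1 * (2 * s * (Psi (p x) - Psi (p a))) + - 1 * (2 * s * (Psi (p b) - Psi (p x))).
  by rewrite pxm; ring.
have -> : b - a - (v b - v a) / m =
  x - a - (v x - v a) / m + (b - x - (v b - v x) / m) by ring.
set e1 := Rintegral _ _ _; set e2 := Rintegral _ _ _.
rewrite [s ^+ 2 * (_ + _)]mulrDr [leRHS]addrACA; apply: lerD.
  by apply: k1 => t /andP[at_ tx]; rewrite pm// at_ (le_trans tx).
by apply: k2 => t /andP[xt tb]; rewrite pm// tb (le_trans ax).
Qed.

Lemma der_uniq (R : realType) (f : R -> R) (x d e : R) :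
  is_derive x 1 f d -> is_derive x 1 f e -> d = e.
Proof. by move=> [_ <-] [_ <-]. Qed.

Lemma H20_data_Rintegral (R : realType) (v p k : R -> R) : H20_data v p k ->
  (\int[lebesgue_measure]_(x in `]0%R, 1%R[) (energy k p x)%:E)%E =
  (\int[lebesgue_measure]_(x in `[0, 1]) energy k p x)%:E.
Proof.
move=> h; have cp := H20_data_continuous h; have [sk _ _ _ _] := h.
have ei := energy_integrable cp sk.
by rewrite -(Rintegral_oo_cc ei) /Rintegral fineK//; exact: integrable_fin_num ei.
Qed.

Lemma der_even (R : realType) (v p : R -> R) :
  (forall x : R, is_derive x 1 v (p x)) ->
  (forall x, 0 <= x <= 1 -> v (1 - x) = v x) ->
  forall x, 0 < x < 1 -> p (1 - x) = - p x.
Proof.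
move=> dv v_sym x /andP[x0 x1].
have dl : is_derive x 1 (fun t : R => 1 - t) (- 1) by der; ring.
have h := @der_comp _ v (fun t => 1 - t) x _ _ (dv (1 - x)) dl.
have {h} : is_derive x 1 v (p (1 - x) * - 1).
  apply: near_eq_is_derive h; near=> t; apply: v_sym; apply/andP; split; apply/ltW.
    by near: t; exact: near_gt.
  by near: t; exact: near_lt.
by move=> /der_uniq -/(_ _ (dv x)) <-; ring.
Unshelve. all: by end_near. Qed.

(** * The height of a minimiser *)

Lemma symmetric_minimiser (R : realType) (psi u : R -> R) : admissible psi u ->
  exists v p k : R -> R, [/\ H20_data v p k, forall x, 0 <= x <= 1 -> u x = v x,
    elastica u = (\int[lebesgue_measure]_(x in `[0, 1]) energy k p x)%:E,
    forall x, 0 <= x <= 1 -> v (1 - x) = v x &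
    forall x, 0 < x < 1 -> p (1 - x) = - p x].
Proof.
move=> [hu u_sym _]; have [v [p [k [h uv ue]]]] := H20_representation hu.
have v_sym x : 0 <= x <= 1 -> v (1 - x) = v x.
  have [_ _ _ _ [v0 v1]] := h.
  move=> /andP[]; rewrite le_eqVlt => /predU1P[<-|x0]; first by rewrite subr0 v0 v1.
  rewrite le_eqVlt => /predU1P[->|x1]; first by rewrite subrr v0 v1.
  by rewrite -!uv ?subr_ge0 ?gerBl ?ltW// -u_sym// x0.
exists v, p, k; split => //; first by rewrite ue; exact: H20_data_Rintegral h.
by have [_ _ _ dv _] := h; exact: der_even.
Qed.

(* It suffices to minimise the slope of the segments from [(x, G (p x))] to
   [(L, c0)] over [x <= L / 2]: for [x >= L / 2] a line starting above [G 0] is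
   above [c0 / 2]. *)
Lemma touching_line (R : realType) (p : R -> R) (L : R) :
  continuous p -> p 0 = 0 -> 0 < L ->
  exists alpha sigma, [/\ 0 <= alpha < L, 0 < sigma, sigma * L <= c0 R,
    G (p alpha) = c0 R - sigma * (L - alpha) &
    forall x, 0 <= x <= L -> G (p x) <= c0 R - sigma * (L - x)].
Proof.
move=> cp p0 L0; have c00 := c0_gt0 R.
pose f x := (G (p x) - c0 R) / (L - x).
have pos x : x <= L / 2 -> 0 < L - x by lra.
have cf : {within `[0, L / 2], continuous f}.
  apply: continuous_in_subspaceT => x; rewrite inE/= in_itv/= => /andP[_ /pos xL].
  apply: cvgM; first apply: cvgB; last apply: cvgV.
  - by apply: (@continuous_comp _ _ _ p (@G R)); [exact: cp|exact: continuous_G].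
  - exact: cvg_cst.
  - by rewrite gt_eqF.
  - by apply: cvgB; [exact: cvg_cst|exact: cvg_id].
have L20 : 0 <= L / 2 by lra.
have [alpha] := EVT_max L20 cf; rewrite in_itv/= => /andP[a0 aL] fmax.
have aL' := pos _ aL.
have fE x : x <= L / 2 -> f x * (L - x) = G (p x) - c0 R.
  by move=> /pos xL; rewrite /f divfK// gt_eqF.
(* Comparison with [x = 0], where [G (p 0) = 0]: the line starts at a nonnegative height. *)
have f0 : - f alpha * L <= c0 R.
  have := fmax 0; rewrite in_itv/= lexx L20 => /(_ isT).
  have := fE 0 L20; rewrite p0 G0 subr0 sub0r => e h.
  have : f 0 * L <= f alpha * L by rewrite ler_pM2r.
  by lra.
exists alpha, (- f alpha); split => //.
- by rewrite a0; lra.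
- rewrite oppr_gt0 /f pmulr_llt0 ?invr_gt0// subr_lt0.
  by have := G_lt_c0 (p alpha); lra.
- by have := fE _ aL; lra.
move=> x /andP[x0 xL]; have [xL2|xL2] := leP x (L / 2).
  have := fmax x; rewrite in_itv/= x0 xL2 => /(_ isT) => h.
  have : f x * (L - x) <= f alpha * (L - x) by rewrite ler_pM2r// pos.
  by rewrite fE//; lra.
have := G_lt_c0 (p x).
have fneg : 0 <= - f alpha.
  rewrite oppr_ge0 /f pmulr_lle0 ?invr_gt0// subr_le0.
  by have := G_lt_c0 (p alpha); lra.
have : - f alpha * (L - x) <= - f alpha * (L / 2) by rewrite ler_wpM2l//; lra.
by lra.
Qed.

(** The slope [P = Ginv (line)] integrates explicitly: G'(P) P' = sigma and q'(P) = - (P / 2) G'(P)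
    make - P the derivative of (2 / sigma) q(P). As p <= P before [alpha], the sum of [u] and (2 /
    sigma) q(P) does not increase. *)
Lemma rise_before_contact (R : realType) (u p : R -> R) (alpha L sigma : R) :
  (forall x : R, is_derive x 1 u (p x)) -> u 0 = 0 ->
  0 <= alpha < L -> 0 < sigma -> sigma * L <= c0 R ->
  G (p alpha) = c0 R - sigma * (L - alpha) ->
  (forall x, 0 <= x <= L -> G (p x) <= c0 R - sigma * (L - x)) ->
  u alpha <= 2 / sigma * (qf (Ginv (c0 R - sigma * L)) - qf (p alpha)).
Proof.
move=> du u0 /andP[a0 aL] s0 sL Ga Gp.
pose P x := Ginv (c0 R - sigma * L + sigma * x).
have Prange x : 0 <= x <= alpha -> 0 <= c0 R - sigma * L + sigma * x < c0 R / 2.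
  move=> /andP[x0 xa]; have := G_lt_c0 (p alpha).
  have : 0 <= sigma * x by rewrite mulr_ge0// ltW.
  have : sigma * x <= sigma * alpha by rewrite ler_wpM2l// ltW.
  by rewrite Ga; lra.
have dF x : 0 <= x <= alpha -> is_derive x 1 (fun x => u x + 2 / sigma * qf (P x))
    (p x - P x).
  move=> /Prange xr; have h1 := der_Ginv_lin xr.
  have h2 := @der_comp _ (@qf R) P x _ _ (der_qf _) h1; have h3 := du x.
  der; rewrite -/(P x) mulr0 addr0; congr (_ + _).
  transitivity (- P x * (ginv5 (P x) * qf (P x) ^+ 5)); last by rewrite ginv5E mulr1.
  by field; rewrite gt_eqF.
have := der_le0 a0 dF; rewrite u0 add0r /P mulr0 addr0.
rewrite (_ : c0 R - _ + _ = G (p alpha)); last by rewrite Ga; ring.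
rewrite GK mulrBr lerBrDr; apply => x /andP[x0 xa].
rewrite subr_le0 -G_le GinvK; last by apply: Prange; rewrite !ltW.
by apply: le_trans (Gp _ _) _; [rewrite ltW// ltW// (lt_trans xa)|lra].
Qed.

(** As [delta] tends to 0, the descent too has speed [sigma], and each half of the competitor costs
    sigma (c0 / 2 - G(p(alpha))) + sigma c0 / 2 = sigma^2 (L - alpha). *)
Lemma minimiser_energy (R : realType) (psi w u p k : R -> R) (alpha L sigma : R) :
  elastica w = (\int[lebesgue_measure]_(x in `[0, 1]) energy k p x)%:E ->
  (forall v, admissible psi v -> (elastica w <= elastica v)%E) ->
  H20_data u p k -> (forall x, 0 < x < 1 -> psi x <= u x) ->
  (forall x, 0 <= x <= 1 -> u (1 - x) = u x) ->
  (forall x, 0 < x < 1 -> p (1 - x) = - p x) ->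
  0 <= alpha < L -> L <= 1 / 2 -> p L = 0 -> 0 <= p alpha -> 0 < sigma ->
  G (p alpha) = c0 R - sigma * (L - alpha) ->
  (forall x, 0 <= x <= L -> G (p x) <= c0 R - sigma * (L - x)) ->
  \int[lebesgue_measure]_(x in `[alpha, L]) energy k p x +
  \int[lebesgue_measure]_(x in `[1 - L, 1 - alpha]) energy k p x <=
  2 * sigma ^+ 2 * (L - alpha).
Proof.
move=> we w_min hu psi_u u_sym p_odd /andP[a0 aL] L12 pL pa s0 Ga Gp.
have Gp' x : alpha <= x <= L -> G (p x) <= c0 R - sigma * (L - x).
  by move=> /andP[ax xL]; rewrite Gp// xL (le_trans a0).
have := competitor hu u_sym p_odd a0 aL L12 pL pa s0 Ga Gp'.
set E := Rintegral _ _ _; set e1 := Rintegral _ _ _; set e2 := Rintegral _ _ _ => comp.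
have {w_min}Emin delta : 0 < delta -> delta < c0 R / 2 / sigma ->
    e1 + e2 <= 2 * (sigma * (c0 R / 2 - G (p alpha)) +
      (c0 R / 2) ^+ 2 / (c0 R / 2 / sigma - delta)).
  move=> d0 d1; have [v [q [j [e [hv v_sym uv [_ _ _ ee] ele]]]]] := comp delta d0 d1.
  have [v20 ve] := H20_data_spec hv.
  have : (elastica w <= elastica v)%E.
    apply: w_min; split => // x /andP[x0 x1]; first by rewrite v_sym// !ltW.
    by apply: (le_trans (psi_u x _)); [rewrite x0|apply: uv; rewrite !ltW].
  rewrite we ve (H20_data_Rintegral hv) ee lee_fin -/E => Ee.
  by move: (le_trans Ee ele); rewrite -subr_ge0 => ?; rewrite -subr_ge0; lra.
have C0 : 0 < c0 R / 2 by have := c0_gt0 R; lra.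
have T0 : 0 < c0 R / 2 / sigma by rewrite divr_gt0.
rewrite leNgt; apply/negP => big.
set C := c0 R / 2 in C0 T0 Emin *; set T := C / sigma in T0 Emin *.
(* [z] is what minimality compares with the descent cost C^2 / (T - delta). The two would be equal
   at delta = T - C^2 / z, positive if the claim fails; half of this [delta] makes the competitor
   strictly cheaper. *)
pose z := (e1 + e2) / 2 - sigma * (C - G (p alpha)).
have zC : sigma * C < z.
  suff : sigma * (C + C - G (p alpha)) < (e1 + e2) / 2 by rewrite /z; lra.
  rewrite ltr_pdivlMr// (_ : _ * 2 = 2 * sigma ^+ 2 * (L - alpha))//.
  by rewrite Ga /C; field.
have z0 : 0 < z by apply: le_lt_trans zC; rewrite mulr_ge0// ltW.
have w0 : 0 < C ^+ 2 / z by rewrite divr_gt0// exprn_gt0.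
have wT : C ^+ 2 / z < T.
  by rewrite /T ltr_pdivrMr// mulrAC ltr_pdivlMr// expr2 -mulrA ltr_pM2l// mulrC.
have d1 : 0 < (T - C ^+ 2 / z) / 2 by lra.
have d2 : (T - C ^+ 2 / z) / 2 < T by lra.
have := Emin _ d1 d2; apply/negP; rewrite -ltNge.
have -> : e1 + e2 = 2 * (sigma * (C - G (p alpha)) + z) by rewrite /z; field.
rewrite ltr_pM2l// ltrD2l ltr_pdivrMr; last by lra.
by rewrite -ltr_pdivrMl// mulrC; lra.
Qed.

(** The calibration is applied to [p] on [alpha, L] and to [- p] on the mirror interval. In the sum
    the energies are replaced by their upper bound, sigma (L - alpha) becomes c0 - G(p(alpha)), and
    [calibration_bound] removes [m]. *)
Lemma rise_after_contact (R : realType) (u p k : R -> R) (alpha L sigma : R) :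
  H20_data u p k ->
  (forall x, 0 <= x <= 1 -> u (1 - x) = u x) ->
  (forall x, 0 < x < 1 -> p (1 - x) = - p x) ->
  0 <= alpha < L -> L <= 1 / 2 -> p L = 0 -> 0 <= p alpha -> 0 < sigma ->
  G (p alpha) = c0 R - sigma * (L - alpha) ->
  \int[lebesgue_measure]_(x in `[alpha, L]) energy k p x +
  \int[lebesgue_measure]_(x in `[1 - L, 1 - alpha]) energy k p x <=
    2 * sigma ^+ 2 * (L - alpha) ->
  u L - u alpha <= 2 / sigma * (1 + qf (p alpha)).
Proof.
move=> hu u_sym p_odd /andP[a0 aL] L12 pL pa s0 Ga X.
have cp := H20_data_continuous hu; have hp := H20_data_energy hu.
have [_ p_out _ du _] := hu.
have p_odd' x : 0 <= x <= 1 -> - p (1 - x) = p x.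
  move=> /andP[]; rewrite le_eqVlt => /predU1P[<-|x0].
    by rewrite subr0 !p_out ?oppr0//; [left|right].
  rewrite le_eqVlt => /predU1P[->|x1]; last by rewrite p_odd ?opprK ?x0.
  by rewrite subrr !p_out ?oppr0//; [right|left].
have [xm /andP[axm xmL] pm] := continuous_max_itv (ltW aL) cp.
(* Without a positive slope [u] does not rise after [alpha]; otherwise the maximum [m] may serve as
   divisor. *)
have [m0|m0] := leP (p xm) 0.
  have : u L <= u alpha.
    apply: (der_le0 (ltW aL) (fun x _ => du x)) => x /andP[ax xL].
    by apply: le_trans m0; rewrite pm// !ltW.
  rewrite -subr_le0 => /le_trans; apply.
  by rewrite mulr_ge0 ?divr_ge0 ?addr_ge0// ltW// qf_gt0.
set m := p xm in m0 pm; set y := p alpha in pa Ga *.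
have ym : 0 <= y <= m by rewrite pa pm// lexx ltW.
have cpsi : continuous (fun x => calib m x * qf x ^+ 5).
  by move=> x; apply: cvgM; [exact: continuous_calib|exact: continuous_qfX].
have [Psi [Psi0 dPsi]] := antiderivative cpsi.
have [L1 L10 a1] : [/\ L <= 1, 0 <= 1 - L & 1 - alpha <= 1] by split; lra.
have LA : 1 - L <= 1 - alpha by lra.
have xm01 : 0 <= xm <= 1 by apply/andP; split; lra.
have a01 : 0 <= alpha <= 1 by apply/andP; split; lra.
have L01 : 0 <= L <= 1 by apply/andP; split; lra.
have h1 := ac_energy_sub a0 L1 hp.
have h2 := ac_energyN (ac_energy_sub L10 a1 hp).
have xm_itv : alpha <= xm <= L by rewrite axm.
have k1 := calibration_integral sigma cp du h1 m0 dPsi pm xm_itv erefl.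
have cpn : continuous (fun x => - p x) by move=> x; apply: cvgN; exact: cp.
have dun (x : R) : is_derive x 1 (fun x => - u x) (- p x) by have h := du x; der.
have pmn x : 1 - L <= x <= 1 - alpha -> - p x <= m.
  move=> /andP[xL xa]; rewrite -[x](subKr 1) p_odd'; last by apply/andP; split; lra.
  by apply: pm; apply/andP; split; lra.
have xmn : 1 - L <= 1 - xm <= 1 - alpha by apply/andP; split; lra.
have k2 := calibration_integral sigma cpn dun h2 m0 dPsi pmn xmn (p_odd' _ xm01).
move: k1 k2; rewrite /= !p_odd'// !u_sym// pL Psi0 -/m -/y => k1 k2.
have h_le : sigma * (u L - u alpha) <=
    2 * (m * (c0 R - G y - 2 * Psi m + Psi y)).
  have -> : u L - u alpha = (u L - u alpha) / m * m by rewrite divfK// gt_eqF.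
  move: k1 k2.
  rewrite (_ : - u alpha - - u L = u L - u alpha); last by ring.
  rewrite (_ : 1 - alpha - (1 - L) = L - alpha); last by ring.
  move: (_ / m) => z k1 k2.
  rewrite [leRHS](_ : _ = 2 * (c0 R - G y - 2 * Psi m + Psi y) * m); last by ring.
  rewrite [leLHS](_ : _ = sigma * z * m); last by ring.
  rewrite ler_pM2r// -(ler_pM2l s0).
  move: k1 k2 X; rewrite Ga; move: (Rintegral _ _ _) (Rintegral _ _ _) (Psi m) (Psi y).
  by clear; move=> *; lra.
rewrite -[2 / sigma]mulrC -mulrA mulrC ler_pdivlMr// mulrC.
apply: le_trans h_le _; rewrite ler_pM2l//.
exact: calibration_bound.
Qed.

Theorem theorem1p2 (R : realType) (psi : R -> R)
  (psi_cont : {within `[0, 1], continuous psi})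
  (psi_sym : forall x : R, 0 < x < 1 -> psi x = psi (1 - x))
  (psi_end : psi 0 = psi 1)
  (psi_neg : psi 0 < 0)
  (psi_pos : exists x0 : R, 0 < x0 < 1 /\ 0 < psi x0)
  (minimiser : exists u : R -> R, admissible psi u /\
     elastica u = ereal_inf [set elastica v | v in admissible psi]) :
  exists M : R,
    [/\ is_maximum [set quot_ext y | y in [set y : \bar R | (0 <= y)%E]] M,
        forall x : R, 0 <= x <= 1 -> psi x <= M
      & `|M - (1 + 1890 / 10 ^+ 4 + 4645 / 10 ^+ 8 + 40 / 10 ^+ 10)|
          < 2 / 10 ^+ 10].
Proof.
have [M [M_max quot_le M_val]] := quot_maximum R; exists M; split => //.
have [w [w_adm w_inf]] := minimiser.
have w_min v : admissible psi v -> (elastica w <= elastica v)%E.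
  by move=> hv; rewrite w_inf; apply: ereal_inf_lbound; exists v.
have [u [p [k [hu wu we u_sym p_odd]]]] := symmetric_minimiser w_adm.
have cp := H20_data_continuous hu; have [_ p_out _ du [u0 _]] := hu.
have psi_u x : 0 < x < 1 -> psi x <= u x.
  move=> /andP[x0 x1]; have [_ _ h] := w_adm.
  by rewrite -wu ?(ltW x0) ?(ltW x1)// h// x0.
have p0 : p 0 = 0 by apply: p_out; left.
have half0 : 0 <= 1 / 2 :> R by lra.
have cu : continuous u by move=> x; exact: der_continuous (du x).
have [L /andP[L0 L12] uL_half] := continuous_max_itv half0 cu.
have uL x : 0 <= x <= 1 -> u x <= u L.
  move=> /andP[x0 x1]; have [xh|xh] := leP x (1 / 2); first by apply: uL_half; rewrite x0.
  by rewrite -u_sym ?x0//; apply: uL_half; apply/andP; split; lra.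
have [x0 [/andP[x00 x01] psi_x0]] := psi_pos.
have uL0 : 0 < u L.
  apply: (lt_le_trans psi_x0); apply: (le_trans (psi_u _ _)); first by rewrite x00.
  by apply: uL; rewrite !ltW.
have {}L0 : 0 < L.
  by rewrite lt_neqAle L0 andbT; apply/eqP => e; move: uL0; rewrite -e u0 ltxx.
have pL : p L = 0.
  apply: der_uniq (du L) _; apply: (derive1_at_max (a := 0) (b := 1)) => //.
  - by rewrite in_itv/= L0; lra.
  - by move=> t; rewrite in_itv/= => /andP[t0 t1]; apply: uL; rewrite !ltW.
have [alpha [sigma [aL s0 sL Ga Gp]]] := touching_line cp p0 L0.
(* The increasing line starts at a nonnegative height, so its contact height [G (p alpha)] is
   nonnegative. *)
have pa : 0 <= p alpha.
  rewrite -G_le G0 Ga subr_ge0; apply: le_trans sL; rewrite ler_pM2l//.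
  by move: aL => /andP[a0 _]; rewrite gerBl.
have X := minimiser_energy we w_min hu psi_u u_sym p_odd aL L12 pL pa s0 Ga Gp.
have b1 := rise_before_contact du u0 aL s0 sL Ga Gp.
have b2 := rise_after_contact hu u_sym p_odd aL L12 pL pa s0 Ga X.
have uLM : u L <= M.
  set y0 := Ginv _ in b1.
  have Gy0 : G y0 = c0 R - sigma * L.
    apply: GinvK; rewrite subr_ge0 sL /=.
    apply: le_lt_trans (G_lt_c0 (p alpha)); rewrite Ga lerD2l lerN2 ler_pM2l//.
    by move: aL => /andP[a0 _]; rewrite gerBl.
  have quot0 : 0 <= quot y0.
    by rewrite quotE divr_ge0 ?ltW ?c0_subG_gt0// addr_gt0// qf_gt0.
  (* Adding [b1] and [b2] cancels q(p(alpha)), and sigma L = c0 - G(y0) turns 2 / sigma into 2 L /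
     (c0 - G(y0)). *)
  have uLq : u L <= 2 * L * quot y0.
    rewrite quotE Gy0 (_ : c0 R - (c0 R - sigma * L) = sigma * L); last by ring.
    rewrite (_ : _ * (_ / _) = 2 / sigma * (1 + qf y0)); last first.
      by field; rewrite !gt_eqF.
    by move: b1 b2; rewrite mulrBr !mulrDr => *; lra.
  apply: le_trans (quot_le y0); apply: le_trans uLq _.
  by rewrite ler_piMl//; lra.
(* Admissibility compares [psi] with [u] only inside the interval; at the ends [psi] is negative and
   the bound positive. *)
move=> x /andP[]; rewrite le_eqVlt => /predU1P[<- _|x_0].
  by apply: ltW; apply: lt_trans psi_neg _; apply: lt_le_trans uLM.
rewrite le_eqVlt => /predU1P[->|x_1].
  by rewrite -psi_end; apply: ltW; apply: lt_trans psi_neg _; apply: lt_le_trans uLM.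
apply: (le_trans (psi_u _ _)); first by rewrite x_0.
by apply: le_trans uLM; apply: uL; rewrite !ltW.
Qed.
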